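(* Let $\alpha\in(0,1)$ be an irrational number and let $(a_j/q_j)_{j=0}^\infty$ be the convergents of its continued fraction. If $$\log q_{j+1}=O\left(\frac{q_j}{(\log q_j)^3}\right),$$ then the Bishop operator $T_\alpha$ has a non-trivial closed hyperinvariant subspace in $L^p[0,1)$, for $1\le p\le\infty$.
   Context: The Bishop operator $T_\alpha$ acts on (complex) $L^p[0,1)$, $1\le p\le\infty$, by $T_\alpha f(t)=t\,f(\{t+\alpha\})$ for $t\in[0,1)$, where $\{\cdot\}$ is the fractional part. A closed subspace is hyperinvariant for an operator $T$ if it is invariant under every bounded linear operator commuting with $T$; it is non-trivial if it is neither $\{0\}$ nor the whole space. The convergents $a_j/q_j$ are in lowest terms with $q_j\ge1$. The $O$-condition means that there is a constant $K$ such that $\log q_{j+1}\le K q_j/(\log q_j)^3$ for all sufficiently large $j$. *)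

(* Defs.v *)
From HB Require Import structures.
From mathcomp Require Import all_boot all_order all_algebra.
From mathcomp Require Import all_classical all_reals all_analysis.
From mathcomp Require Import ess_sup_inf measurable_realfun.
From mathcomp Require Import complex lra.

Set Implicit Arguments.
Unset Strict Implicit.
Unset Printing Implicit Defensive.

Import Order.TTheory GRing.Theory Num.Theory.
Import numFieldNormedType.Exports.
Import ComplexField.Normc.

Local Open Scope classical_set_scope.
Local Open Scope ring_scope.
Local Open Scope complex_scope.

Lemma normr_normc (R : rcfType) (z : R[i]) : `|z| = (normc z)%:C.
Proof. by case: z. Qed.

Lemma normc_ge0 (R : rcfType) (z : R[i]) : 0 <= normc z.
Proof. by case: z => a b; exact: sqrtr_ge0. Qed.

Section measurable_complex.
Context d (T : measurableType d) (R : realType).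

Definition cmeasurable (f : T -> R[i]) : Prop :=
  measurable_fun [set: T] (fun x => complex.Re (f x)) /\
  measurable_fun [set: T] (fun x => complex.Im (f x)).

Lemma cmeasurable_cst (c : R[i]) : cmeasurable (cst c).
Proof. by split; exact: measurable_cst. Qed.

Lemma cmeasurableD f g : cmeasurable f -> cmeasurable g -> cmeasurable (f \+ g).
Proof.
move=> [rf jf] [rg jg]; split.
- rewrite (_ : (fun x => _) =
      (fun x => complex.Re (f x)) \+ (fun x => complex.Re (g x))).
    exact: measurable_funD.
  by apply/funext => x /=; case: (f x); case: (g x).
- rewrite (_ : (fun x => _) =
      (fun x => complex.Im (f x)) \+ (fun x => complex.Im (g x))).
    exact: measurable_funD.
  by apply/funext => x /=; case: (f x); case: (g x).
Qed.

Lemma cmeasurableM f g : cmeasurable f -> cmeasurable g ->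
  cmeasurable (fun x => f x * g x).
Proof.
move=> [rf jf] [rg jg]; split.
- rewrite (_ : (fun x => _) =
    ((fun x => complex.Re (f x)) \* (fun x => complex.Re (g x))) \-
    ((fun x => complex.Im (f x)) \* (fun x => complex.Im (g x)))).
    by apply: measurable_funB; exact: measurable_funM.
  by apply/funext => x /=; case: (f x); case: (g x).
- rewrite (_ : (fun x => _) =
    ((fun x => complex.Re (f x)) \* (fun x => complex.Im (g x))) \+
    ((fun x => complex.Im (f x)) \* (fun x => complex.Re (g x)))).
    by apply: measurable_funD; exact: measurable_funM.
  by apply/funext => x /=; case: (f x); case: (g x).
Qed.

Lemma measurable_normc f : cmeasurable f ->
  measurable_fun [set: T] (fun x => normc (f x)).
Proof.
move=> [rf jf]; rewrite (_ : (fun x => _) =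
    (fun x => Num.sqrt (complex.Re (f x) ^+ 2 + complex.Im (f x) ^+ 2))).
  have msqrt : measurable_fun [set: R] (@Num.sqrt R).
    by apply: continuous_measurable_fun; exact: sqrt_continuous.
  apply: (measurableT_comp msqrt).
  by apply: measurable_funD; exact: measurable_funX.
by apply/funext => x; case: (f x).
Qed.

End measurable_complex.

Section le_Lnorm.
Context d (T : measurableType d) (R : realType).
Variables (mu : {measure set T -> \bar R}) (p : \bar R) (p1 : (1 <= p)%E).
Local Open Scope ereal_scope.

Lemma le_Lnorm (f g : T -> R) :
  measurable_fun [set: T] f -> measurable_fun [set: T] g ->
  {ae mu, forall x, `|f x| <= `|g x|}%R ->
  'N[mu]_p[EFin \o f] <= 'N[mu]_p[EFin \o g].
Proof.
have pow_le (a b : \bar R) (s : R) :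
    (0 <= s)%R -> 0 <= a -> a <= b -> a `^ s <= b `^ s.
  move=> s0 a0 ab; apply: (gt0_ler_poweR s0) => //; rewrite in_itv/= leey andbT//.
  exact: le_trans ab.
move=> mf mg fg; rewrite unlock; case: p p1 => [r|_|]; last by [].
- rewrite lee_fin => r1; have r0 : (0 < r)%R by exact: lt_le_trans r1.
  have m (h : T -> R) : measurable_fun [set: T] h ->
      measurable_fun [set: T] (fun x => `|(EFin \o h) x| `^ r).
    move=> mh; apply: (@measurableT_comp _ _ _ _ _ _ (fun x : \bar R => x `^ r)).
      exact: measurable_poweR.
    by apply: measurableT_comp => //; exact/measurable_EFinP.
  apply: (pow_le).
  + by rewrite invr_ge0 ltW.
  + by apply: integral_ge0 => x _; exact: poweR_ge0.
  apply: ae_ge0_le_integral => //.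
  + by move=> x _; exact: poweR_ge0.
  + exact: m.
  + by move=> x _; exact: poweR_ge0.
  + exact: m.
  + apply: filterS fg => x fg _ /=.
    by rewrite lee_fin ge0_ler_powR ?nnegrE// ltW.
- case: ifPn => // _; apply: le_ess_sup; apply: filterS fg => x fg /=.
  by rewrite lee_fin.
Qed.

End le_Lnorm.

Section complex_Lfun.
Context d (T : measurableType d) (R : realType).
Variables (mu : {measure set T -> \bar R}) (p : \bar R).

Definition cLfun : {pred T -> R[i]} :=
  mem [set f | cmeasurable f /\ finite_norm mu p (fun x => normc (f x))].

Lemma cLfunP f : (f \in cLfun) <->
  cmeasurable f /\ finite_norm mu p (fun x => normc (f x)).
Proof. by rewrite inE. Qed.

Hypothesis p1 : (1 <= p)%E.

Lemma cLnormZ (f : T -> R[i]) (c : R[i]) : f \in cLfun ->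
  ('N[mu]_p[EFin \o (fun x => normc ((c *: f)%R x))] =
   (normc c)%:E * 'N[mu]_p[EFin \o (fun x => normc (f x))])%E.
Proof.
move=> /cLfunP[mf nf].
have Lf : (fun x => normc (f x)) \in Lfun mu p.
  by apply/andP; rewrite !inE; split => //; exact: measurable_normc.
have := LnormZ (Lfun_Sub p1 Lf) (normc c).
rewrite ger0_norm ?normc_ge0// => <-.
by apply: eq_Lnorm => x /=; rewrite normcM.
Qed.

Lemma cLnormD (f g : T -> R[i]) : f \in cLfun -> g \in cLfun ->
  ('N[mu]_p[EFin \o (fun x => normc ((f + g)%R x))] <=
   'N[mu]_p[EFin \o (fun x => normc (f x))] +
   'N[mu]_p[EFin \o (fun x => normc (g x))])%E.
Proof.
move=> /cLfunP[mf nf] /cLfunP[mg ng].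
have mnf := measurable_normc mf; have mng := measurable_normc mg.
apply: (le_trans _ (eminkowski mu mnf mng p1)).
apply: le_Lnorm => //.
- exact/measurable_normc/cmeasurableD.
- exact: measurable_funD.
- apply: aeW => x; rewrite !ger0_norm ?addr_ge0 ?normc_ge0//.
  exact: le_normcD.
Qed.

Lemma cLfun_submod_closed : submod_closed cLfun.
Proof.
split=> [|c f g Lf Lg].
  apply/cLfunP; split; first exact: cmeasurable_cst.
  rewrite /finite_norm (_ : _ \o _ = cst 0%E).
    by rewrite Lnorm0 // gt_eqF // (lt_le_trans _ p1).
  by apply/funext => x; congr (_%:E); exact: normc0.
have Lcf : c *: f \in cLfun.
  move/cLfunP: (Lf) => [mf nf]; apply/cLfunP; split.
    have := cmeasurableM (cmeasurable_cst T c) mf.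
    by rewrite (_ : (fun x => _) = c *: f).
  by rewrite /finite_norm cLnormZ// lte_mul_pinfty// lee_fin normc_ge0.
move/cLfunP: (Lcf) => [mcf ncf]; move/cLfunP: (Lg) => [mg ng].
apply/cLfunP; split; first exact: cmeasurableD.
by rewrite /finite_norm (le_lt_trans (cLnormD _ _))// lte_add_pinfty.
Qed.

End complex_Lfun.

Section complex_Lspace.
Context d (T : measurableType d) (R : realType).
Variables (mu : {measure set T -> \bar R}) (p : \bar R).

Record cLfunType (p1 : (1 <= p)%E) := CLfun {
  cLfun_fun :> T -> R[i];
  cLfun_funP : cLfun_fun \in cLfun mu p }.

Variable p1 : (1 <= p)%E.

HB.instance Definition _ := [isSub for @cLfun_fun p1].
HB.instance Definition _ := [Choice of cLfunType p1 by <:].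
HB.instance Definition _ := GRing.isSubmodClosed.Build _ _ (cLfun mu p)
  (cLfun_submod_closed mu p1).
HB.instance Definition _ := [SubChoice_isSubLmodule of cLfunType p1 by <:].

Definition cLeq (f g : cLfunType p1) : bool := `[< f = g %[ae mu] >].

Let cLeq_refl : reflexive cLeq.
Proof. by move=> f; apply/asboolP/aeW. Qed.

Let cLeq_sym : symmetric cLeq.
Proof.
by move=> f g; apply/idP/idP => /asboolP fg; apply/asboolP;
  apply: filterS fg => x /[apply].
Qed.

Let cLeq_trans : transitive cLeq.
Proof.
move=> g f h /asboolP fg /asboolP gh; apply/asboolP.
by apply: filterS2 fg gh => x fg gh xT; rewrite fg// gh.
Qed.

Canonical cLeq_equiv := EquivRel cLeq cLeq_refl cLeq_sym cLeq_trans.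

Local Open Scope quotient_scope.

Definition cLspace : Type := {eq_quot cLeq}.
HB.instance Definition _ := Choice.on cLspace.
HB.instance Definition _ := EqQuotient.on cLspace.

Implicit Types f g h : cLfunType p1.

Definition toL f : cLspace := \pi_cLspace f.

Lemma toL_eqP f g : toL f = toL g <-> f = g %[ae mu].
Proof.
by split=> [/eqquotP/asboolP//|fg]; apply/eqquotP/asboolP.
Qed.

Lemma reprLK (u : cLspace) : toL (repr u) = u.
Proof. exact: reprK. Qed.

Lemma repr_toL f : repr (toL f) = f %[ae mu].
Proof. by apply/toL_eqP; rewrite reprLK. Qed.

Definition cLadd (u v : cLspace) : cLspace := toL (repr u + repr v).
Definition cLopp (u : cLspace) : cLspace := toL (- repr u).
Definition cLscale (c : R[i]) (u : cLspace) : cLspace := toL (c *: repr u).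

Lemma cLaddE f g : cLadd (toL f) (toL g) = toL (f + g).
Proof.
apply/toL_eqP; apply: filterS2 (repr_toL f) (repr_toL g) => x fE gE xT.
by rewrite /= -[LHS]/((repr (toL f)) x + (repr (toL g)) x) fE// gE.
Qed.

Lemma cLoppE f : cLopp (toL f) = toL (- f).
Proof.
apply/toL_eqP; apply: filterS (repr_toL f) => x fE xT.
by rewrite /= -[LHS]/(- (repr (toL f)) x) fE.
Qed.

Lemma cLscaleE c f : cLscale c (toL f) = toL (c *: f).
Proof.
apply/toL_eqP; apply: filterS (repr_toL f) => x fE xT.
by rewrite /= -[LHS]/(c *: (repr (toL f)) x) fE.
Qed.

Let cLaddA : associative cLadd.
Proof.
move=> u v w; rewrite -(reprLK u) -(reprLK v) -(reprLK w).
by rewrite !cLaddE addrA.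
Qed.

Let cLaddC : commutative cLadd.
Proof.
by move=> u v; rewrite -(reprLK u) -(reprLK v) !cLaddE addrC.
Qed.

Let cLadd0 : left_id (toL 0) cLadd.
Proof. by move=> u; rewrite -(reprLK u) cLaddE add0r. Qed.

Let cLaddN : left_inverse (toL 0) cLopp cLadd.
Proof. by move=> u; rewrite -(reprLK u) cLoppE cLaddE addNr. Qed.

HB.instance Definition _ :=
  GRing.isZmodule.Build cLspace cLaddA cLaddC cLadd0 cLaddN.

Lemma toLD f g : toL f + toL g = toL (f + g).
Proof. exact: cLaddE. Qed.

Let cLscaleA a b (u : cLspace) : cLscale a (cLscale b u) = cLscale (a * b) u.
Proof. by rewrite -(reprLK u) !cLscaleE scalerA. Qed.

Let cLscale1 : left_id 1 cLscale.
Proof. by move=> u; rewrite -(reprLK u) cLscaleE scale1r. Qed.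

Let cLscaleDr : right_distributive cLscale +%R.
Proof.
move=> a u v; rewrite -(reprLK u) -(reprLK v) toLD !cLscaleE toLD.
by rewrite scalerDr.
Qed.

Let cLscaleDl (u : cLspace) : {morph cLscale^~ u : a b / a + b}.
Proof.
by move=> a b; rewrite -(reprLK u) !cLscaleE toLD scalerDl.
Qed.

HB.instance Definition _ := GRing.Zmodule_isLmodule.Build R[i] cLspace
  cLscaleA cLscale1 cLscaleDr cLscaleDl.

Lemma toLZ c f : c *: toL f = toL (c *: f).
Proof. exact: cLscaleE. Qed.

Definition cLfun_norm f : R := fine ('N[mu]_p[EFin \o (fun x => normc (f x))])%E.

Definition cLnorm (u : cLspace) : R[i] := (cLfun_norm (repr u))%:C.

Lemma cLfun_normE f :
  (cLfun_norm f)%:E = ('N[mu]_p[EFin \o (fun x => normc (f x))])%E.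
Proof.
rewrite /cLfun_norm fineK// ge0_fin_numE ?Lnorm_ge0//.
by have /cLfunP[] := cLfun_funP f.
Qed.

Lemma le_cLfun_norm f g : {ae mu, forall x, normc (f x) <= normc (g x)} ->
  cLfun_norm f <= cLfun_norm g.
Proof.
move=> fg; rewrite -lee_fin !cLfun_normE; apply: le_Lnorm => //.
- by apply: measurable_normc; have /cLfunP[] := cLfun_funP f.
- by apply: measurable_normc; have /cLfunP[] := cLfun_funP g.
- by apply: filterS fg => x; rewrite !ger0_norm ?normc_ge0.
Qed.

Lemma cLnormE f : cLnorm (toL f) = (cLfun_norm f)%:C.
Proof.
congr (_%:C); apply/eqP; rewrite eq_le; apply/andP; split; apply: le_cLfun_norm;
  by apply: filterS (repr_toL f) => x -> .
Qed.

Let cLnorm_triangle u v : cLnorm (u + v) <= cLnorm u + cLnorm v.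
Proof.
rewrite -(reprLK u) -(reprLK v) toLD !cLnormE -rmorphD/= lecR.
rewrite -lee_fin EFinD !cLfun_normE.
exact: (cLnormD p1 (cLfun_funP _) (cLfun_funP _)).
Qed.

Let cLnorm_scale c u : cLnorm (c *: u) = `|c| * cLnorm u.
Proof.
rewrite -(reprLK u) toLZ !cLnormE normr_normc -rmorphM/=; congr (_%:C).
apply: EFin_inj; rewrite EFinM !cLfun_normE.
exact: (cLnormZ p1 c (cLfun_funP _)).
Qed.

Let cLnorm_eq0 u : cLnorm u = 0 -> u = 0.
Proof.
rewrite -(reprLK u) cLnormE => -[n0]; apply/toL_eqP.
set f := repr u in n0 *.
have mf : measurable_fun [set: T] (EFin \o (fun x => normc (f x))).
  apply/measurable_EFinP/measurable_normc.
  by have /cLfunP[] := cLfun_funP f.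
have N0 : ('N[mu]_p[EFin \o (fun x => normc (f x))] = 0)%E.
  by rewrite -cLfun_normE n0.
have := Lnorm_eq0_eq0 mf (lt_le_trans lte01 p1) N0.
by apply: filterS => x /[apply] -[] /eq0_normc.
Qed.

HB.instance Definition _ := Lmodule_isNormed.Build R[i] cLspace
  cLnorm_triangle cLnorm_scale cLnorm_eq0.

Lemma norm_toL f : `|toL f| = (cLfun_norm f)%:C.
Proof. exact: cLnormE. Qed.

End complex_Lspace.

Definition fracpart (R : realType) (x : R) : R := x - (Num.floor x)%:~R.

Lemma measurable_fracpart (R : realType) :
  measurable_fun [set: R] (@fracpart R).
Proof.
apply: measurable_funB => //; apply: nondecreasing_measurable => // x y xy.
by rewrite ler_int le_floor.
Qed.

Section rotation.
Context (R : realType).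
Local Notation lambda := (@lebesgue_measure R).
Implicit Types (A : set R) (a c t : R).

Lemma lebesgue_measure_translation c A : measurable A ->
  lambda ((fun t => t + c) @^-1` A) = lambda A.
Proof.
have mc : measurable_fun [set: measurableTypeR R]
    ((fun t => t + c) : _ -> measurableTypeR R).
  exact: measurable_funD.
pose h : {mfun measurableTypeR R >-> measurableTypeR R} :=
  HB.pack ((fun t => t + c) : _ -> measurableTypeR R)
    (isMeasurableFun.Build _ _ _ _ _ mc).
move=> mA; rewrite -[LHS]/(pushforward lambda h A); apply/esym.
apply: lebesgue_measure_unique => //= _ [[a b]] _ <-.
rewrite /pushforward.
have -> : h @^-1` `]a, b] = `]a - c, b - c]%classic.
  by apply/seteqP; split => x /=; rewrite !in_itv/= ltrBlDr lerBrDr.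
rewrite !lebesgue_measure_itv/= !lte_fin ltrD2r.
by case: ifP => // _; rewrite -!EFinD; congr (_%:E); lra.
Qed.

Definition rotation a t : R := fracpart (t + a).

Lemma measurable_rotation a : measurable_fun [set: R] (rotation a).
Proof.
apply: (measurableT_comp (@measurable_fracpart R)).
exact: measurable_funD.
Qed.

Lemma rotationE a t : 0 <= t < 1 ->
  rotation a t = if t + fracpart a < 1 then t + fracpart a
                 else t + fracpart a - 1.
Proof.
move=> /andP[t0 t1]; rewrite /rotation /fracpart.
have /andP[fa fa1] := floor_itv a; rewrite intrD in fa1.
case: ifPn => [ta|]; last rewrite -leNgt => ta.
- suff -> : Num.floor (t + a) = Num.floor a by lra.
  by apply: floor_def; rewrite intrD; apply/andP; split; lra.
- suff -> : Num.floor (t + a) = Num.floor a + 1 by rewrite intrD; lra.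
  by apply: floor_def; rewrite !intrD; apply/andP; split; lra.
Qed.

Lemma rotation_preserving a A : measurable A ->
  lambda (rotation a @^-1` A `&` `[0, 1[) = lambda (A `&` `[0, 1[).
Proof.
move=> mA; set b := fracpart a.
have /andP[b0 b1] : 0 <= b < 1.
  rewrite /b /fracpart; have /andP[fa fa1] := floor_itv a.
  by rewrite intrD in fa1; apply/andP; split; lra.
have m1 : measurable (A `&` `[b, 1[) by exact: measurableI.
have m2 : measurable (A `&` `[0, b[) by exact: measurableI.
have mt c B : measurable B -> measurable ((fun t : R => t + c) @^-1` B).
  move=> mB; rewrite -[X in measurable X]setTI.
  have mc : measurable_fun [set: R] (fun t : R => t + c).
    exact: measurable_funD.
  exact: mc.
transitivity (lambda (((fun t : R => t + b) @^-1` (A `&` `[b, 1[)) `|`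
                      ((fun t : R => t + (b - 1)) @^-1` (A `&` `[0, b[)))).
  congr (lambda _); apply/seteqP; split => [t [/= At]|t /=].
  - rewrite in_itv/= => t01; move: At; rewrite rotationE// -/b.
    case: ifPn => [tb|]; last rewrite -leNgt => tb; move=> At.
    + by left; split => //; rewrite in_itv/=; lra.
    + by right; rewrite addrA; split => //; rewrite in_itv/=; lra.
  - rewrite !in_itv/= => -[] [At] /andP[tb tb1].
    + have t01 : 0 <= t < 1 by lra.
      by rewrite rotationE// -/b ifT.
    + have t01 : 0 <= t < 1 by lra.
      have tbF : (t + b < 1) = false by apply/negbTE; rewrite -leNgt; lra.
      by rewrite rotationE// -/b tbF -addrA.
rewrite measureU; [|exact: mt|exact: mt|]; last first.
  rewrite -subset0 => t [[_ /=]]; rewrite in_itv/= => h1 [_ /=].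
  by rewrite in_itv/= => h2; lra.
transitivity (lambda (A `&` `[b, 1%R[) + lambda (A `&` `[0%R, b[))%E.
  by congr (_ + _)%E; exact: lebesgue_measure_translation.
rewrite -measureU//; last first.
  rewrite -subset0 => t [[_ /=]]; rewrite in_itv/= => h1 [_ /=].
  by rewrite in_itv/= => h2; lra.
rewrite -setIUr; congr (lambda (A `&` _)); apply/seteqP; split => t /=;
  rewrite !in_itv/=; last by case: (ltP t b) => tb h; [right|left]; lra.
by case=> h; lra.
Qed.

End rotation.

(* The restriction of Lebesgue measure to [0,1): functions on the line modulo
   equality almost everywhere for this measure are functions on [0,1) modulo
   equality almost everywhere. *)
Definition lebesgue01 (R : realType) :
    {measure set (measurableTypeR R) -> \bar R} :=
  mrestr (@lebesgue_measure R) (@measurable_itv R `[0, 1[).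

Section lebesgue01_theory.
Context (R : realType).
Local Notation mu := (lebesgue01 R).

Lemma ae_lebesgue01 (P : R -> Prop) :
  (forall t, 0 <= t < 1 -> P t) -> {ae mu, forall t, P t}.
Proof.
move=> P01; exists (~` `[0, 1[%classic); split.
- by apply: measurableC; exact: measurable_itv.
- by rewrite /= /lebesgue01/= /mrestr setICl measure0.
- by move=> t nP /=; rewrite in_itv/= => /P01.
Qed.

Lemma lebesgue01_rotation a (A : set R) : measurable A ->
  mu (rotation a @^-1` A) = mu A.
Proof. exact: rotation_preserving. Qed.

Lemma ae_rotation a (P : R -> Prop) :
  {ae mu, forall t, P t} -> {ae mu, forall t, P (rotation a t)}.
Proof.
move=> [N [mN N0 PN]]; exists (rotation a @^-1` N); split.
- by rewrite -[X in measurable X]setTI; exact: measurable_rotation.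
- by rewrite lebesgue01_rotation.
- by move=> t nP; exact: PN.
Qed.

Lemma Lnorm_rotation a (p : \bar R) (g : R -> R) :
  (1 <= p)%E -> measurable_fun [set: R] g ->
  ('N[mu]_p[EFin \o (g \o rotation a)] <= 'N[mu]_p[EFin \o g])%E.
Proof.
rewrite unlock; case: p => [r r1|_|]; [move=> mg|move=> mg|by []].
- set G := (fun x : R => `|(EFin \o g) x| `^ r)%E.
  have mG : measurable_fun [set: R] G.
    apply: (@measurableT_comp _ _ _ _ _ _ (fun x : \bar R => x `^ r)%E).
      exact: measurable_poweR.
    by apply: measurableT_comp => //; exact/measurable_EFinP.
  rewrite (_ : (\int[mu]_x _)%E = (\int[mu]_x G x)%E)//.
  have mr : measurable_fun [set: measurableTypeR R]
      (rotation a : _ -> measurableTypeR R) by exact: measurable_rotation.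
  pose mrot : {mfun measurableTypeR R >-> measurableTypeR R} :=
    HB.pack (rotation a : _ -> measurableTypeR R)
      (isMeasurableFun.Build _ _ _ _ _ mr).
  transitivity (\int[pushforward mu mrot]_x G x)%E; last first.
    by apply: eq_measure_integral => A mA _; exact: lebesgue01_rotation.
  by rewrite ge0_integral_pushforward// => x _; exact: poweR_ge0.
- case: ifPn => // _; apply/ess_supP.
  by apply: (@ae_rotation a (fun t => `|(g t)%:E| <= _)%E); exact: ess_sup_ge.
Qed.

End lebesgue01_theory.

Section bishop.
Context (R : realType) (p : \bar R) (p1 : (1 <= p)%E) (alpha : R).
Local Notation mu := (lebesgue01 R).

Definition bishop_map (f : R -> R[i]) (t : R) : R[i] :=
  t%:C * f (fracpart (t + alpha)).

Lemma cmeasurable_bishop (f : R -> R[i]) :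
  @cmeasurable _ (measurableTypeR R) R f ->
  @cmeasurable _ (measurableTypeR R) R (bishop_map f).
Proof.
move=> [rf jf]; apply: cmeasurableM.
  by split; [exact: measurable_id|exact: measurable_cst].
by split; [exact: (measurableT_comp rf (measurable_rotation alpha))|
           exact: (measurableT_comp jf (measurable_rotation alpha))].
Qed.

Lemma bishop_Lnorm (f : R -> R[i]) : @cmeasurable _ (measurableTypeR R) R f ->
  ('N[mu]_p[EFin \o (fun t => normc (bishop_map f t))] <=
   'N[mu]_p[EFin \o (fun t => normc (f t))])%E.
Proof.
move=> mf; apply: le_trans (Lnorm_rotation alpha p1 (measurable_normc mf)).
apply: le_Lnorm => //.
- exact/measurable_normc/cmeasurable_bishop.
- exact: (measurableT_comp (measurable_normc mf) (measurable_rotation alpha)).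
- apply: ae_lebesgue01 => t /andP[t0 t1]; rewrite !ger0_norm ?normc_ge0//=.
  rewrite normcM ler_piMl ?normc_ge0//= expr0n addr0 sqrtr_sqr ger0_norm//.
  exact: ltW.
Qed.

Lemma cLfun_bishop (f : cLfunType mu p1) :
  bishop_map f \in cLfun mu p.
Proof.
have /cLfunP[mf nf] := cLfun_funP f.
apply/cLfunP; split; first exact: cmeasurable_bishop.
exact: le_lt_trans (bishop_Lnorm mf) nf.
Qed.

Definition bishop_fun (f : cLfunType mu p1) : cLfunType mu p1 :=
  CLfun p1 (cLfun_bishop f).

(* The choice of representative is immaterial, see [bishopE]. *)
Definition bishop (u : cLspace mu p1) : cLspace mu p1 :=
  toL (bishop_fun (repr u)).

Lemma bishopE (f : cLfunType mu p1) : bishop (toL f) = toL (bishop_fun f).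
Proof.
apply/toL_eqP; have [N [mN N0 fN]] := ae_rotation alpha (repr_toL f).
exists N; split=> // t /= tN; apply: fN => fE; apply: tN => _.
by rewrite /= /bishop_map fE.
Qed.

Lemma bishop_is_linear : linear bishop.
Proof.
move=> c u v; rewrite -(reprLK u) -(reprLK v) toLZ toLD !bishopE toLZ toLD.
congr toL; apply: val_inj; apply/funext => t.
rewrite /= /bishop_map -[LHS]/(t%:C * (c * _ + _)) -[RHS]/(c * (_ * _) + _ * _).
by rewrite mulrDr mulrCA.
Qed.

HB.instance Definition _ :=
  GRing.isLinear.Build R[i] (cLspace mu p1) (cLspace mu p1) _ bishop
    bishop_is_linear.

End bishop.

Arguments bishop {R p} p1 alpha u.

Section operators.
Context (K : numFieldType) (V : normedModType K).

Definition bounded_operator (S : V -> V) : Prop :=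
  exists C : K, forall x, `|S x| <= C * `|x|.

Definition closed_subspace (M : set V) : Prop :=
  submod_closed (mem M) /\ closed M.

Definition hyperinvariant (T : V -> V) (M : set V) : Prop :=
  forall S : {linear V -> V}, bounded_operator S ->
    (forall x, S (T x) = T (S x)) -> forall x, M x -> M (S x).

Definition nontrivial_subspace (M : set V) : Prop :=
  M <> [set 0] /\ M <> [set: V].

End operators.

Lemma bishop_bounded (R : realType) (p : \bar R) (p1 : (1 <= p)%E) (alpha : R) :
  bounded_operator (bishop p1 alpha).
Proof.
exists 1 => u; rewrite mul1r -(reprLK u) bishopE !norm_toL lecR.
have /cLfunP[mf _] := cLfun_funP (repr u).
rewrite -lee_fin !cLfun_normE; exact: (bishop_Lnorm p1 alpha mf).
Qed.

Section continued_fraction.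
Context (R : realType) (alpha : R).

Definition complete_quotient (n : nat) : R :=
  iter n (fun x => (fracpart x)^-1) alpha.

Definition partial_quotient (n : nat) : int := Num.floor (complete_quotient n).

(* The base case relies on 0^-1 = 0: the fraction [:: a] evaluates to a. *)
Fixpoint cf_eval (s : seq int) : rat :=
  if s is a :: s' then a%:~R + (cf_eval s')^-1 else 0.

Definition convergent (j : nat) : rat :=
  cf_eval (mkseq partial_quotient j.+1).

Definition convergent_den (j : nat) : R := (denq (convergent j))%:~R.

End continued_fraction.

(* Main.v *)
Require Import Defs.
From HB Require Import structures.
From mathcomp Require Import all_boot all_order all_algebra.
From mathcomp Require Import all_classical all_reals all_analysis.
From mathcomp Require Import ess_sup_inf measurable_realfun complex.
From mathcomp Require Import zify ring lra.

(* Let B be the set of s such that s + j alpha stays at distance at least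
   c / (1 + |j|)^2 from the integers for every j in Z; it has positive measure.
   For s in B and a convergent denominator q, the sum of 1 + ln {s + i alpha}
   over a block of b q consecutive indices is O(b (1 + ln q)): over one block
   the points are close to the grid (1/q) Z, whose log-sum is given by Stirling's
   formula, and the few points close to 0 drift along an arithmetic progression.
   Decomposing n along the convergents, the iterates (e T)^n of 1_B, and those of
   1_B under the transpose, are bounded by exp (w |n|) for all n in Z, and the
   growth condition on the denominators gives sum_j w (2^j) / 2^j < oo.

   For such a non-quasianalytic weight, an infinite product
   c_n = prod_j cos(pi n / 2^(j+2))^(2 m_j) decays faster than exp (- w (2 |n|)),
   while the Fourier series with coefficients c_n has small support; hence
   sum_m c_m c_(n-m) e^(i m theta) = 0 for theta away from 0.  Put
   X = sum_n c_n (e T)^n 1_B, which is at least 1_B, and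
   Y = e^(2 i pi k t) sum_m c_m (e T')^m 1_B, where k alpha lies in the middle
   half of the circle.  If S commutes with T, the pairing of Y with S X is a
   combination of these vanishing convolutions, so it is 0.  The vectors u such
   that Y annihilates S u for every S commuting with T form a closed
   hyperinvariant subspace, which contains X and is not the whole space. *)

Set Implicit Arguments.
Unset Strict Implicit.
Unset Printing Implicit Defensive.

Import Order.TTheory GRing.Theory Num.Theory.
Import numFieldNormedType.Exports.
Import ComplexField.Normc.

Local Open Scope classical_set_scope.
Local Open Scope ring_scope.
Local Open Scope complex_scope.

(** * Symmetric sums and rapidly decaying coefficients *)

Section symmetric_sums.

(** The factor e is forced by the mean of ln on [0,1), which is -1: iterates of e T involve Birkhoff
    sums of 1 + ln t, of mean zero, so that the weight w records only their fluctuation. The twist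
    e^(2 i pi k t) separates X from Y. Rotation by alpha multiplies it by e^(2 i pi k alpha), so the
    pairing of S x_n with the twisted m-th dual iterate depends only on n + m, up to a phase m theta
    with theta = 2 pi (k alpha - l). The convolutions of c are therefore evaluated at theta, far
    from the support near 0. Proving X and Y nonzero would be delicate for a general multiplier.
    Here c is nonnegative with c_0 = 1 and both orbits are nonnegative functions, so nothing
    cancels. Supports of Fourier series are never formed: they are replaced by bounds on sums of
    partial sums, stable under modulation and pointwise limits, and the orthogonality is reached
    through finite sums with error O(1/N). Only bounded functions occur, as vectors and as
    functionals, so all p are treated alike and the dual space for p = infinity is not involved. *)

Definition symsum (V : zmodType) (f : int -> V) (N : nat) : V :=
  f 0 + \sum_(i < N) (f i.+1%:Z + f (- i.+1%:Z)).

Lemma symsum0 (V : zmodType) (f : int -> V) : symsum f 0 = f 0.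
Proof. by rewrite /symsum big_ord0 addr0. Qed.

Lemma symsumS (V : zmodType) (f : int -> V) N :
  symsum f N.+1 = symsum f N + (f N.+1%:Z + f (- N.+1%:Z)).
Proof. by rewrite /symsum big_ord_recr /= addrA. Qed.

Lemma eq_symsum (V : zmodType) (f g : int -> V) N :
  f =1 g -> symsum f N = symsum g N.
Proof. by move=> fg; rewrite /symsum fg; under eq_bigr do rewrite !fg. Qed.

Lemma symsum_morph (U V : zmodType) (h : {additive U -> V}) (f : int -> U) N :
  h (symsum f N) = symsum (fun n => h (f n)) N.
Proof.
elim: N => [|N IH]; first by rewrite !symsum0.
by rewrite symsumS [RHS]symsumS -IH raddfD; congr (_ + _); exact: raddfD.
Qed.

Lemma symsumD (V : zmodType) (f g : int -> V) N :
  symsum (fun n => f n + g n) N = symsum f N + symsum g N.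
Proof.
elim: N => [|N IH]; first by rewrite !symsum0.
by rewrite !symsumS IH [RHS]addrACA; congr (_ + _); rewrite addrACA.
Qed.

Lemma symsumM (K : comNzRingType) (a : K) (f : int -> K) N :
  symsum (fun n => a * f n) N = a * symsum f N.
Proof.
elim: N => [|N IH]; first by rewrite !symsum0.
by rewrite !symsumS IH !mulrDr.
Qed.

Lemma exchange_symsum (V : zmodType) (f : int -> int -> V) M N :
  symsum (fun m => symsum (f m) N) M = symsum (fun n => symsum (f ^~ n) M) N.
Proof.
elim: M => [|M IH].
  by rewrite symsum0; apply: eq_symsum => n; rewrite symsum0.
rewrite symsumS IH -!symsumD; apply: eq_symsum => n.
by rewrite symsumS.
Qed.

Lemma symsum_shift1 (V : zmodType) (f : int -> V) N :
  symsum (fun n => f (n + 1)) N = symsum f N + f N.+1%:Z - f (- N%:Z).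
Proof.
elim: N => [|N IH].
  by rewrite !symsum0 add0r oppr0 addrAC subrr add0r.
have E (a b c d e : V) : a + b - c + (d + c) = a + (b + e) + d - e.
  by rewrite (addrC d) addrA subrK [RHS]addrAC addrA addrK.
rewrite !symsumS IH -PoszD addn1.
have -> : - (N.+1)%:Z + 1 = - N%:Z by rewrite -addn1 PoszD opprD addrNK.
exact: E.
Qed.

Lemma ler_norm_symsum (R : numDomainType) (V : normedZmodType R)
    (f : int -> V) N :
  `|symsum f N| <= symsum (fun n => `|f n|) N.
Proof.
elim: N => [|N IH]; first by rewrite !symsum0.
rewrite !symsumS (le_trans (ler_normD _ _))// lerD//.
exact: ler_normD.
Qed.

Lemma symsum_cst (R : comNzRingType) (a : R) N :
  symsum (fun=> a) N = a * (N.*2.+1)%:R.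
Proof.
elim: N => [|N IH]; first by rewrite symsum0 mulr1.
by rewrite symsumS IH doubleS -[N.*2.+3]addn2 natrD mulrDr; congr (_ + _); ring.
Qed.

Lemma ler_symsum_bound (R : numDomainType) (f g : int -> R) N :
  (forall n, (`|n| <= N)%N -> f n <= g n) -> symsum f N <= symsum g N.
Proof.
elim: N => [|N IH] fg; first by rewrite !symsum0 fg.
rewrite !symsumS lerD//; last by rewrite lerD// fg// abszN.
by apply: IH => n nN; rewrite fg// (leq_trans nN).
Qed.

(** The majorant K / (n (n + 1)) telescopes: the pairs n, -n with N < n <= M contribute at most 2 K
    (1/(N+1) - 1/(M+1)), which is the form that the induction on M carries. *)
Lemma symsum_tail (R : realFieldType) (f : int -> R) (K : R) N M :
  (forall n : int, (N < `|n|)%N ->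
    `|f n| <= K / (`|n|%:R * (`|n|.+1)%:R)) ->
  (N <= M)%N -> `|symsum f M - symsum f N| <= 2 * K / N.+1%:R.
Proof.
move=> fK NM.
have K0 : 0 <= K.
  have := fK N.+1%:Z (ltnSn _); rewrite absz_nat => /(le_trans (normr_ge0 _)).
  by rewrite pmulr_lge0// invr_gt0 -natrM ltr0n.
suff H : `|symsum f M - symsum f N| <= 2 * K * (N.+1%:R^-1 - M.+1%:R^-1).
  apply: (le_trans H); rewrite ler_wpM2l//; first lra.
  by rewrite gerBl invr_ge0.
elim: M NM => [|M IH].
  by rewrite leqn0 => /eqP ->; rewrite !subrr normr0 mulr0.
rewrite leq_eqVlt => /predU1P[<-|NM]; first by rewrite !subrr normr0 mulr0.
rewrite symsumS addrAC (le_trans (ler_normD _ _))//.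
have h1 := fK M.+1%:Z NM; have h2 := fK (- M.+1%:Z).
rewrite abszN in h2; have {}h2 := h2 NM; rewrite absz_nat in h1 h2.
have h3 := ler_normD (f M.+1%:Z) (f (- M.+1%:Z)).
have {}IH := IH NM.
apply: (le_trans (lerD IH (le_trans h3 (lerD h1 h2)))).
rewrite -[M.+2%:R]natr1.
have M0 : 0 < M.+1%:R :> R by [].
have -> : K / (M.+1%:R * (M.+1%:R + 1)) = K * (M.+1%:R^-1 - (M.+1%:R + 1)^-1).
  by field; lra.
by rewrite le_eqVlt; apply/orP; left; apply/eqP; ring.
Qed.

End symmetric_sums.

(** * Fourier series vanishing off an arc, through sums of partial sums *)

Section band_limited.
Variable R : realType.
Implicit Types (A theta tau : R) (e : int -> R).

(** This is N times the Cesaro mean. The phase tau covers the real and imaginary parts of the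
    Fourier series at once. *)
Definition cesaro e theta tau (N : nat) : R :=
  \sum_(r < N) symsum (fun n => e n * cos (n%:~R * theta + tau)) r.

Definition fejer_bound : R := 2 / (1 - cos (pi / 4)).

(** Encodes a support within A of 0 on the circle, with a margin pi / 4. A bound on [cesaro]
    independent of N makes the means tend to 0, and one constant shared by all sequences survives
    modulations and pointwise limits. *)
Definition band_limited A e := forall theta tau N,
  pi / 4 + A <= theta <= pi *+ 2 - pi / 4 - A ->
  `|cesaro e theta tau N| <= fejer_bound.

Lemma cos_piquarter_lt1 : cos (pi / 4) < 1 :> R.
Proof.
by have p0 := pi_gt0 R; rewrite -[X in _ < X]cos0 ltr_cos ?in_itv/=; lra.
Qed.

Lemma fejer_bound_gt0 : 0 < fejer_bound.
Proof. by rewrite divr_gt0// subr_gt0 cos_piquarter_lt1. Qed.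

Lemma cos_le_piquarter theta : pi / 4 <= theta <= pi *+ 2 - pi / 4 ->
  cos theta <= cos (pi / 4).
Proof.
have p0 := pi_gt0 R.
wlog tp : theta / theta <= pi => [H|].
  have [tp|tp] := leP theta pi; first exact: H.
  move=> h; have -> : cos theta = cos (pi *+ 2 - theta).
    by rewrite -[RHS]cosN opprB -[RHS]cosD2pi subrK.
  by apply: H; rewrite mulr2n in h *; lra.
move=> /andP[t1 _]; rewrite leNgt; apply/negP.
by rewrite ltr_cos ?in_itv/=; lra.
Qed.

Lemma dirichlet_kernel theta tau r :
  (1 - cos theta) * symsum (fun n => 1 * cos (n%:~R * theta + tau)) r =
  cos tau * (cos (r%:R * theta) - cos (r.+1%:R * theta)).
Proof.
elim: r => [|r IH].
  by rewrite symsum0 !mul0r add0r cos0 !mul1r mulrC.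
rewrite symsumS mulrDr IH !mul1r intrN mulNr -!pmulrn.
set x := r.+1%:R * theta.
have -> : cos (x + tau) + cos (- x + tau) = 2 * cos tau * cos x.
  by rewrite !cosD cosN sinN; ring.
have -> : r%:R * theta = x - theta by rewrite /x -natr1; ring.
have -> : r.+2%:R * theta = x + theta by rewrite /x -[r.+2%:R]natr1; ring.
by rewrite cosB cosD; ring.
Qed.

(** The case of the Dirac mass at 0. Multiplied by 1 - cos theta, the partial sums become
    differences (the Dirichlet kernel), and their sum telescopes to cos tau (1 - cos (N theta)), at
    most 2 in absolute value; this is the origin of [fejer_bound]. *)
Lemma band_limited1 : band_limited 0 (fun=> 1).
Proof.
move=> theta tau N; rewrite addr0 subr0 => tpi.
have c1 := cos_le_piquarter tpi; have c2 := cos_piquarter_lt1.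
have H : (1 - cos theta) * cesaro (fun=> 1) theta tau N =
    cos tau * (1 - cos (N%:R * theta)).
  rewrite /cesaro mulr_sumr; elim: N => [|N IH].
    by rewrite big_ord0 mul0r cos0 subrr mulr0.
  by rewrite big_ord_recr/= IH dirichlet_kernel; ring.
have d0 : 0 < 1 - cos theta by lra.
have : `|(1 - cos theta) * cesaro (fun=> 1) theta tau N| <= 2.
  rewrite H normrM; have h1 := cos_max tau.
  have h2 : `|1 - cos (N%:R * theta)| <= 2.
    have := cos_le1 (N%:R * theta); have := cos_geN1 (N%:R * theta).
    by move=> *; rewrite ler_norml; lra.
  by rewrite -[2]mul1r ler_pM.
rewrite normrM gtr0_norm// mulrC -ler_pdivlMr// => /le_trans; apply.
by rewrite ler_wpM2l// lef_pV2 ?posrE; lra.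
Qed.

Lemma cesaro_cos e a (m : int) theta tau N :
  cesaro (fun n => cos (a * (n - m)%:~R) * e n) theta tau N =
  2^-1 * (cesaro e (theta + a) (tau - a * m%:~R) N +
          cesaro e (theta - a) (tau + a * m%:~R) N).
Proof.
rewrite /cesaro -big_split mulr_sumr; apply: eq_bigr => r _.
rewrite /= -symsumD -symsumM; apply: eq_symsum => n.
rewrite intrB.
have -> : n%:~R * (theta + a) + (tau - a * m%:~R) =
  (n%:~R * theta + tau) + a * (n%:~R - m%:~R) by ring.
have -> : n%:~R * (theta - a) + (tau + a * m%:~R) =
  (n%:~R * theta + tau) - a * (n%:~R - m%:~R) by ring.
by rewrite (cosD _ (a * _)) cosB; field.
Qed.

(** By the product formula for cosines, the new series is the average of two translates by a and -a,
    so the bound is kept and the support widens by a. The centre m only changes the phase tau. *)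
Lemma band_limited_cos A a (m : int) e : 0 <= a -> band_limited A e ->
  band_limited (A + a) (fun n => cos (a * (n - m)%:~R) * e n).
Proof.
move=> a0 Ae theta tau N h; rewrite cesaro_cos.
have h1 : `|cesaro e (theta + a) (tau - a * m%:~R) N| <= fejer_bound.
  by apply: Ae; lra.
have h2 : `|cesaro e (theta - a) (tau + a * m%:~R) N| <= fejer_bound.
  by apply: Ae; lra.
rewrite normrM gtr0_norm ?invr_gt0//.
have := ler_normD (cesaro e (theta + a) (tau - a * m%:~R) N)
  (cesaro e (theta - a) (tau + a * m%:~R) N).
by lra.
Qed.

Lemma eq_band_limited A e1 e2 : e1 =1 e2 ->
  band_limited A e1 -> band_limited A e2.
Proof. by move=> /funext ->. Qed.

Lemma band_limitedW A B e : A <= B -> band_limited A e -> band_limited B e.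
Proof. by move=> AB Ae theta tau N h; apply: Ae; lra. Qed.

Lemma cvg_symsum (f_ : nat -> int -> R) (f : int -> R) N :
  (forall n, f_ ^~ n @ \oo --> f n) ->
  (fun J => symsum (f_ J) N) @ \oo --> symsum f N.
Proof.
move=> ff; elim: N => [|N IH].
  by rewrite symsum0; under eq_fun do rewrite symsum0; exact: ff.
rewrite symsumS; under eq_fun do rewrite symsumS.
by apply: cvgD => //; apply: cvgD; exact: ff.
Qed.

Lemma band_limited_cvg A (e_ : nat -> int -> R) e :
  (forall J, band_limited A (e_ J)) -> (forall n, e_ ^~ n @ \oo --> e n) ->
  band_limited A e.
Proof.
move=> Ae ee theta tau N h.
have C : (fun J => cesaro (e_ J) theta tau N) @ \oo --> cesaro e theta tau N.
  rewrite /cesaro; elim: N => [|N IH].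
    by rewrite big_ord0; under eq_fun do rewrite big_ord0; exact: cvg_cst.
  rewrite big_ord_recr; under eq_fun do rewrite big_ord_recr.
  apply: cvgD => //; apply: cvg_symsum => n.
  by apply: cvgMl; exact: ee.
move/cvg_norm : C => C; rewrite -(cvg_lim _ C)//.
apply: limr_le; first by apply/cvg_ex; eexists; exact: C.
by apply: nearW => J; exact: Ae.
Qed.

(* The Cesaro means of the partial sums tend to [0] by [band_limited] and to the
   sum of the series by convergence; hence the sum vanishes. *)
Lemma band_limited_sum0 A e theta tau (K : R) N : band_limited A e ->
  pi / 4 + A <= theta <= pi *+ 2 - pi / 4 - A ->
  (forall n : int, (N < `|n|)%N ->
    `|e n| <= K / (`|n|%:R * (`|n|.+1)%:R)) ->
  `|symsum (fun n => e n * cos (n%:~R * theta + tau)) N| <= 2 * K / N.+1%:R.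
Proof.
move=> Ae h eK; set f := fun n => _.
have fK n : (N < `|n|)%N -> `|f n| <= K / (`|n|%:R * (`|n|.+1)%:R).
  move=> nN; apply: le_trans (eK _ nN); rewrite /f normrM.
  by rewrite ler_piMr// cos_max.
have T M := symsum_tail fK (M := M).
set t := 2 * K / _ in T *; set S := symsum f N in T *.
rewrite leNgt; apply/negP => tS.
pose d : R := `|S| - t; have d0 : 0 < d by rewrite subr_gt0.
pose F := fejer_bound; have F0 : 0 < F := fejer_bound_gt0.
have [L HL] : exists L : nat, 2 * F < d * L%:R.
  exists (Num.bound (2 * F / d)); rewrite [d * _]mulrC -ltr_pdivrMr//.
  by apply: archi_boundP; rewrite ltW// divr_gt0// mulr_gt0.
have H1 := Ae theta tau N h; have H2 := Ae theta tau (N + L)%N h.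
have E : cesaro e theta tau (N + L) = cesaro e theta tau N +
    \sum_(r < L) symsum f (N + r).
  by rewrite /cesaro big_split_ord.
have H3 : `|\sum_(r < L) symsum f (N + r) - S * L%:R| <= t * L%:R.
  have -> : S * L%:R = \sum_(r < L) S by rewrite sumr_const card_ord mulr_natr.
  have -> : t * L%:R = \sum_(r < L) t by rewrite sumr_const card_ord mulr_natr.
  rewrite -sumrB (le_trans (ler_norm_sum _ _ _))// ler_sum// => r _.
  by apply: T; rewrite leq_addr.
have H4 : `|\sum_(r < L) symsum f (N + r)| <= 2 * F.
  have -> : \sum_(r < L) symsum f (N + r) =
    cesaro e theta tau (N + L) - cesaro e theta tau N by rewrite E addrC addKr.
  by rewrite (le_trans (ler_normB _ _))// mulr_natl mulr2n lerD.
have : `|S * L%:R| <= t * L%:R + 2 * F.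
  rewrite -[S * _](subKr (\sum_(r < L) symsum f (N + r))).
  by rewrite (le_trans (ler_normB _ _))// addrC lerD.
rewrite normrM [`|L%:R|]ger0_norm//; move: HL; rewrite /d mulrBl; lra.
Qed.

End band_limited.

(** * A product of cosines with prescribed decay and small bandwidth *)

Section decaying_coefficients.
Variable R : realType.

Lemma summable_tail (u : nat -> R) (B : R) : (forall j, 0 <= u j) ->
  (forall J, \sum_(j < J) u j <= B) ->
  forall eps : R, 0 < eps ->
  exists j0 : nat, forall J, \sum_(j0 <= j < J) u j <= eps.
Proof.
move=> u0 uB eps eps0; pose E := range (fun J : nat => \sum_(j < J) u j).
have sE : has_sup E.
  split; first by exists 0; exists 0%N => //; rewrite big_ord0.
  by exists B => _ [J _ <-].
have [_ [j0 _ <-] Hj0] := sup_adherent eps0 sE.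
exists j0 => J; have [Jj|jJ] := leqP J j0.
  by rewrite big_geq// ltW.
have : \sum_(j < J) u j <= sup E by apply: sup_upper_bound => //; exists J.
rewrite -!(big_mkord xpredT u) (big_cat_nat (leq0n j0) (ltnW jJ))/= => H.
by rewrite -(big_mkord xpredT u) in Hj0; lra.
Qed.

Variables (v : nat -> R) (B : R).
Hypothesis v0 : forall n, 0 <= v n.
Hypothesis vnd : forall m n, (m <= n)%N -> v m <= v n.
Hypothesis vB : forall J, \sum_(j < J) v (2 ^ j)%N / 2 ^+ j <= B.

(** For 2^j <= |n| < 2^(j+1) the angle [freq j] n has absolute value in [pi/4, pi/2], where cos^2 <=
    1/2 <= exp(-1/2). At least 2 v(2^(j+1)) such factors give exp(-v(2^(j+1))) <= exp(-v(|n|)). *)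
Let mult (j : nat) : nat := (Num.truncn (2 * v (2 ^ j.+1)%N)).+1.
Let freq (j : nat) : R := pi / 4 / 2 ^+ j.

Let mult_ge j : 2 * v (2 ^ j.+1)%N <= (mult j)%:R.
Proof. exact/ltW/truncnS_gt. Qed.

Let mult_le j : (mult j)%:R <= 2 * v (2 ^ j.+1)%N + 1.
Proof. by rewrite /mult -natr1 lerD2r truncn_le mulr_ge0. Qed.

Let sum_geo J : \sum_(j < J) (2 ^+ j)^-1 <= 2 :> R.
Proof.
suff -> : \sum_(j < J) (2 ^+ j)^-1 = 2 - 2 * (2 ^+ J)^-1 :> R.
  by rewrite gerBl mulr_ge0// invr_ge0 exprn_ge0.
elim: J => [|J IH]; first by rewrite big_ord0 expr0 invr1; lra.
rewrite big_ord_recr/= IH exprS; field.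
by rewrite expf_neq0.
Qed.

Let mult_summable J : \sum_(j < J) (mult j)%:R / 2 ^+ j <= 4 * B + 2.
Proof.
have H : \sum_(j < J) (mult j)%:R / 2 ^+ j <=
    4 * \sum_(j < J) v (2 ^ j.+1)%N / 2 ^+ j.+1 + \sum_(j < J) (2 ^+ j)^-1.
  rewrite mulr_sumr -big_split/= ler_sum// => j _.
  have -> : 4 * (v (2 ^ j.+1)%N / 2 ^+ j.+1) + (2 ^+ j)^-1 =
    (2 * v (2 ^ j.+1)%N + 1) / 2 ^+ j.
    by rewrite exprS; field; rewrite expf_neq0.
  by rewrite ler_wpM2r// invr_ge0 exprn_ge0.
have H2 : \sum_(j < J) v (2 ^ j.+1)%N / 2 ^+ j.+1 <= B.
  apply: le_trans (vB J.+1); rewrite big_ord_recl.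
  by rewrite lerDr divr_ge0// exprn_ge0.
by have := sum_geo J; lra.
Qed.

(** The bandwidth of the convolution below is pi times this sum; discarding the scales under j0
    brings it down to pi / 4. *)
Let tail_ex : exists j0 : nat, forall J,
  \sum_(j0 <= j < J) (mult j)%:R / 2 ^+ j <= 1 / 4 :> R.
Proof.
apply: summable_tail mult_summable _ _ => [j|]; last by lra.
by rewrite divr_ge0// exprn_ge0.
Qed.

(** The even powers keep the coefficients nonnegative. *)
Let cosprod (j0 : nat) (J : nat) (n : int) : R :=
  \prod_(j0 <= j < J) cos (freq j * n%:~R) ^+ 2 ^+ mult j.

Let cos2_itv (x : R) : 0 <= cos x ^+ 2 <= 1.
Proof.
rewrite sqr_ge0/= -[leRHS](cos2Dsin2 x) lerDl.
by rewrite sqr_ge0.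
Qed.

Let cosprod_ge0 j0 J n : 0 <= cosprod j0 J n.
Proof.
by apply: prodr_ge0 => j _; rewrite exprn_ge0// sqr_ge0.
Qed.

Let cosprod_noninc j0 n : {homo (cosprod j0)^~ n : J K / (J <= K)%N >-> K <= J}.
Proof.
move=> J K JK; have [Kj|jK] := leqP K j0.
  by rewrite /cosprod !big_geq// (leq_trans JK).
have [Jj|jJ] := leqP J j0.
  rewrite {2}/cosprod big_geq//; apply: prodr_ile1 => j _.
  have /andP[h1 h2] := cos2_itv (freq j * n%:~R).
  by rewrite exprn_ge0// exprn_ile1.
rewrite /cosprod (big_cat_nat (ltnW jJ) JK)/= ler_piMr//; first exact: cosprod_ge0.
apply: prodr_ile1 => j _.
have /andP[h1 h2] := cos2_itv (freq j * n%:~R).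
by rewrite exprn_ge0// exprn_ile1.
Qed.

Let cosprod_cvg j0 n : cvgn ((cosprod j0)^~ n).
Proof.
apply: nonincreasing_is_cvgn; first exact: cosprod_noninc.
by exists 0 => _ [J _ <-].
Qed.

Let band_limited_cosX A a (m : int) r (e : int -> R) : 0 <= a ->
  band_limited A e ->
  band_limited (A + a * r%:R) (fun n => cos (a * (n - m)%:~R) ^+ r * e n).
Proof.
move=> a0; elim: r => [|r IH] Ae.
  by rewrite mulr0 addr0; apply: eq_band_limited Ae => n; rewrite expr0 mul1r.
have := band_limited_cos m a0 (IH Ae).
rewrite -natr1 mulrDr mulr1 addrA; apply: eq_band_limited => n.
by rewrite exprS !mulrA.
Qed.

(** Starting from the constant sequence 1, scale j brings 2 [mult j] cosines centred at 0 and as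
    many centred at k, each widening the band by [freq j]. *)
Let band_limited_cosprod j0 J (k : int) :
  band_limited (\sum_(j0 <= j < J) freq j * (2 * mult j)%N%:R * 2)
    (fun n => cosprod j0 J n * cosprod j0 J (k - n)).
Proof.
have base K : (K <= j0)%N ->
    band_limited (\sum_(j0 <= j < K) freq j * (2 * mult j)%N%:R * 2)
      (fun n => cosprod j0 K n * cosprod j0 K (k - n)).
  move=> Kj; rewrite big_geq//; apply: eq_band_limited (@band_limited1 R) => n.
  by rewrite /cosprod !big_geq// mulr1.
elim: J => [|J IH]; first exact: base.
have [Jj|] := leqP J.+1 j0; [exact: base|rewrite ltnS => jJ].
have f0 : 0 <= freq J by rewrite !divr_ge0 ?pi_ge0// exprn_ge0.
have := @band_limited_cosX _ _ k (2 * mult J)%N _ f0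
     (@band_limited_cosX _ _ 0 (2 * mult J)%N _ f0 IH).
rewrite (big_nat_recr _ _ _ jJ)/= [freq J * _ * _]mulr_natr mulr2n addrA.
apply: eq_band_limited => n.
rewrite /cosprod !(big_nat_recr _ _ _ jJ)/= subr0 !exprM.
have -> : cos (freq J * (n - k)%:~R) = cos (freq J * (k - n)%:~R).
  by rewrite -[LHS]cosN -mulrN -intrN opprB.
by ring.
Qed.

(** The constant exp(v(2^j0)) absorbs the indices |n| < 2^j0, whose scales were discarded. Beyond
    them, the single factor at the dyadic scale of |n| gives the decay, the others being at most
    1. *)
Lemma decaying_coefficients : exists (c : int -> R) (K : R),
  [/\ c 0 = 1, forall n, 0 <= c n <= 1,
    forall n : int, c n <= K * expR (- v `|n|%N)
  & forall k : int, band_limited (pi / 4) (fun n => c n * c (k - n))].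
Proof.
have [j0 Hj0] := tail_ex.
pose c n := limn ((cosprod j0)^~ n).
have cle n J : c n <= cosprod j0 J n.
  exact: nonincreasing_cvgn_ge (cosprod_noninc j0 n) (@cosprod_cvg j0 n) J.
have c0 n : 0 <= c n by apply: limr_ge; [exact: cosprod_cvg|exact: nearW].
have c1 n : c n <= 1 by apply: le_trans (cle n 0%N) _; rewrite /cosprod big_geq.
exists c, (expR (v (2 ^ j0)%N)); split.
- rewrite /c (_ : _^~ 0 = cst 1) ?lim_cst//.
  apply/funext => J; rewrite /cosprod big1// => j _.
  by rewrite mulr0 cos0 !expr1n.
- by move=> n; rewrite c0 c1.
- move=> n; have [nj|nj] := ltnP `|n|%N (2 ^ j0)%N.
    rewrite (le_trans (c1 n))// -expRD -expR0 ler_expR subr_ge0.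
    by apply: vnd; exact: ltnW.
  have n0 : (0 < `|n|)%N by apply: leq_trans nj; rewrite expn_gt0.
  have /andP[] := trunc_log_bounds (isT : (1 < 2)%N) n0.
  set j := trunc_log 2 _ => jn nj1.
  have jj : (j0 <= j)%N by rewrite -ltnS -(@ltn_exp2l 2)// (leq_ltn_trans nj).
  apply: le_trans (cle n j.+1) _.
  rewrite /cosprod big_nat_recr//=.
  apply: (@le_trans _ _ (1 * expR (- v `|n|%N))); last first.
    by rewrite ler_wpM2r ?expR_ge0// -expR0 ler_expR.
  apply: ler_pM.
  + exact: cosprod_ge0.
  + by rewrite exprn_ge0//; case/andP: (cos2_itv (freq j * n%:~R)).
  + apply: prodr_ile1 => i _.
    have /andP[h1 h2] := cos2_itv (freq i * n%:~R).
    by rewrite exprn_ge0// exprn_ile1.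
  (* The double angle lies in [pi/2, pi], so its cosine 2 cos^2 - 1 is nonpositive; and 1/2 <=
     exp(-1/2). *)
  have Hc : cos (freq j * n%:~R) ^+ 2 <= expR (- (1 / 2)).
    have -> : cos (freq j * n%:~R) = cos (freq j * `|n|%N%:R).
      have [nn|nn] := leP 0 n; first by rewrite -{1}(gez0_abs nn) -pmulrn.
      by rewrite -cosN -mulrN -intrN -{1}(lez0_abs (ltW nn)) -pmulrn.
    set x := freq j * _.
    have p2 : 0 < 2 ^+ j :> R by rewrite exprn_gt0.
    have pp := pi_gt0 R.
    have xE : x = pi / 4 * (`|n|%N%:R / 2 ^+ j) by rewrite /x /freq; field; lra.
    have h1 : 1 <= `|n|%N%:R / 2 ^+ j :> R.
      by rewrite ler_pdivlMr// mul1r -natrX ler_nat.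
    have h2 : `|n|%N%:R / 2 ^+ j <= 2 :> R.
      by rewrite ler_pdivrMr// -exprS -natrX ler_nat ltnW.
    have xlo : pi / 4 <= x by rewrite xE ler_peMr//; lra.
    have xhi : x <= pi / 4 * 2 by rewrite xE ler_wpM2l//; lra.
    have : cos (x *+ 2) <= 0.
      rewrite mulr2n -(cos_pihalf R) leNgt; apply/negP.
      by rewrite ltr_cos ?in_itv/=; lra.
    rewrite cos_mulr2n => h3.
    apply: le_trans (expR_ge1Dx _); move: h3; rewrite mulr2n; lra.
  apply: (@le_trans _ _ (expR (- (1 / 2)) ^+ mult j)).
    by rewrite lerXn2r ?nnegrE ?expR_ge0//; case/andP: (cos2_itv (freq j * n%:~R)).
  rewrite -expRM_natl ler_expR mulrN lerN2.
  have := mult_ge j; have : v `|n|%N <= v (2 ^ j.+1)%N by apply: vnd; exact: ltnW.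
  lra.
- move=> k; apply: (@band_limited_cvg _ _
    (fun J n => cosprod j0 J n * cosprod j0 J (k - n))).
    move=> J; apply: band_limitedW (@band_limited_cosprod j0 J k).
    have -> : \sum_(j0 <= j < J) freq j * (2 * mult j)%N%:R * 2 =
        pi * \sum_(j0 <= j < J) (mult j)%:R / 2 ^+ j.
      rewrite mulr_sumr; apply: eq_bigr => j _; rewrite /freq natrM; field.
      by rewrite expf_neq0.
    by have := Hj0 J; have := pi_gt0 R; nra.
  by move=> n; apply: cvgM; exact: cosprod_cvg.
Qed.

End decaying_coefficients.

(** * Logarithmic sums over blocks of an orbit *)

Section distance_to_integers.
Variable R : realType.
Implicit Types x y : R.

Definition dist_int x : R := Num.min (fracpart x) (1 - fracpart x).

Lemma fracpart_itv x : 0 <= fracpart x < 1.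
Proof. by have := floor_itv x; rewrite /fracpart intrD; lra. Qed.

Lemma fracpart_unique (k : int) x y : x = k%:~R + y -> 0 <= y < 1 ->
  fracpart x = y.
Proof.
move=> -> y01; rewrite /fracpart (_ : Num.floor _ = k).
  by rewrite addrAC subrr add0r.
by apply: floor_def; rewrite intrD; lra.
Qed.

Lemma fracpartDz x (k : int) : fracpart (x + k%:~R) = fracpart x.
Proof.
apply: (@fracpart_unique (Num.floor x + k)); last exact: fracpart_itv.
by rewrite /fracpart intrD; ring.
Qed.

Lemma dist_intDz x (k : int) : dist_int (x + k%:~R) = dist_int x.
Proof. by rewrite /dist_int fracpartDz. Qed.

Lemma dist_int_le_fracpart x : dist_int x <= fracpart x.
Proof. by rewrite ge_min lexx. Qed.

Lemma dist_intE x : exists k : int, dist_int x = `|x - k%:~R|.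
Proof.
have fx := fracpart_itv x.
rewrite /dist_int; case: leP => h.
  by exists (Num.floor x); rewrite -/(fracpart x) ger0_norm//; lra.
exists (Num.floor x + 1).
have -> : x - (Num.floor x + 1)%:~R = - (1 - fracpart x).
  by rewrite intrD /fracpart; ring.
by rewrite normrN ger0_norm//; lra.
Qed.

Lemma dist_int_le x (k : int) : dist_int x <= `|x - k%:~R|.
Proof.
rewrite -(dist_intDz x (- k)) intrN; set y := x - _.
have fy := fracpart_itv y.
rewrite /dist_int; have [y0|y0] := leP 0 y.
  rewrite ger0_norm// ge_min; apply/orP; left.
  by rewrite /fracpart gerBl ler0z -[0]/(0%:~R) floor_ge_int.
rewrite ltr0_norm// ge_min; apply/orP; right.
have : Num.floor y <= -1.
  by have : Num.floor y < 0 by [rewrite floor_lt_int]; lia.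
by rewrite -(ler_int R) /fracpart intrN; lra.
Qed.

Lemma dist_int_lip x (e : R) : dist_int x <= dist_int (x + e) + `|e|.
Proof.
have [k ->] := dist_intE (x + e); apply: le_trans (dist_int_le x k) _.
by rewrite [leLHS](_ : _ = `|(x + e - k%:~R) - e|) ?ler_normB//; congr `|_|; ring.
Qed.

(** With a common nearest integer this is the triangle inequality. Otherwise the two integers are at
    least 1 apart, and the distances add up to at least 1 - |x - y| >= |x - y|. *)
Lemma dist_int_sep x y : `|x - y| <= 1 / 2 ->
  `|x - y| <= dist_int x + dist_int y.
Proof.
move=> xy; have [k ->] := dist_intE x; have [l ->] := dist_intE y.
have h := ler_normB (x - k%:~R) (y - l%:~R).
have [->|kl] := eqVneq k l.
  apply: le_trans (ler_normB _ _).
  by rewrite le_eqVlt; apply/orP; left; apply/eqP; congr `|_|; ring.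
apply: le_trans h.
have h1 : 1 <= `|(k - l)%:~R| :> R.
  by rewrite -intr_norm -[1]/(1%:~R) ler_int -gtz0_ge1 normr_gt0 subr_eq0.
have -> : x - k%:~R - (y - l%:~R) = (x - y) - (k - l)%:~R by rewrite intrB; ring.
set n := (k - l)%:~R in h1 *.
have := ler_normB (x - y - n) (x - y).
by rewrite [X in `|X| <= _ -> _](_ : _ = - n) ?normrN; [lra|ring].
Qed.

End distance_to_integers.

(** * Elementary forms of Stirling's formula *)

Section log_factorial.
Variable R : realType.

Lemma ln_factE n : \sum_(i < n) ln (i.+1%:R) = ln (n`!%:R) :> R.
Proof.
elim: n => [|n IH]; first by rewrite big_ord0 fact0 ln1.
by rewrite big_ord_recr/= IH factS natrM mulrC lnM// posrE ltr0n// fact_gt0.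
Qed.

Lemma ln_fact_ge n : (0 < n)%N -> n%:R * ln n%:R - n%:R <= ln n`!%:R :> R.
Proof.
elim: n => [//|[|n] IH] _; first by rewrite factS fact0 muln1 ln1; lra.
have {}IH := IH isT; rewrite factS natrM lnM ?posrE ?ltr0n ?fact_gt0//.
apply: (@le_trans _ _ (ln n.+2%:R + (n.+1%:R * ln n.+1%:R - n.+1%:R))); last first.
  by rewrite lerD2l.
have p1 : 0 < n.+1%:R :> R by [].
have -> : n.+2%:R = n.+1%:R + 1 :> R by rewrite natr1.
set x := n.+1%:R in p1 *.
have : ln (1 + x^-1) <= x^-1.
  by apply: le_ln1Dx; rewrite (@lt_le_trans _ _ 0)// invr_ge0 ltW.
have -> : 1 + x^-1 = (x + 1) / x by field; lra.
rewrite ln_div ?posrE//; last lra.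
rewrite -(ler_pM2l p1) mulrBr mulfV; last lra.
lra.
Qed.

Lemma ln_fact_le n : (0 < n)%N ->
  ln n`!%:R <= n%:R * ln n%:R - n%:R + 1 + ln n%:R :> R.
Proof.
elim: n => [//|[|n] IH] _; first by rewrite factS fact0 muln1 !ln1; lra.
have {}IH := IH isT; rewrite factS natrM lnM ?posrE ?ltr0n ?fact_gt0//.
have p1 : 0 < n.+1%:R :> R by [].
move: IH; have -> : n.+2%:R = n.+1%:R + 1 :> R by rewrite natr1.
set x := n.+1%:R in p1 *; move=> IH.
have h : ln (1 + (- (x + 1)^-1)) <= - (x + 1)^-1.
  by apply: le_ln1Dx; rewrite ltrN2 invf_lt1; lra.
have E : 1 - (x + 1)^-1 = x / (x + 1) by field; lra.
rewrite E ln_div ?posrE// in h; last lra.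
have h2 : (x + 1) * (ln x - ln (x + 1)) <= (x + 1) * - (x + 1)^-1.
  by rewrite ler_pM2l//; lra.
rewrite mulrN mulfV in h2; last lra.
lra.
Qed.

(** The binomial coefficient is at most 2^n. Splitting a progression at one of its points thus costs
    only ln 2 per term. *)
Lemma ln_binomial l n : (l <= n)%N ->
  ln n`!%:R - n%:R * ln 2 <= ln l`!%:R + ln (n - l)`!%:R :> R.
Proof.
move=> ln_; rewrite -(bin_fact ln_) !natrM.
have b0 : 0 < 'C(n, l)%:R :> R by rewrite ltr0n bin_gt0.
rewrite !lnM ?posrE ?mulr_gt0 ?ltr0n ?fact_gt0 ?bin_gt0//.
have : ln 'C(n, l)%:R <= ln (2 ^+ n) :> R.
  rewrite ler_ln ?posrE ?exprn_gt0// -natrX ler_nat.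
  rewrite -[2%N]/(1 + 1)%N Pascal.
  rewrite (bigD1 (inord l))//= inordK ?ltnS// !exp1n !muln1.
  exact: leq_addr.
rewrite lnXn// -mulr_natl; lra.
Qed.

End log_factorial.

(** * Logarithms of distances to the integers along a slow progression *)

Section arithmetic_progression.
Variable R : realType.
Implicit Types x eta kappa delta : R.

Let lnsum_left (F : nat -> R) (D : R) l :
  (forall i, (i < l)%N -> F i <= D - ln (l - i)%:R) ->
  \sum_(i < l) F i <= l%:R * D - ln l`!%:R.
Proof.
move=> FD; rewrite -ln_factE -(big_mkord xpredT F) big_nat_rev/= add0n.
rewrite -[X in X - _](_ : \sum_(i < l) D = _); last first.
  by rewrite sumr_const card_ord mulr_natl.
rewrite -sumrB big_mkord; apply: ler_sum => i _.
apply: le_trans (FD _ _) _; last by rewrite subnA ?subnn// ltnW.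
by rewrite ltn_subrL (leq_ltn_trans _ (ltn_ord i)).
Qed.

Lemma ln_le_nat (n : nat) : ln n%:R <= n%:R :> R.
Proof.
case: n => [|n]; first by rewrite ln0// ltr10.
by rewrite ltW// ln_sublinear.
Qed.

Lemma ln2_le1 : ln 2 <= 1 :> R.
Proof. by have := @le_ln1Dx R 1; rewrite -[1 + 1]/(2%:R) => ->//; lra. Qed.

Lemma lnsum_progression_far x eta kappa (b : nat) : 0 < kappa ->
  kappa <= dist_int x -> b%:R * `|eta| <= kappa / 2 ->
  - \sum_(l < b) ln (dist_int (x + l%:R * eta)) <= b%:R * (ln 2 - ln kappa).
Proof.
move=> k0 kx be.
rewrite -sumrN mulr_natl -[b in leRHS]card_ord -sumr_const; apply: ler_sum => l _.
rewrite -ln_div ?posrE// -lerN2 opprK -lnV ?posrE ?divr_gt0// invf_div.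
have h := dist_int_lip x (l%:R * eta).
have h2 : `|l%:R * eta| <= kappa / 2.
  apply: le_trans be; rewrite normrM ger0_norm// ler_wpM2r//.
  by rewrite ler_nat ltnW.
by rewrite ler_ln ?posrE//; lra.
Qed.

(* Around the index [l0] where the distance is smallest, the other distances
   are at least [`|l - l0| * `|eta| / 2], which produces a factorial. *)
Lemma lnsum_progression_near x eta kappa kappa' (b : nat) :
  0 < kappa -> 0 < kappa' ->
  (forall l : nat, (l < b)%N -> kappa' <= dist_int (x + l%:R * eta)) ->
  b%:R * `|eta| <= 1 / 2 -> kappa / 2 < b%:R * `|eta| ->
  - \sum_(l < b) ln (dist_int (x + l%:R * eta)) <=
  - ln kappa' + b%:R * (ln 8 - ln kappa + 1) + ln b%:R.
Proof.
move=> k0 k'0 k'x be1 be2.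
have b0 : (0 < b)%N.
  by case: b be2 {k'x be1} => //; rewrite mul0r; lra.
have e0 : 0 < `|eta|.
  rewrite lt_neqAle normr_ge0 andbT; apply/negP => /eqP e0.
  by move: be2; rewrite -e0 mulr0; lra.
have bR : 0 < b%:R :> R by rewrite ltr0n.
pose f l := dist_int (x + l%:R * eta).
pose i0 := Ordinal b0.
case: (@arg_minP _ R _ i0 xpredT (fun i : 'I_b => f i) isT) => l0 _ l0min.
have sep l : (l < b)%N -> l != l0 :> nat ->
    `|l%:R - l0%:R| * `|eta| / 2 <= f l.
  move=> lb ll0.
  have E : x + l%:R * eta - (x + l0%:R * eta) = (l%:R - l0%:R) * eta by ring.
  have H : `|l%:R - l0%:R| <= b%:R :> R.
    by have := ltn_ord l0; rewrite -!(ltr_nat R) in lb *; have := ler0n R l;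
       have := ler0n R l0; rewrite ler_norml; lra.
  have := @dist_int_sep R (x + l%:R * eta) (x + l0%:R * eta).
  rewrite E normrM => H2.
  have {}H2 := H2 (le_trans (ler_wpM2r (normr_ge0 eta) H) be1).
  have := l0min (Ordinal lb) isT; rewrite /= -/(f l) -/(f l0) in H2 *; lra.
have D0 : 0 <= ln (2 / `|eta|).
  apply: ln_ge0; rewrite ler_pdivlMr// mul1r.
  have : 1 <= b%:R :> R by rewrite ler1n.
  by nra.
set D := ln (2 / _) in D0.
have Fle l (m : nat) : (l < b)%N -> (0 < m)%N -> `|l%:R - l0%:R| = m%:R :> R ->
    - ln (f l) <= D - ln m%:R.
  move=> lb m0 lm; have mR : 0 < m%:R :> R by rewrite ltr0n.
  have ll0 : l != l0 :> nat.
    apply/negP => /eqP ll; move: lm; rewrite ll subrr normr0 => m1.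
    by move: mR; rewrite -m1 ltxx.
  have := sep l lb ll0; rewrite lm => h.
  rewrite /D -ln_div ?posrE ?divr_gt0// -lerN2 opprK -lnV ?posrE ?divr_gt0//.
  rewrite !invf_div mulrA ler_ln ?posrE ?divr_gt0 ?mulr_gt0//.
  exact: lt_le_trans (k'x l lb).
rewrite -sumrN -(big_mkord xpredT (fun l => - ln (f l))).
have l0b := ltn_ord l0.
rewrite (big_cat_nat (leq0n l0) (ltnW l0b))/= (big_ltn l0b).
have H1 : \sum_(0 <= i < l0) - ln (f i) <= l0%:R * D - ln l0`!%:R.
  rewrite big_mkord; apply: (@lnsum_left (fun i => - ln (f i))) => i il.
  apply: Fle; rewrite ?subn_gt0//; first exact: ltn_trans l0b.
  by rewrite distrC -natrB ?ger0_norm// ltnW.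
have H2 : \sum_(l0.+1 <= i < b) - ln (f i) <=
    (b - l0.+1)%:R * D - ln (b - l0.+1)`!%:R.
  rewrite -[l0.+1]add0n big_addn -ln_factE big_mkord.
  rewrite -[X in X - _](_ : \sum_(i < b - l0.+1) D = _); last first.
    by rewrite sumr_const card_ord mulr_natl.
  rewrite -sumrB; apply: ler_sum => i _.
  have ib : (i + l0.+1 < b)%N by rewrite addnC -ltn_subRL.
  apply: Fle => //; rewrite -natrB; last by rewrite addnS ltnW// ltnS leq_addl.
  by rewrite ger0_norm// addnS -addSn addnK.
have H3 : - ln (f l0) <= - ln kappa'.
  rewrite lerN2 ler_ln ?posrE//; last exact: lt_le_trans (k'x _ l0b).
  exact: k'x.
(* The factorials from both sides of l0 recombine into (b-1)!. By Stirling its b ln b turns b D into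
   b ln(2 / (b |eta|)), which the lower bound on b |eta| controls by kappa. *)
have H4 := @ln_binomial R l0 b.-1.
have {}H4 : _ := H4 (ltac:(by rewrite -ltnS prednK)).
have bE : (b.-1 - l0 = b - l0.+1)%N by rewrite -subn1 -subnDA add1n.
rewrite bE in H4.
have H5 : ln b`!%:R = ln b%:R + ln b.-1`!%:R :> R.
  by rewrite -{1}(prednK b0) factS natrM lnM ?posrE ?ltr0n ?fact_gt0// prednK.
have H6 := @ln_fact_ge R b b0.
have H7 : l0%:R + (b - l0.+1)%:R + 1 = b%:R :> R.
  by rewrite -natrD natr1 -addSn subnKC.
have H8 : b.-1%:R = b%:R - 1 :> R by rewrite -[in RHS](prednK b0) -natr1 addrK.
have H9 : D + ln 2 - ln b%:R <= ln 8 - ln kappa.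
  have e1 : D + ln 2 - ln b%:R = ln (4 / (b%:R * `|eta|)).
    rewrite /D -lnM ?posrE ?divr_gt0// -ln_div ?posrE ?mulr_gt0 ?invr_gt0//.
    by congr ln; field; lra.
  rewrite e1 -ln_div ?posrE// ler_ln ?posrE ?divr_gt0 ?mulr_gt0//.
  rewrite ler_pdivrMr ?mulr_gt0// mulrAC ler_pdivlMr//; lra.
have L2 : 0 <= ln 2 :> R by apply: ln_ge0; lra.
have P1 : l0%:R * D + (b - l0.+1)%:R * D = (b%:R - 1) * D.
  by rewrite -H7; ring.
have P2 : b%:R * (D + ln 2 - ln b%:R) <= b%:R * (ln 8 - ln kappa).
  by rewrite ler_pM2l.
rewrite H8 in H4; lra.
Qed.

(** The point is a bound free of ln Q. If the total drift b |eta| is at most kappa / 2, with kappa =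
    delta / (4 q^2), all points stay kappa / 2 away from the integers. Otherwise Q |eta| <= 1 forces
    Q < 2 b / kappa, so ln Q is controlled by ln b and ln q. The numbers 17, 4, 6 collect the terms,
    using ln 2 <= 1 and ln b <= b. *)
Lemma lnsum_progression x eta delta (q Q : R) (b : nat) :
  0 < delta <= 1 -> 1 <= q -> 0 < Q -> Q * `|eta| <= 1 ->
  b%:R * `|eta| <= 1 / 2 ->
  delta / (4 * q ^+ 2) <= dist_int x ->
  (forall l : nat, (l < b)%N ->
    delta / (4 * Q ^+ 2) <= dist_int (x + l%:R * eta)) ->
  - (b%:R * (17 - 4 * ln delta + 6 * ln q)) <=
  \sum_(l < b) ln (dist_int (x + l%:R * eta)).
Proof.
move=> /andP[d0 d1] q1 Q0 Qe be dx dl.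
rewrite lerNl.
have q0 : 0 < q by lra.
have q20 : 0 < 4 * q ^+ 2 by rewrite mulr_gt0// exprn_gt0.
have Q20 : 0 < 4 * Q ^+ 2 by rewrite mulr_gt0// exprn_gt0.
set k := _ / _ in dx; set k' := _ / _ in dl.
have k0 : 0 < k by rewrite divr_gt0.
have k'0 : 0 < k' by rewrite divr_gt0.
have L2 : 0 <= ln 2 :> R by apply: ln_ge0; lra.
have L21 := ln2_le1.
have L4 : ln 4 = 2 * ln 2 :> R.
  by rewrite -[4](_ : 2 ^+ 2 = _) ?lnXn// -?natrX// mulr_natl.
have L8 : ln 8 = 3 * ln 2 :> R.
  by rewrite -[8](_ : 2 ^+ 3 = _) ?lnXn// -?natrX// mulr_natl.
have lnk : ln k = ln delta - 2 * ln 2 - 2 * ln q.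
  rewrite /k ln_div ?posrE// lnM ?posrE ?exprn_gt0// lnXn// L4 -mulr_natl; lra.
have lnk' : ln k' = ln delta - 2 * ln 2 - 2 * ln Q.
  rewrite /k' ln_div ?posrE// lnM ?posrE ?exprn_gt0// lnXn// L4 -mulr_natl; lra.
have ld : ln delta <= 0 by apply: ln_le0.
have lq : 0 <= ln q by apply: ln_ge0.
have [be1|be1] := leP (b%:R * `|eta|) (k / 2).
  apply: le_trans (lnsum_progression_far k0 dx be1) _.
  by rewrite ler_wpM2l// lnk; lra.
apply: le_trans (lnsum_progression_near k0 k'0 dl be be1) _.
have b1 : 1 <= b%:R :> R.
  by rewrite ler1n lt0n; apply/eqP => b0; move: be1; rewrite b0 mul0r; lra.
have lb := ln_le_nat b.
have lQ : ln Q <= ln 2 + ln b%:R - ln k.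
  rewrite -lnM ?posrE//; last lra.
  rewrite -ln_div ?posrE//; last lra.
  rewrite ler_ln ?posrE// ?divr_gt0//; last lra.
  rewrite ler_pdivlMr//.
  have : Q * (k / 2) <= b%:R.
    apply: (@le_trans _ _ (Q * (b%:R * `|eta|))); first by rewrite ler_pM2l// ltW.
    by rewrite mulrCA -[leRHS]mulr1 ler_pM2l//; lra.
  lra.
rewrite lnk' L8; move: lQ; rewrite lnk => lQ.
nra.
Qed.

End arithmetic_progression.

(** * Blocks of b q consecutive points of a rotation orbit *)

Section block_of_orbit.
Variable R : realType.

Lemma sum_block (F : nat -> R) (b q : nat) :
  \sum_(i < b * q) F i = \sum_(i < q) \sum_(l < b) F (i + l * q)%N.
Proof.
elim: b => [|b IH].
  by rewrite big_ord0 big1// => i _; rewrite big_ord0.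
rewrite mulSnr big_split_ord/= IH -big_split/=; apply: eq_bigr => i _.
by rewrite big_ord_recr/= [(b * q + i)%N]addnC.
Qed.

Definition residue (k a : int) (r : nat) (i : 'I_r.+1) : 'I_r.+1 :=
  inord `|((k + i%:Z * a) %% r.+1%:Z)%Z|%N.

Lemma residueE k a r (i : 'I_r.+1) :
  (residue k a i)%:Z = ((k + i%:Z * a) %% r.+1%:Z)%Z.
Proof.
have m0 : (0 <= (k + i%:Z * a) %% r.+1%:Z)%Z by exact: modz_ge0.
rewrite /residue inordK ?gez0_abs//.
by rewrite -ltz_nat gez0_abs// ltz_pmod.
Qed.

Lemma residue_inj k a r : coprimez r.+1%:Z a ->
  injective (@residue k a r).
Proof.
move=> cop i j ij.
have : (k + i%:Z * a = k + j%:Z * a %[mod r.+1%:Z])%Z.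
  by rewrite -!residueE ij.
move=> /eqP; rewrite eqz_mod_dvd addrAC opprD addrA subrr add0r addrC -mulrBl.
rewrite Gauss_dvdzl// -eqz_mod_dvd => /eqP.
by rewrite !modz_nat !modn_small ?ltn_ord// => -[] /val_inj.
Qed.

(** With q = r + 3, the r well-placed residues have lower grid values 1/q, ..., r/q; the three terms
    missing from Stirling's formula are nonpositive. In the companion upper bound the values are
    4/q, ..., q/q, and the missing terms cost at most 3 ln q. *)
Lemma lnsum_grid_ge r :
  - r.+3%:R <= \sum_(i < r) ln (i.+1%:R / r.+3%:R) :> R.
Proof.
apply: (@le_trans _ _ (\sum_(i < r.+3) ln (i.+1%:R / r.+3%:R))).
  have -> : \sum_(i < r.+3) ln (i.+1%:R / r.+3%:R) =
      ln r.+3`!%:R - r.+3%:R * ln r.+3%:R :> R.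
    rewrite -ln_factE -[X in _ = _ - X](_ : \sum_(i < r.+3) ln r.+3%:R = _).
      rewrite -sumrB; apply: eq_bigr => i _; by rewrite ln_div ?posrE.
    by rewrite sumr_const card_ord mulr_natl.
  by have := @ln_fact_ge R r.+3 isT; lra.
rewrite !big_ord_recr/= -!addrA gerDl.
have H (i : nat) : (i <= r.+3)%N -> ln (i%:R / r.+3%:R) <= 0 :> R.
  by move=> ir; apply: ln_le0; rewrite ler_pdivrMr// mul1r ler_nat.
have := H r.+1 (leqW (leqnSn _)); have := H r.+2 (leqnSn _).
by have := H r.+3 (leqnn _); lra.
Qed.

Lemma lnsum_grid_le r : \sum_(i < r) ln (i.+4%:R / r.+3%:R) <=
  - r.+3%:R + 1 + 4 * ln r.+3%:R :> R.
Proof.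
have E : \sum_(i < r.+3) ln (i.+1%:R / r.+3%:R) =
    ln r.+3`!%:R - r.+3%:R * ln r.+3%:R :> R.
  rewrite -ln_factE -[X in _ = _ - X](_ : \sum_(i < r.+3) ln r.+3%:R = _).
    rewrite -sumrB; apply: eq_bigr => i _; by rewrite ln_div ?posrE.
  by rewrite sumr_const card_ord mulr_natl.
have H := @ln_fact_le R r.+3 isT.
rewrite !big_ord_recl/= in E.
have lnp (n : nat) : 0 <= ln n.+1%:R :> R by apply: ln_ge0; rewrite ler1n.
rewrite !ln_div ?posrE// in E.
have l1 := lnp 0%N; have l2 := lnp 1%N; have l3 := lnp 2%N.
rewrite (eq_bigr (fun i : 'I_r => ln (i.+4%:R / r.+3%:R))) in E; last by [].
lra.
Qed.

(** Write gamma = a/q + eps. Modulo 1, the point of index i + l q is (h i + rho)/q + (i + l q) eps,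
    where h permutes the residues and the drift is at most 1/q because b q <= Q. A residue with 2 <=
    h <= q - 2 traps it between (h-1)/q and (h+2)/q, and the -q of Stirling's formula cancels the q
    terms 1. The residues 0, 1 and q - 1, which may approach 0 or wrap around, are treated as
    progressions in l; these three account for the constant 51 - 12 ln delta = 3 (17 - 4 ln
    delta). *)
Lemma ln_block_bound (gamma s delta : R) (a : int) (q Q b : nat) :
  0 < delta <= 1 -> (3 <= q)%N -> (q <= Q)%N -> (b * q <= Q)%N ->
  coprimez q%:Z a -> `|gamma - a%:~R / q%:R| <= (q%:R * Q%:R)^-1 ->
  (forall i : nat, (i < q)%N ->
    delta / (4 * q%:R ^+ 2) <= dist_int (s + i%:R * gamma)) ->
  (forall i : nat, (i < b * q)%N ->
    delta / (4 * Q%:R ^+ 2) <= dist_int (s + i%:R * gamma)) ->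
  `|\sum_(i < b * q) (1 + ln (fracpart (s + i%:R * gamma)))| <=
  (51 - 12 * ln delta) * (b%:R * (1 + ln q%:R)).
Proof.
move=> d01; case: q => [|[|[|r]]]// _; set q := r.+3 => qQ bqQ cop gaq dq dQ.
have q0 : 0 < q%:R :> R by [].
have Q0 : 0 < Q%:R :> R by rewrite ltr0n (leq_trans _ qQ).
set eps := gamma - _ in gaq.
set k := Num.floor (q%:R * s); set rho := fracpart (q%:R * s).
have rho01 : 0 <= rho < 1 := fracpart_itv _.
pose h (i : 'I_q) : 'I_q := residue k a i.
pose y (i l : nat) := s + (i + l * q)%N%:R * gamma.
have epsq i l : (i < q)%N -> (l < b)%N ->
    `|(i + l * q)%N%:R * eps| <= q%:R^-1.
  move=> iq lb; rewrite normrM ger0_norm//.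
  apply: (@le_trans _ _ (Q%:R * (q%:R * Q%:R)^-1)).
    apply: ler_pM => //; rewrite ler_nat (leq_trans _ bqQ)//.
    apply: (@leq_trans (q + l * q)); first by rewrite leq_add2r ltnW.
    by rewrite -mulSn leq_mul2r lb orbT.
  by rewrite invfM mulrCA mulfV ?mulr1 ?gt_eqF.
have yE (i : 'I_q) (l : nat) : exists d : int,
    y i l = d%:~R + (((h i)%:R + rho) / q%:R + (i + l * q)%N%:R * eps).
  exists (((k + i%:Z * a) %/ q%:Z)%Z + l%:Z * a).
  have E : (k + i%:Z * a)%:~R =
      ((k + i%:Z * a) %/ q%:Z)%Z%:~R * q%:R + (h i)%:R :> R.
    rewrite {1}(divz_eq (k + i%:Z * a) q%:Z) -residueE intrD intrM.
    by rewrite -!pmulrn.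
  have sE : q%:R * s = k%:~R + rho by rewrite /rho /fracpart -/k; ring.
  have {}sE : s = (k%:~R + rho) / q%:R by rewrite -sE; field; lra.
  rewrite /y /eps.
  have -> : (h i)%:R = (k + i%:Z * a)%:~R -
      ((k + i%:Z * a) %/ q%:Z)%Z%:~R * q%:R :> R by rewrite E; ring.
  rewrite {1}sE natrD natrM !intrD !intrM -!pmulrn.
  by field; lra.
have good (i : 'I_q) (l : nat) : (l < b)%N -> (2 <= h i <= r.+1)%N ->
    (h i).-1%:R / q%:R <= fracpart (y i l) <= (h i).+2%:R / q%:R.
  move=> lb /andP[h2 hr]; have [d yd] := yE i l.
  have e := epsq i l (ltn_ord i) lb; rewrite ler_norml in e.
  have hp : (h i).-1%:R = (h i)%:R - 1 :> R.
    by rewrite -[in RHS](prednK (ltnW h2)) -natr1 addrK.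
  have hs : (h i).+2%:R = (h i)%:R + 2 :> R by rewrite -addn2 natrD.
  have h2R : 2 <= (h i)%:R :> R by rewrite ler_nat.
  have hrR : (h i)%:R + 2 <= q%:R :> R by rewrite -hs ler_nat !ltnS.
  set z := _ + _ * eps in yd.
  have zlo : (h i).-1%:R / q%:R <= z.
    rewrite hp mulrBl mul1r /z mulrDl.
    have : 0 <= rho / q%:R by rewrite divr_ge0//; lra.
    lra.
  have zhi : z < (h i).+2%:R / q%:R.
    rewrite hs mulrDl /z mulrDl.
    have : rho / q%:R < q%:R^-1 by rewrite ltr_pdivrMr// mulVf ?gt_eqF//; lra.
    by rewrite [2 / _]mulrDl !mul1r; lra.
  rewrite (fracpart_unique yd) ?zlo ?(ltW zhi)//.
  rewrite (le_trans _ zlo) ?divr_ge0//= (lt_le_trans zhi)//.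
  by rewrite ler_pdivrMr// mul1r hs.
have q1 : 1 <= q%:R :> R by rewrite ler1n.
have Q1 : 1 <= Q%:R :> R by rewrite ler1n -(ltr0n R).
have lq : 0 <= ln q%:R :> R by apply: ln_ge0.
have ld : ln delta <= 0 by apply: ln_le0; lra.
set D := 17 - 4 * ln delta + 6 * ln q%:R.
have D0 : 0 <= D by rewrite /D; lra.
have yb (i l : nat) : (i < q)%N -> (l < b)%N -> (i + l * q < b * q)%N.
  move=> iq lb; apply: (@leq_trans (q + l * q)); first by rewrite ltn_add2r.
  by rewrite -mulSn leq_mul2r lb orbT.
have dist0 (i l : nat) : (i < q)%N -> (l < b)%N -> 0 < dist_int (y i l).
  move=> iq lb; apply: lt_le_trans (dQ _ (yb _ _ iq lb)).
  by rewrite divr_gt0 ?mulr_gt0 ?exprn_gt0//; lra.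
(* Since q gamma = a + q eps, the points of indices i + l q advance modulo 1 by eta = q eps as l
   grows. *)
have bad (i : 'I_q) : - (b%:R * D) <= \sum_(l < b) ln (fracpart (y i l)).
  pose eta := q%:R * eps.
  have yAP (l : nat) : dist_int (y i l) =
      dist_int (s + i%:R * gamma + l%:R * eta).
    rewrite -(dist_intDz (s + _ + _) (l%:Z * a)); congr dist_int.
    by rewrite /y /eta natrD natrM intrM -pmulrn /eps; field; lra.
  have etaQ : Q%:R * `|eta| <= 1.
    rewrite /eta normrM ger0_norm// mulrA [Q%:R * _]mulrC.
    by rewrite -ler_pdivlMl ?mulr1// mulr_gt0.
  have -> : b%:R * D = b%:R * (17 - 4 * ln delta + 6 * ln q%:R) by [].
  apply: le_trans (lnsum_progression d01 q1 Q0 etaQ _ (dq i (ltn_ord i)) _) _.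
  - have : b%:R * q%:R <= Q%:R :> R by rewrite -natrM ler_nat.
    have q2 : 2 <= q%:R :> R by rewrite ler_nat.
    have e0 := normr_ge0 eta; have b0 : 0 <= b%:R :> R by [].
    move=> bq; have : b%:R * 2 <= Q%:R :> R by nra.
    by nra.
  - move=> l lb; rewrite -yAP; apply: dQ; exact: yb.
  - apply: ler_sum => l _; rewrite -yAP.
    have h1 := dist0 i l (ltn_ord i) (ltn_ord l).
    have h2 := dist_int_le_fracpart (y i l).
    by rewrite ler_ln ?posrE//; lra.
have bad' (i : 'I_q) : \sum_(l < b) ln (fracpart (y i l)) <= 0.
  apply: sumr_le0 => l _; apply: ln_le0.
  by have := fracpart_itv (y i l); lra.
pose isgood (m : nat) := (2 <= m <= r.+1)%N.
pose lo (m : nat) := if isgood m then ln (m.-1%:R / q%:R) else - D.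
pose up (m : nat) : R := if isgood m then ln (m.+2%:R / q%:R) else 0.
have frac0 (i : 'I_q) (l : nat) : (l < b)%N -> 0 < fracpart (y i l).
  move=> lb; apply: lt_le_trans (dist_int_le_fracpart _).
  exact: dist0.
have Hlo (i : 'I_q) : b%:R * lo (h i) <= \sum_(l < b) ln (fracpart (y i l)).
  rewrite /lo; case: ifPn => [hg|_]; last by rewrite mulrN.
  rewrite mulr_natl -[b in leLHS]card_ord -sumr_const; apply: ler_sum => l _.
  have /andP[g1 _] := good i l (ltn_ord l) hg.
  have hp : 0 < (h i).-1%:R / q%:R :> R.
    rewrite divr_gt0// ltr0n -ltnS prednK.
      by case/andP : hg.
    by case/andP : hg => /ltnW.
  by rewrite ler_ln ?posrE// (lt_le_trans hp).
have Hup (i : 'I_q) : \sum_(l < b) ln (fracpart (y i l)) <= b%:R * up (h i).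
  rewrite /up; case: ifPn => [hg|_]; last by rewrite mulr0.
  rewrite mulr_natl -[b in leRHS]card_ord -sumr_const; apply: ler_sum => l _.
  have /andP[_ g1] := good i l (ltn_ord l) hg.
  have hp := frac0 i l (ltn_ord l).
  by rewrite ler_ln ?posrE// (lt_le_trans hp).
have hinj : injective h by exact: residue_inj.
have Slo : - q%:R - 3 * D <= \sum_(i < q) lo (h i).
  rewrite -(reindex_inj hinj (F := fun i : 'I_q => lo i) (P := xpredT))/=.
  rewrite big_ord_recl big_ord_recl big_ord_recr/=.
  have -> : \sum_(i < r) lo (bump 0 (bump 0 i)) = \sum_(i < r) ln (i.+1%:R / q%:R).
    apply: eq_bigr => i _.
    by rewrite /lo /isgood /bump/= !add1n !ltnS ltn_ord.
  rewrite {1 2 3}/lo /isgood/= /bump/= !add1n ltnn.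
  by have := lnsum_grid_ge r; rewrite -/q; lra.
have Sup : \sum_(i < q) up (h i) <= - q%:R + 1 + 4 * ln q%:R.
  rewrite -(reindex_inj hinj (F := fun i : 'I_q => up i) (P := xpredT))/=.
  rewrite big_ord_recl big_ord_recl big_ord_recr/=.
  have -> : \sum_(i < r) up (bump 0 (bump 0 i)) = \sum_(i < r) ln (i.+4%:R / q%:R).
    apply: eq_bigr => i _.
    by rewrite /up /isgood /bump/= !add1n !ltnS ltn_ord.
  rewrite {1 2 3}/up /isgood/= /bump/= !add1n ltnn.
  by have := lnsum_grid_le r; rewrite -/q; lra.
rewrite big_split/= sumr_const card_ord.
rewrite (sum_block (fun i => ln (fracpart (s + i%:R * gamma)))).
set S := \sum_(i < q) _.
have S1 : b%:R * (- q%:R - 3 * D) <= S.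
  apply: (@le_trans _ _ (\sum_(i < q) b%:R * lo (h i))).
    by rewrite -mulr_sumr ler_wpM2l.
  by apply: ler_sum => i _; exact: Hlo.
have S2 : S <= b%:R * (- q%:R + 1 + 4 * ln q%:R).
  apply: (@le_trans _ _ (\sum_(i < q) b%:R * up (h i))); last first.
    by rewrite -mulr_sumr ler_wpM2l.
  by apply: ler_sum => i _; exact: Hup.
have b0 : 0 <= b%:R :> R by [].
rewrite natrM ler_norml; apply/andP; split.
  apply: (@le_trans _ _ (b%:R * (- (3 * D)))); last lra.
  rewrite mulrN lerN2 [leRHS]mulrCA ler_wpM2l// /D; nra.
apply: (@le_trans _ _ (b%:R * (1 + 4 * ln q%:R))); first lra.
by rewrite mulrCA ler_wpM2l//; nra.
Qed.

End block_of_orbit.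

(** * Logarithmic sums along a sequence of denominators *)

Section orbit_growth.
Variables (R : realType) (q : nat -> nat) (m0 : nat).

(** The i-th term bounds the cost of the blocks attached to q_i: at most min(n, q_(i+1)) indices,
    each costing (1 + ln q_i)/q_i. The minimum, in place of the actual digit of n, makes the weight
    nondecreasing; the range ends at m0 + 2n, where the denominators already exceed n. *)
Definition orbit_weight (C : R) (n : nat) : R :=
  C + C * \sum_(m0 <= i < m0 + n.*2)
    (minn n (q i.+1))%:R * ((1 + ln (q i)%:R) / (q i)%:R).

Hypothesis q4 : (4 <= q m0)%N.
Hypothesis q_nd : forall i, (m0 <= i)%N -> (q i <= q i.+1)%N.
Hypothesis q_double : forall i, (m0 <= i)%N -> ((q i).*2 <= q i.+2)%N.

Lemma ln2_ge : 1 / 2 <= ln 2 :> R.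
Proof.
have : ln (1 + - (1 / 2)) <= - (1 / 2) :> R by apply: le_ln1Dx; lra.
have -> : 1 + - (1 / 2) = 2^-1 :> R by field.
by rewrite lnV ?posrE//; lra.
Qed.

Lemma q_ge i : (m0 <= i)%N -> (4 <= q i)%N.
Proof.
move=> mi; rewrite -(subnK mi); elim: (i - m0)%N => [//|k IH].
by rewrite addSn (leq_trans IH)// q_nd// leq_addl.
Qed.

Lemma q_exp k : (4 * 2 ^ k./2 <= q (m0 + k))%N.
Proof.
suff [] : (4 * 2 ^ k./2 <= q (m0 + k))%N /\ (4 * 2 ^ k.+1./2 <= q (m0 + k.+1))%N by [].
elim: k => [|k [IH1 IH2]].
  by rewrite addn0 /= addn1 !muln1 q4 (leq_trans q4)// q_nd.
split => //; rewrite addnS addnS (leq_trans _ (q_double _)) ?leq_addr//.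
by rewrite /= expnS mulnCA mul2n leq_double.
Qed.

Let g i : R := (1 + ln (q i)%:R) / (q i)%:R.

Let g_ge0 i : (m0 <= i)%N -> 0 <= g i.
Proof.
move=> mi; rewrite divr_ge0// addr_ge0// ln_ge0// ler1n.
by rewrite (leq_trans _ (q_ge mi)).
Qed.

Lemma orbit_weight_nd (C : R) m n : 0 <= C -> (m <= n)%N ->
  orbit_weight C m <= orbit_weight C n.
Proof.
move=> C0 mn; rewrite /orbit_weight lerD2l ler_wpM2l//.
rewrite [leRHS](@big_cat_nat _ _ _ (m0 + m.*2)%N) ?leq_addr//=; last first.
  by rewrite leq_add2l leq_double.
apply: (@le_trans _ _ (\sum_(m0 <= i < m0 + m.*2) (minn n (q i.+1))%:R * g i)).
  rewrite big_seq_cond [leRHS]big_seq_cond; apply: ler_sum => i.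
  rewrite mem_index_iota andbT => /andP[mi _]; rewrite ler_wpM2r ?g_ge0//.
  by rewrite ler_nat leq_min geq_minr (leq_trans (geq_minl _ _) mn).
rewrite lerDl big_seq_cond; apply: sumr_ge0 => i.
rewrite mem_index_iota andbT => /andP[mi _].
by rewrite mulr_ge0 ?g_ge0// (leq_trans (leq_addr _ _) mi).
Qed.

Lemma orbit_weight_ge0 (C : R) n : 0 <= C -> 0 <= orbit_weight C n.
Proof.
move=> C0; rewrite addr_ge0// mulr_ge0// big_seq_cond sumr_ge0// => i.
rewrite mem_index_iota andbT => /andP[mi _].
by rewrite mulr_ge0 ?g_ge0.
Qed.

Section bound.
Variables (a : nat -> int) (gamma delta : R).
Hypothesis q_coprime : forall i, (m0 <= i)%N -> coprimez (q i)%:Z (a i).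
Hypothesis q_approx : forall i, (m0 <= i)%N ->
  `|gamma - (a i)%:~R / (q i)%:R| <= ((q i)%:R * (q i.+1)%:R)^-1.
Hypothesis delta01 : 0 < delta <= 1.

(** Induction on the level: for n = n' + b q with n' < q, the first n' points fall under the
    previous level and the other b q form a block started at s + n' gamma. Below q_m0 the slow
    recurrence bounds each term separately, which gives [C0]. *)
Lemma orbit_weight_bound : exists2 C : R, 0 <= C & forall s : R,
  (forall j : nat, delta / (j.+1)%:R ^+ 2 <= dist_int (s + j%:R * gamma)) ->
  forall n, `|\sum_(i < n) (1 + ln (fracpart (s + i%:R * gamma)))| <=
    orbit_weight C n.
Proof.
have /andP[dlt0 dlt1] := delta01.
pose C1 : R := 51 - 12 * ln delta.
pose C0 := (q m0)%:R * (1 - ln delta + 2 * ln (q m0)%:R).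
have ld : ln delta <= 0 by apply: ln_le0; lra.
have lq : 0 <= ln (q m0)%:R :> R.
  by apply: ln_ge0; rewrite ler1n (leq_trans _ q4).
have C00 : 0 <= C0 by rewrite mulr_ge0//; lra.
have C10 : 0 <= C1 by rewrite /C1; lra.
exists (C0 + C1); first exact: addr_ge0.
move=> s sd; pose L n := \sum_(i < n) (1 + ln (fracpart (s + i%:R * gamma))).
suff H k n : (n < q (m0 + k))%N -> `|L n| <=
    C0 + C1 * \sum_(m0 <= i < m0 + k) (minn n (q i.+1))%:R * g i.
  move=> n; have nq : (n < q (m0 + n.*2))%N.
    apply: leq_trans (q_exp _); rewrite doubleK.
    by rewrite (leq_trans (ltn_expl n (isT : 1 < 2)%N))// leq_pmull.
  apply: le_trans (H _ _ nq) _; rewrite /orbit_weight -/g.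
  have S0 : 0 <= \sum_(m0 <= i < m0 + n.*2) (minn n (q i.+1))%:R * g i.
    rewrite big_seq_cond sumr_ge0// => i; rewrite mem_index_iota andbT => /andP[mi _].
    by rewrite mulr_ge0 ?g_ge0.
  rewrite /g in S0 *; nra.
elim: k n => [|k IH] n nq.
  rewrite addn0 big_geq// mulr0 addr0 /L.
  apply: (@le_trans _ _ (\sum_(i < n) (1 - ln delta + 2 * ln (q m0)%:R))).
    apply: (le_trans (ler_norm_sum _ _ _)); apply: ler_sum => i _.
    have di := sd i; have := dist_int_le_fracpart (s + i%:R * gamma).
    have := fracpart_itv (s + i%:R * gamma); set f := fracpart _ => f01 df.
    have dp : 0 < delta / i.+1%:R ^+ 2 by rewrite divr_gt0 ?exprn_gt0//; lra.
    have fd := le_trans di df; have f0 := lt_le_trans dp fd.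
    have lf : ln (delta / i.+1%:R ^+ 2) <= ln f by rewrite ler_ln ?posrE.
    rewrite ln_div ?posrE ?exprn_gt0// in lf.
    rewrite lnXn// -[_ *+ 2]mulr_natl in lf.
    have li : ln i.+1%:R <= ln (q m0)%:R :> R.
      rewrite ler_ln ?posrE ?ltr0n ?(leq_trans _ q4)// ler_nat.
      by rewrite addn0 in nq; rewrite (leq_trans _ nq)// ltnS ltnW ?ltn_ord.
    have lf0 : ln f <= 0 by apply: ln_le0; lra.
    rewrite ler_norml; lra.
  rewrite sumr_const card_ord -[leLHS]mulr_natl /C0 ler_wpM2r//; first lra.
  by rewrite ler_nat; rewrite addn0 in nq; exact: ltnW.
have mk : (m0 <= m0 + k)%N by exact: leq_addr.
set m := (m0 + k)%N in mk IH *.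
have qm4 := q_ge mk.
pose b := (n %/ q m)%N; pose n' := (n %% q m)%N.
have nE : n = (n' + b * q m)%N by rewrite addnC -divn_eq.
have n'q : (n' < q m)%N by rewrite ltn_mod (leq_trans _ qm4).
have LE : L n = L n' + \sum_(i < b * q m)
    (1 + ln (fracpart ((s + n'%:R * gamma) + i%:R * gamma))).
  rewrite {1}nE /L big_split_ord/=; congr (_ + _); apply: eq_bigr => i _.
  by congr (1 + ln (fracpart _)); rewrite natrD; ring.
rewrite addnS in nq *.
have qm0 : 0 < (q m)%:R :> R by rewrite ltr0n (leq_trans _ qm4).
have dist_ge (i j : nat) : (i < j)%N -> delta / j%:R ^+ 2 <= dist_int (s + i%:R * gamma).
  move=> ij; apply: le_trans (sd i).
  rewrite ler_wpM2l//; first lra.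
  rewrite lef_pV2 ?posrE ?exprn_gt0// ?ltr0n ?(leq_ltn_trans _ ij)//.
  by rewrite lerXn2r ?nnegrE// ler_nat.
have bq : (b * q m <= q m.+1)%N.
  by apply: leq_trans (ltnW nq); rewrite nE leq_addl.
have H := @ln_block_bound R gamma (s + n'%:R * gamma) delta (a m) (q m) (q m.+1) b
  delta01 (ltnW qm4) (q_nd mk) bq (q_coprime mk) (q_approx mk).
have {}H := H _ _.
rewrite LE (le_trans (ler_normD _ _))//.
rewrite big_nat_recr//= mulrDr addrA lerD//.
  apply: le_trans (IH _ n'q) _; rewrite lerD2l ler_wpM2l//.
  rewrite big_seq_cond [leRHS]big_seq_cond; apply: ler_sum => i.
  rewrite mem_index_iota andbT => /andP[mi _]; rewrite ler_wpM2r ?g_ge0//.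
  rewrite ler_nat leq_min geq_minr andbT (leq_trans (geq_minl _ _))//.
  by rewrite nE leq_addr.
apply: le_trans (H _ _) _ => [i iq|i iq|].
(* The block starts at an index n' < q_m, so its first q_m points have indices below 2 q_m; hence
   the 4 in the block estimate. *)
- have -> : 4 * (q m)%:R ^+ 2 = (2 * q m)%N%:R ^+ 2 :> R by rewrite natrM; ring.
  rewrite -addrA -mulrDl -natrD; apply: dist_ge.
  by rewrite mul2n -addnn -addSn leq_add// ltnW.
- have -> : 4 * (q m.+1)%:R ^+ 2 = (2 * q m.+1)%N%:R ^+ 2 :> R by rewrite natrM; ring.
  rewrite -addrA -mulrDl -natrD; apply: dist_ge.
  rewrite mul2n -addnn -addSn leq_add//; first exact: leq_trans n'q (q_nd mk).
  exact: leq_trans (ltnW iq) bq.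
rewrite ler_wpM2l//.
have -> : b%:R * (1 + ln (q m)%:R) = (b * q m)%N%:R * g m :> R.
  by rewrite natrM /g; field; lra.
rewrite ler_wpM2r ?g_ge0// ler_nat leq_min bq andbT.
by rewrite nE leq_addl.
Qed.

End bound.

(** Terms below l are at most 1 and the later ones form a geometric series: the dyadic sum of
    min(2^j, Q) is O(ln Q). *)
Let sum_min (Q l J : nat) : (Q <= 2 ^ l)%N ->
  \sum_(j < J) (minn (2 ^ j) Q)%:R / 2 ^+ j <= l%:R + 2 :> R.
Proof.
move=> Ql; have p2 j : 0 < 2 ^+ j :> R by rewrite exprn_gt0.
have H1 K : \sum_(j < K) (minn (2 ^ j) Q)%:R / 2 ^+ j <= K%:R :> R.
  rewrite -[K in leRHS]card_ord -sumr_const; apply: ler_sum => j _.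
  by rewrite ler_pdivrMr// mul1r -natrX ler_nat geq_minl.
have [Jl|lJ] := leqP J l.
  by apply: le_trans (H1 J) _; rewrite -[leLHS]addr0 lerD// ler_nat.
rewrite -(subnKC (ltnW lJ)) big_split_ord/= lerD//; first exact: H1.
set K := (J - l)%N.
apply: (@le_trans _ _ (\sum_(i < K) 2^-1 ^+ i)).
  apply: ler_sum => i _; rewrite ler_pdivrMr// exprD mulrCA -exprMn mulVf//.
  by rewrite expr1n mulr1 -natrX ler_nat geq_min Ql orbT.
suff -> : \sum_(i < K) 2^-1 ^+ i = 2 - 2 * 2^-1 ^+ K :> R.
  by rewrite gerBl mulr_ge0// exprn_ge0// invr_ge0.
elim: K => [|K IH]; first by rewrite big_ord0 expr0; lra.
by rewrite big_ord_recr/= IH exprS; lra.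
Qed.

(* The growth condition makes the contribution of the denominator [q i] to the
   dyadic sum [O((ln (q i))^-2)], and [ln (q i)] grows linearly. *)
Lemma orbit_weight_summable (K C : R) : 0 <= C -> 0 <= K ->
  (forall i, (m0 <= i)%N ->
    ln (q i.+1)%:R <= K * ((q i)%:R / ln (q i)%:R ^+ 3)) ->
  exists B : R, forall J,
    \sum_(j < J) orbit_weight C (2 ^ j)%N / 2 ^+ j <= B.
Proof.
move=> C0 K0 qK; exists (2 * C + C * (320 * K)) => J.
have p2 j : 0 < 2 ^+ j :> R by rewrite exprn_gt0.
pose I := (m0 + (2 ^ J).*2)%N.
have lnq k : (k.+1)%:R / 4 <= ln (q (m0 + k)%N)%:R :> R.
  have h : ln (2 ^+ (k./2.+2)) <= ln (q (m0 + k)%N)%:R :> R.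
    rewrite ler_ln ?posrE ?exprn_gt0//; last first.
      by rewrite ltr0n (leq_trans _ (q_exp k))// muln_gt0 expn_gt0.
    by rewrite -natrX ler_nat (leq_trans _ (q_exp k))// !expnS mulnA.
  apply: le_trans h; rewrite lnXn// -[ln _ *+ _]mulr_natl.
  have h2 : k.+1%:R <= k./2.+2%:R * 2 :> R.
    by rewrite -natrM ler_nat; lia.
  have := ler_wpM2l (ler0n R k./2.+2) ln2_ge; lra.
have lnq1 i : (m0 <= i)%N -> 1 <= ln (q i)%:R :> R.
  move=> mi; apply: (@le_trans _ _ (ln (2 ^+ 2))).
    by rewrite lnXn// -[ln _ *+ _]mulr_natl; have := ln2_ge; lra.
  rewrite ler_ln ?posrE// ?ltr0n ?(leq_trans _ (q_ge mi))//.
  by rewrite -natrX ler_nat q_ge.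
apply: (@le_trans _ _ (\sum_(j < J) (C * (2 ^+ j)^-1 +
    C * \sum_(m0 <= i < I) (minn (2 ^ j) (q i.+1))%:R / 2 ^+ j * g i))).
  apply: ler_sum => j _; rewrite mulrDl -mulrA lerD// ler_wpM2l//.
  rewrite mulr_suml [leRHS](@big_cat_nat _ _ _ (m0 + (2 ^ j).*2)%N) ?leq_addr//=;
    last first.
    by rewrite leq_add2l leq_double leq_exp2l// ltnW.
  apply: (@le_trans _ _ (\sum_(m0 <= i < m0 + (2 ^ j).*2)
     (minn (2 ^ j) (q i.+1))%:R / 2 ^+ j * g i)).
    by apply: ler_sum => i _; rewrite mulrAC.
  rewrite lerDl big_seq_cond; apply: sumr_ge0 => i.
  rewrite mem_index_iota andbT => /andP[mi _].
  have mi' := leq_trans (leq_addr _ _) mi.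
  by rewrite mulr_ge0 ?g_ge0// divr_ge0// ltW.
rewrite big_split/= -!mulr_sumr lerD//.
  rewrite mulrC ler_wpM2r//.
  suff -> : \sum_(i < J) (2 ^+ i)^-1 = 2 - 2 * (2 ^+ J)^-1 :> R.
    by rewrite gerBl mulr_ge0// invr_ge0 ltW.
  elim: (J) => [|L IH]; first by rewrite big_ord0 expr0 invr1; lra.
  by rewrite big_ord_recr/= IH exprS; field; rewrite gt_eqF.
rewrite ler_wpM2l// exchange_big/=.
(* The inner sum over j is at most 5 ln q_(i+1), to which the growth condition applies, and [g i] is
   at most 2 ln q_i / q_i; hence 10 K. *)
apply: (@le_trans _ _ (\sum_(m0 <= i < I) 10 * K / ln (q i)%:R ^+ 2)).
  rewrite big_seq_cond [leRHS]big_seq_cond; apply: ler_sum => i.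
  rewrite mem_index_iota andbT => /andP[mi _]; rewrite -mulr_suml.
  have qi1 : (4 <= q i.+1)%N by apply: q_ge; exact: leqW.
  have qi0 : 0 < (q i)%:R :> R by rewrite ltr0n (leq_trans _ (q_ge mi)).
  have l1 := lnq1 i mi; have l2 := lnq1 i.+1 (leqW mi).
  have q1p : (0 < q i.+1)%N by rewrite (leq_trans _ qi1).
  have tl : ((q i.+1) <= 2 ^ (trunc_log 2 (q i.+1)).+1)%N.
    by rewrite ltnW// trunc_log_ltn.
  have := sum_min J tl; set S := \sum_(j < J) _ => HS.
  have lt : (trunc_log 2 (q i.+1))%:R <= 2 * ln (q i.+1)%:R :> R.
    have : ln (2 ^+ trunc_log 2 (q i.+1)) <= ln (q i.+1)%:R :> R.
      rewrite ler_ln ?posrE ?exprn_gt0 ?ltr0n// -natrX ler_nat.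
      exact: trunc_logP.
    rewrite lnXn// -[ln _ *+ _]mulr_natl; have := ln2_ge.
    have : 0 <= (trunc_log 2 (q i.+1))%:R :> R by [].
    by nra.
  have {}HS : S <= 5 * ln (q i.+1)%:R by rewrite -natr1 in HS; lra.
  have gle : g i <= 2 * ln (q i)%:R / (q i)%:R.
    by rewrite /g ler_wpM2r ?invr_ge0 ?(ltW qi0)//; lra.
  have S0 : 0 <= S by apply: sumr_ge0 => j _; rewrite divr_ge0// ltW.
  apply: (@le_trans _ _ (5 * (K * ((q i)%:R / ln (q i)%:R ^+ 3)) *
     (2 * ln (q i)%:R / (q i)%:R))).
    apply: ler_pM => //; first exact: g_ge0.
    by apply: (le_trans HS); rewrite ler_pM2l// qK.
  rewrite le_eqVlt; apply/orP; left; apply/eqP; field.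
  by rewrite gt_eqF//=; lra.
(* From ln q_(m0+k) >= (k+1)/4 comes 16/(k+1)^2, and 1/x^2 <= 2/(x (x+1)) telescopes: 320 = 10 * 16
   * 2. *)
apply: (@le_trans _ _ (\sum_(k < (2 ^ J).*2) 320 * K * ((k.+1)%:R^-1 - (k.+2)%:R^-1))).
  rewrite /I [(m0 + _)%N]addnC -{1}[m0]add0n big_addn addnK big_mkord.
  apply: ler_sum => k _; rewrite [(k + m0)%N]addnC.
  have h := lnq k; set l := ln _ in h *.
  have k0 : 0 < k.+1%:R :> R by [].
  have l0 : 0 < l by lra.
  apply: (@le_trans _ _ (10 * K * (16 / k.+1%:R ^+ 2))).
    rewrite ler_wpM2l ?mulr_ge0// -invf_div lef_pV2 ?posrE ?divr_gt0 ?exprn_gt0//.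
    by rewrite ler_pdivrMr//; nra.
  rewrite -[k.+2%:R]natr1; set x := k.+1%:R in k0 *.
  have x1 : 1 <= x by rewrite ler1n.
  have -> : x^-1 - (x + 1)^-1 = (x * (x + 1))^-1 by field; lra.
  have -> : 320 * K * (x * (x + 1))^-1 = 10 * K * (16 / (x * (x + 1) / 2)) by field; lra.
  rewrite ler_wpM2l ?mulr_ge0// ler_wpM2l//.
  rewrite lef_pV2 ?posrE ?exprn_gt0 ?divr_gt0 ?mulr_gt0//; try lra.
  by rewrite expr2; nra.
have c0 : 0 <= 320 * K by lra.
set c := 320 * K in c0 *; rewrite -mulr_sumr -[leRHS]mulr1 ler_wpM2l//.
suff H n : \sum_(k < n) ((k.+1)%:R^-1 - (k.+2)%:R^-1) = 1 - (n.+1)%:R^-1 :> R.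
  by rewrite H gerBl invr_ge0.
elim: n => [|n IH]; first by rewrite big_ord0 invr1 subrr.
by rewrite big_ord_recr/= IH; ring.
Qed.

End orbit_growth.

(** * Continued fractions *)

Section convergents.
Variables (R : realType) (alpha : R).
Hypothesis alpha01 : 0 < alpha < 1.
Hypothesis alpha_irr : irrational alpha.

Local Notation x := (complete_quotient alpha).
Local Notation a := (partial_quotient alpha).

Fixpoint continuants (u v : int) (n : nat) : int * int :=
  if n is n'.+1 then
    let w := continuants u v n' in (w.2, a n' * w.2 + w.1)
  else (u, v).

(* Shifted by two: [cf_num j.+2] and [cf_den j.+2] are the numerator and the
   denominator of the [j]-th convergent. *)
Definition cf_num n := (continuants 0 1 n).1.
Definition cf_den n := (continuants 1 0 n).1.

Lemma cf_numSS n : cf_num n.+2 = a n * cf_num n.+1 + cf_num n.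
Proof. by []. Qed.

Lemma cf_denSS n : cf_den n.+2 = a n * cf_den n.+1 + cf_den n.
Proof. by []. Qed.

Lemma complete_quotientE n : x n = (a n)%:~R + fracpart (x n).
Proof. by rewrite /fracpart /partial_quotient addrC subrK. Qed.

Lemma complete_quotient_irr n : irrational (x n).
Proof.
elim: n => [//|n IH] [r _ rx]; apply: IH; exists ((a n)%:~R + r^-1) => //.
rewrite rmorphD/= fmorphV/= rx ratr_int /= [RHS]complete_quotientE.
by congr (_ + _); rewrite /= invrK.
Qed.

Lemma fracpart_complete_quotient n : 0 < fracpart (x n).
Proof.
have /andP[f0 _] := fracpart_itv (x n).
rewrite lt_neqAle f0 andbT; apply/negP => /eqP e.
apply: (@complete_quotient_irr n); exists (a n)%:~R => //.
by rewrite ratr_int [RHS]complete_quotientE -e addr0.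
Qed.

Lemma complete_quotientSE n : x n.+1 * (x n - (a n)%:~R) = 1.
Proof.
rewrite [x n]complete_quotientE addrAC subrr add0r /=.
by rewrite mulVf// gt_eqF// fracpart_complete_quotient.
Qed.

Lemma partial_quotient0 : a 0%N = 0.
Proof. by apply: floor_def; rewrite /= add0r; move: alpha01; lra. Qed.

Lemma partial_quotient_ge1 n : 1 <= a n.+1.
Proof.
rewrite /partial_quotient floor_ge_int /=.
have f0 := fracpart_complete_quotient n; have := fracpart_itv (x n).
by move=> /andP[_ f1]; rewrite invf_ge1// ltW.
Qed.

Lemma partial_quotient_ge0 n : 0 <= a n.
Proof.
case: n => [|n]; first by rewrite partial_quotient0.
exact: le_trans (partial_quotient_ge1 n).
Qed.

Lemma cf_den_ge0 n : 0 <= cf_den n.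
Proof.
suff [] : 0 <= cf_den n /\ 0 <= cf_den n.+1 by [].
elim: n => [//|n [IH1 IH2]]; split=> //.
by rewrite cf_denSS addr_ge0// mulr_ge0// partial_quotient_ge0.
Qed.

Lemma cf_den_ge1 n : 1 <= cf_den n.+2.
Proof.
elim: n => [|n IH]; first by rewrite cf_denSS mulr0 add0r.
rewrite cf_denSS; apply: (@le_trans _ _ (a n.+1 * cf_den n.+2)).
  by rewrite mulr_ege1// partial_quotient_ge1.
by rewrite lerDl cf_den_ge0.
Qed.

Lemma cf_den_nd n : cf_den n.+2 <= cf_den n.+3.
Proof.
rewrite [leRHS]cf_denSS; have := cf_den_ge0 n.+1; have := cf_den_ge1 n.
by have := partial_quotient_ge1 n; nia.
Qed.

Lemma cf_den_double n : 2 * cf_den n.+2 <= cf_den n.+4.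
Proof.
rewrite [leRHS]cf_denSS; have := cf_den_nd n; have := cf_den_ge1 n.
by have := partial_quotient_ge1 n.+1; nia.
Qed.

(** Expresses alpha as the Moebius image of its n-th complete quotient, cross-multiplied so that the
    induction is a polynomial identity. *)
Lemma cf_moebius n :
  alpha * ((cf_den n.+1)%:~R * x n + (cf_den n)%:~R) =
  (cf_num n.+1)%:~R * x n + (cf_num n)%:~R.
Proof.
elim: n => [|n IH]; first by rewrite /= !mul0r add0r addr0 mulr1 mul1r.
have h := complete_quotientSE n.
rewrite cf_denSS cf_numSS !intrD !intrM.
move: (x n.+1) (x n) h IH => X Y h IH.
have e : X * Y = 1 + (a n)%:~R * X by rewrite -[X in X + _]h; ring.
transitivity (X * (alpha * ((cf_den n.+1)%:~R * Y + (cf_den n)%:~R))).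
  transitivity (alpha * ((cf_den n.+1)%:~R * (X * Y) + (cf_den n)%:~R * X)).
    by rewrite e; ring.
  by ring.
rewrite IH; transitivity ((cf_num n.+1)%:~R * (X * Y) + (cf_num n)%:~R * X).
  by ring.
by rewrite e; ring.
Qed.

Lemma cf_det n : cf_num n.+1 * cf_den n - cf_num n * cf_den n.+1 = (-1) ^+ n.
Proof.
elim: n => [|n IH]; first by rewrite /cf_num /cf_den /=.
by rewrite cf_numSS cf_denSS exprS -IH; ring.
Qed.

Lemma cf_coprime n : coprimez (cf_den n.+1) (cf_num n.+1).
Proof.
rewrite coprimez_sym; apply/coprimezP.
have := cf_det n; rewrite -signr_odd; case: (odd n) => /= h.
  exists (- cf_den n, cf_num n) => /=; move: h; rewrite expr1; lia.
exists (cf_den n, - cf_num n) => /=; move: h; rewrite expr0; lia.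
Qed.

(** [cf_eval] nests from the front, whereas continuants grow at the back. A variable innermost entry
    z reconciles them: one more quotient amounts to replacing z by a_n + 1/z. *)
Let cf_tail (s : seq int) (z : rat) : rat :=
  foldr (fun c acc => c%:~R + acc^-1) z s.

Let cf_eval_rcons s c : cf_eval (rcons s c) = cf_tail s c%:~R.
Proof.
by elim: s => [|b s IH] /=; [rewrite invr0 addr0|rewrite IH].
Qed.

Let cf_tailE n z : 0 < z -> cf_tail (mkseq a n) z =
  ((cf_num n.+1)%:~R * z + (cf_num n)%:~R) /
  ((cf_den n.+1)%:~R * z + (cf_den n)%:~R).
Proof.
elim: n z => [|n IH] z z0.
  by rewrite /= mul1r mul0r !addr0 add0r divr1.
have a0 := partial_quotient_ge0 n.
have -> : cf_tail (mkseq a n.+1) z = cf_tail (mkseq a n) ((a n)%:~R + z^-1).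
  by rewrite mkseqS /cf_tail foldr_rcons.
rewrite IH; last by rewrite ltr_wpDl ?ler0z ?invr_gt0.
rewrite cf_numSS cf_denSS.
have d0 : 0 <= (cf_den n)%:~R :> rat by rewrite ler0z cf_den_ge0.
have d1 : 0 <= (cf_den n.+1)%:~R :> rat by rewrite ler0z cf_den_ge0.
have D : 0 < ((a n)%:~R * (cf_den n.+1)%:~R + (cf_den n)%:~R) * z +
    (cf_den n.+1)%:~R :> rat.
  have := cf_den_ge0 n.+2; rewrite cf_denSS le_eqVlt => /predU1P[e|p].
    rewrite -intrM -intrD -e mul0r add0r ltr0z lt_neqAle cf_den_ge0 andbT.
    apply/negP => /eqP e1; case: n e e1 {IH a0 d0 d1} => [|n] e e1.
      by move: e; rewrite mulr0.
    by have := cf_den_ge1 n; rewrite -e1.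
  by rewrite ltr_pwDl// mulr_gt0// -intrM -intrD ltr0z.
rewrite !intrD !intrM; move: D.
move: (a n)%:~R (cf_den n.+1)%:~R (cf_den n)%:~R => A D1 D0.
move: (cf_num n.+1)%:~R (cf_num n)%:~R => N1 N0 D.
have E : (D1 * (A + z^-1) + D0) * z = (A * D1 + D0) * z + D1.
  by field; rewrite gt_eqF.
have D' : D1 * (A + z^-1) + D0 != 0.
  by apply/negP => /eqP e; move: D; rewrite -E e mul0r ltxx.
rewrite -E; field; rewrite gt_eqF//=.
by apply/negP => /eqP e; move: D; rewrite [X in _ < X](_ : _ = 0) ?ltxx// -e; ring.
Qed.

Lemma convergentE j : convergent alpha j =
  (cf_num j.+2)%:~R / (cf_den j.+2)%:~R.
Proof.
rewrite /convergent mkseqS cf_eval_rcons.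
(* For j = 0 the innermost entry is a_0 = 0, outside the range z > 0 of [cf_tailE]. *)
case: j => [|j].
  rewrite /= partial_quotient0 /cf_num /cf_den /= partial_quotient0.
  by rewrite !mul0r ?add0r ?addr0 ?mul0r.
rewrite cf_tailE; last first.
  by rewrite ltr0z (lt_le_trans _ (partial_quotient_ge1 _)).
by rewrite -!intrM -!intrD !(mulrC _ (a j.+1)).
Qed.

Lemma convergent_denE j : convergent_den alpha j = (cf_den j.+2)%:~R.
Proof.
have d1 := cf_den_ge1 j.
rewrite /convergent_den convergentE coprimeq_den; last first.
  by have := cf_coprime j.+1; rewrite coprimez_sym.
by rewrite gt_eqF ?gtr0_norm// (lt_le_trans _ d1).
Qed.

(** The determinant identity gives the error exactly: it is 1/(q_j y) in absolute value, with y =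
    q_j x_(j+1) + q_(j-1), and y >= q_(j+1) because x_(j+1) is at least its floor. *)
Lemma convergent_approx j :
  `|alpha - (cf_num j.+2)%:~R / (cf_den j.+2)%:~R| <=
  ((cf_den j.+2)%:~R * (cf_den j.+3)%:~R)^-1.
Proof.
have d1 : 1 <= (cf_den j.+2)%:~R :> R by rewrite ler1z cf_den_ge1.
have d2 : 1 <= (cf_den j.+3)%:~R :> R by rewrite ler1z cf_den_ge1.
set y := (cf_den j.+2)%:~R * x j.+1 + (cf_den j.+1)%:~R.
have yd : (cf_den j.+3)%:~R <= y.
  rewrite cf_denSS intrD intrM /y lerD2r mulrC ler_wpM2l//; first lra.
  by have /andP[] := floor_itv (x j.+1).
have E : (alpha * (cf_den j.+2)%:~R - (cf_num j.+2)%:~R) * y = - (-1) ^+ j.+1.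
  have h : alpha * y = (cf_num j.+2)%:~R * x j.+1 + (cf_num j.+1)%:~R.
    exact: cf_moebius.
  have := congr1 (fun z : int => z%:~R : R) (cf_det j.+1).
  rewrite intrB !intrM intr_sign => <-.
  transitivity ((alpha * y) * (cf_den j.+2)%:~R - (cf_num j.+2)%:~R * y).
    by ring.
  by rewrite h /y; ring.
have y0 : 0 < y by lra.
have -> : alpha - (cf_num j.+2)%:~R / (cf_den j.+2)%:~R =
   - (-1) ^+ j.+1 / ((cf_den j.+2)%:~R * y) by rewrite -E; field; lra.
rewrite normrM normrN normrX normrN1 expr1n mul1r ger0_norm; last first.
  by rewrite invr_ge0 mulr_ge0//; lra.
by rewrite lef_pV2 ?posrE ?mulr_gt0//; try lra; rewrite ler_pM2l//; lra.
Qed.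

Lemma convergent_data : exists (q : nat -> nat) (p : nat -> int),
  [/\ forall j, convergent_den alpha j = (q j)%:R,
      forall j, coprimez (q j)%:Z (p j),
      forall j, `|alpha - (p j)%:~R / (q j)%:R| <= ((q j)%:R * (q j.+1)%:R)^-1,
      forall j, (0 < q j <= q j.+1)%N & forall j, ((q j).*2 <= q j.+2)%N].
Proof.
pose q j := `|cf_den j.+2|%N.
have qE j : (q j)%:Z = cf_den j.+2 by rewrite /q gez0_abs ?cf_den_ge0.
exists q, (fun j => cf_num j.+2); split => j.
- by rewrite convergent_denE -qE -pmulrn.
- by rewrite qE cf_coprime.
- by have := convergent_approx j; rewrite -!qE -!pmulrn.
- have := cf_den_ge1 j; have := cf_den_nd j; rewrite -!qE; lia.
- by have := cf_den_double j; rewrite -!qE; lia.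
Qed.

End convergents.

(** * Points with slowly recurrent orbits *)

Lemma sum_inv_sqr_le (R : realFieldType) n :
  \sum_(j < n) (j.+1%:R ^+ 2)^-1 <= 2 :> R.
Proof.
suff : \sum_(j < n) (j.+1%:R ^+ 2)^-1 <= 2 - 2 * n.+1%:R^-1 :> R.
  by move=> /le_trans; apply; rewrite gerBl mulr_ge0// invr_ge0.
elim: n => [|n IH]; first by rewrite big_ord0 invr1; lra.
rewrite big_ord_recr/=; apply: (le_trans (lerD IH (lexx _))).
rewrite -[n.+2%:R]natr1; set x : R := n.+1%:R.
have x1 : 1 <= x by rewrite ler1n.
have : (x ^+ 2)^-1 <= (x * (x + 1) / 2)^-1.
  by rewrite lef_pV2 ?posrE ?exprn_gt0 ?expr2//; nra.
have -> : (x * (x + 1) / 2)^-1 = 2 * (x^-1 - (x + 1)^-1) by field; lra.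
by move: (x^-1) ((x + 1)^-1) ((x ^+ 2)^-1) => y1 y2 y3; lra.
Qed.

Section good_set.
Variables (R : realType) (alpha : R).
Local Notation mu := (lebesgue01 R).

(* The points whose orbit under the rotation by [alpha] approaches [0] only
   slowly, in both time directions. *)
Definition good_set : set R := [set s | forall j : nat,
  16^-1 / j.+1%:R ^+ 2 <= dist_int (s + j%:R * alpha) /\
  16^-1 / j.+1%:R ^+ 2 <= dist_int (s - j%:R * alpha)].

Lemma measurable_dist_int : measurable_fun [set: R] (@dist_int R).
Proof.
have -> : @dist_int R = (@fracpart R) \min (fun x => 1 - fracpart x).
  by apply/funext => x /=.
apply: measurable_minr; first exact: measurable_fracpart.
by apply: measurable_funB => //; exact: measurable_fracpart.
Qed.

Let slow (e a : R) : set R := [set s | e <= dist_int (s + a)].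

Let measurable_slow e a : measurable (slow e a).
Proof.
have mf : measurable_fun [set: R] (fun s => dist_int (s + a)).
  by apply: (measurableT_comp measurable_dist_int); exact: measurable_funD.
have -> : slow e a = setT `&` (fun s => dist_int (s + a)) @^-1` `[e, +oo[.
  by apply/seteqP; split => s /=; rewrite in_itv/= andbT; [|case].
exact: mf.
Qed.

Let good_setE : good_set = \bigcap_j
  (slow (16^-1 / j.+1%:R ^+ 2) (j%:R * alpha) `&`
   slow (16^-1 / j.+1%:R ^+ 2) (- (j%:R * alpha))).
Proof.
apply/seteqP; split => s; first by move=> gs j _; exact: gs.
by move=> h j; exact: h.
Qed.

Lemma measurable_good_set : measurable good_set.
Proof.
rewrite good_setE; apply: bigcapT_measurable => j.
by apply: measurableI; exact: measurable_slow.
Qed.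

Lemma good_setDz s (k : int) : good_set (s + k%:~R) <-> good_set s.
Proof.
have E (a : R) : dist_int (s + k%:~R + a) = dist_int (s + a).
  by rewrite addrAC dist_intDz.
by split => gs j; have := gs j; rewrite !E.
Qed.

(** Rotation invariance reduces to a = 0, where the set lies in the two end intervals of length
    e. *)
Let slowC_measure e a : 0 < e -> (mu (~` slow e a) <= (2 * e)%:E)%E.
Proof.
move=> e0.
have -> : ~` slow e a = rotation a @^-1` (~` slow e 0).
  apply/seteqP; split => s /=; rewrite /slow/= /rotation addr0 => h h2; apply: h.
    by move: h2; rewrite /fracpart -intrN dist_intDz.
  by rewrite /fracpart -intrN dist_intDz.
rewrite lebesgue01_rotation; last exact: measurableC (@measurable_slow _ _).
rewrite /= /lebesgue01/= /mrestr.
apply: (@le_trans _ _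
    (lebesgue_measure (`[0, e]%classic `|` `[1 - e, 1]%classic : set R))).
  apply: le_measure; rewrite ?inE.
  - apply: measurableI; last exact: measurable_itv.
    exact: measurableC (@measurable_slow _ _).
  - by apply: measurableU; exact: measurable_itv.
  - move=> s [/= h]; rewrite in_itv/= => /andP[s0 s1].
    move/negP : h; rewrite /slow/= addr0 -ltNge /dist_int.
    have -> : fracpart s = s by apply: (@fracpart_unique R 0); rewrite ?add0r// s0 s1.
    rewrite gt_min => /orP[h|h]; [left|right]; rewrite /= in_itv/=; lra.
have mU (A B : set R) : measurable A -> measurable B ->
    (lebesgue_measure (A `|` B) <= lebesgue_measure A + lebesgue_measure B)%E.
  by move=> mA mB; exact: measureU2.
apply: (le_trans (mU _ _ _ _)); [exact: measurable_itv|exact: measurable_itv|].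
rewrite !lebesgue_measure_itv/= !lte_fin e0.
have -> : 1 - e < 1 by lra.
by rewrite -!EFinD lee_fin; lra.
Qed.

(** Time j excludes measure at most 4 e_j, two per direction, with e_j = 1/(16 (j+1)^2). As the sum
    of 1/(j+1)^2 is at most 2, the excluded measure is at most 1/2; this fixes the constant 1/16. *)
Lemma good_set_measure : (0 < mu good_set)%E.
Proof.
have mT : mu setT = 1%E.
  rewrite /= /lebesgue01/= /mrestr setTI lebesgue_measure_itv/= lte_fin ltr01.
  by rewrite -EFinD subr0.
have mC : (mu (~` good_set) <= (1/2)%:E)%E.
  pose F j := ~` slow (16^-1 / j.+1%:R ^+ 2) (j%:R * alpha) `|`
    ~` slow (16^-1 / j.+1%:R ^+ 2) (- (j%:R * alpha)).
  have mF j : measurable (F j).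
    by apply: measurableU; exact: measurableC (@measurable_slow _ _).
  have sub : ~` good_set `<=` \bigcup_n F n.
    by rewrite good_setE setC_bigcap => s [j _ h]; exists j => //; rewrite /F -setCI.
  have mgC := measurableC measurable_good_set.
  apply: (le_trans (measure_sigma_subadditive mu mF mgC sub)).
  apply: lime_le; first by apply: is_cvg_nneseries => *; exact: measure_ge0.
  apply: nearW => n.
  have H j : (mu (F j) <= (4^-1 * (j.+1%:R ^+ 2)^-1)%:E)%E.
    apply: (le_trans (measureU2 _ _ _)); try exact: measurableC (@measurable_slow _ _).
    have e0 : 0 < 16^-1 / j.+1%:R ^+ 2 :> R by rewrite divr_gt0// exprn_gt0.
    apply: (le_trans (leeD (slowC_measure _ e0) (slowC_measure _ e0))).
    rewrite -EFinD lee_fin; set y := (j.+1%:R ^+ 2)^-1.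
    by rewrite [leLHS](_ : _ = 4^-1 * y)//; field.
  apply: (@le_trans _ _ (\sum_(0 <= j < n) (4^-1 * (j.+1%:R ^+ 2)^-1)%:E)).
    by apply: lee_sum.
  rewrite sumEFin lee_fin -mulr_sumr.
  rewrite big_mkord; have := sum_inv_sqr_le R n.
  by move=> h; rewrite ler_pdivrMl// (le_trans h)// mul1r ler_pdivlMr// -natrM ler_nat.
have E : (mu (good_set `|` ~` good_set) = mu good_set + mu (~` good_set))%E.
  apply: measureU; [exact: measurable_good_set| |exact: setICr].
  exact: measurableC measurable_good_set.
have : (1 <= mu good_set + mu (~` good_set))%E by rewrite -E setUv -mT.
move=> h; rewrite lt0e measure_ge0 andbT; apply/negP => /eqP e.
rewrite e add0e in h; have := le_trans h mC; rewrite lee_fin; lra.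
Qed.

End good_set.

(** * Two-sided Birkhoff sums of 1 + ln *)

Section log_cocycle.
Variables (R : realType) (alpha : R).

(** The negative branch, where [Negz n] is -(n+1), is the extension for which the one-step
    recurrence holds on all of Z. *)
Definition log_cocycle (k : int) (s : R) : R :=
  match k with
  | Posz n => \sum_(i < n) (1 + ln (fracpart (s + i%:R * alpha)))
  | Negz n => - \sum_(i < n.+1) (1 + ln (fracpart (s - i.+1%:R * alpha)))
  end.

Lemma log_cocycle0 s : log_cocycle 0 s = 0.
Proof. exact: big_ord0. Qed.

Lemma log_cocycleS k s : log_cocycle (k + 1) s =
  log_cocycle k s + (1 + ln (fracpart (s + k%:~R * alpha))).
Proof.
case: k => [n|[|n]].
- by rewrite -PoszD addn1 /= big_ord_recr/= -pmulrn.
- have -> : Negz 0 + 1 = 0 by [].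
  rewrite log_cocycle0 /= big_ord1 NegzE intrN mulNr -pmulrn.
  by rewrite addrC subrr.
- have -> : Negz n.+1 + 1 = Negz n by rewrite !NegzE; lia.
  rewrite /= [in RHS]big_ord_recr/= NegzE intrN mulNr -pmulrn.
  by rewrite opprD addrNK.
Qed.

Lemma log_cocycleDz k s (z : int) : log_cocycle k (s + z%:~R) = log_cocycle k s.
Proof.
have E (a : R) : fracpart (s + z%:~R + a) = fracpart (s + a).
  by rewrite addrAC fracpartDz.
by case: k => n /=; [|congr (- _)]; apply: eq_bigr => i _; rewrite E.
Qed.

Lemma measurable_log_cocycle k : measurable_fun [set: R] (log_cocycle k).
Proof.
have H (a : R) : measurable_fun [set: R] (fun s => 1 + ln (fracpart (s + a))).
  apply: measurable_funD => //; apply: (measurableT_comp (@measurable_ln R)).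
  apply: (measurableT_comp (@measurable_fracpart R)).
  exact: measurable_funD.
case: k => n /=.
  by apply: measurable_sum => i; exact: H.
apply: measurable_funN.
by apply: measurable_sum => i; exact: H.
Qed.

Lemma orbit_weight_le (q : nat -> nat) (m0 : nat) (C1 C2 : R) n :
  (forall i, (m0 <= i)%N -> (0 < q i)%N) ->
  0 <= C1 <= C2 -> orbit_weight q m0 C1 n <= orbit_weight q m0 C2 n.
Proof.
move=> q0 /andP[_ C12]; rewrite /orbit_weight lerD// ler_wpM2r//.
rewrite big_seq_cond sumr_ge0// => i.
rewrite mem_index_iota andbT => /andP[mi _]; rewrite mulr_ge0// divr_ge0//.
by rewrite addr_ge0// ln_ge0// ler1n q0.
Qed.

(** The backward sum is, up to sign, the forward sum for -alpha started at s - alpha, and -alpha is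
    approximated by -p/q with the same denominators. The weight with constant C1 + C2 thus serves
    both directions. *)
Lemma log_cocycle_growth : 0 < alpha < 1 -> irrational alpha ->
  (exists C : R, \forall j \near \oo,
    ln (convergent_den alpha j.+1) <=
    C * (convergent_den alpha j / ln (convergent_den alpha j) ^+ 3)) ->
  exists (w : nat -> R) (B : R), [/\ forall n, 0 <= w n,
    forall m n, (m <= n)%N -> w m <= w n,
    forall J, \sum_(j < J) w (2 ^ j)%N / 2 ^+ j <= B &
    forall s, good_set alpha s -> forall k : int,
      `|log_cocycle k s| <= w `|k|%N].
Proof.
move=> alpha01 alpha_irr [C [N _ HN]].
have [q [p [qE cop app q_nd q2]]] := convergent_data alpha01 alpha_irr.
(* Past N the growth condition holds; the 4 ensures q_m0 >= 4, as denominators double every two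
   steps from q_0 >= 1. *)
pose m0 := (N + 4)%N.
have qle i j : (i <= j)%N -> (q i <= q j)%N.
  move=> ij; rewrite -(subnKC ij); elim: (j - i)%N => [|k IH]; first by rewrite addn0.
  by rewrite addnS (leq_trans IH)//; case/andP: (q_nd (i + k)%N).
have q4 : (4 <= q m0)%N.
  have := q2 0%N; have := q2 2%N; have := qle 4%N m0 (leq_addl _ _).
  have /andP[] := q_nd 0%N; lia.
have nd i : (m0 <= i)%N -> (q i <= q i.+1)%N by case/andP: (q_nd i).
have db i : (m0 <= i)%N -> ((q i).*2 <= q i.+2)%N by [].
have K i : (m0 <= i)%N ->
    ln (q i.+1)%:R <= `|C| * ((q i)%:R / ln (q i)%:R ^+ 3) :> R.
  move=> mi; have := HN i (leq_trans (leq_addr _ _) mi).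
  rewrite /= !qE => /le_trans; apply; rewrite ler_wpM2r ?ler_norm//.
  by rewrite divr_ge0// exprn_ge0// ln_ge0// ler1n (leq_trans _ (q_ge q4 nd mi)).
(* Starting the backward orbit at s - alpha shifts the index by one, and (j+2)^2 <= 4 (j+1)^2: hence
   64 = 16 * 4. *)
have d01 : 0 < (64^-1 : R) <= 1.
  by rewrite invr_gt0 ltr0n/= invf_le1// ler1n.
have app' i : `|- alpha - (- p i)%:~R / (q i)%:R| <= ((q i)%:R * (q i.+1)%:R)^-1.
  by rewrite intrN mulNr opprK addrC distrC.
have cop' i : coprimez (q i) (- p i) by rewrite coprimezN.
have [C1 C10 H1] := orbit_weight_bound q4 nd db
  (fun i _ => cop i) (fun i _ => app i) d01.
have [C2 C20 H2] := orbit_weight_bound q4 nd db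
  (fun i _ => cop' i) (fun i _ => app' i) d01.
have [B HB] := orbit_weight_summable q4 nd db (addr_ge0 C10 C20) (normr_ge0 C) K.
exists (orbit_weight q m0 (C1 + C2)), B; split => //.
- by move=> n; apply: orbit_weight_ge0 => //; exact: addr_ge0.
- by move=> m n mn; apply: orbit_weight_nd => //; exact: addr_ge0.
have q0 i : (m0 <= i)%N -> (0 < q i)%N by case/andP: (q_nd i).
move=> s gs [n|n] /=.
  apply: le_trans (H1 _ _ _) _ => [j|].
    apply: le_trans (gs j).1; rewrite ler_wpM2r ?invr_ge0 ?exprn_ge0//.
    by rewrite lef_pV2 ?posrE// ler_nat.
  by apply: orbit_weight_le => //; rewrite C10 lerDl.
have E : - \sum_(i < n.+1) (1 + ln (fracpart (s - i.+1%:R * alpha))) =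
    - \sum_(i < n.+1) (1 + ln (fracpart ((s - alpha) + i%:R * (- alpha)))).
  congr (- _); apply: eq_bigr => i _; congr (1 + ln (fracpart _)).
  by rewrite -natr1; ring.
rewrite E normrN.
apply: le_trans (H2 _ _ _) _ => [j|].
  have -> : s - alpha + j%:R * - alpha = s - j.+1%:R * alpha by rewrite -natr1; ring.
  apply: le_trans (gs j.+1).2.
  have -> : 64^-1 = 16^-1 * 4^-1 :> R by rewrite -invfM -natrM.
  rewrite -mulrA ler_wpM2l ?invr_ge0// -invfM lef_pV2 ?posrE ?mulr_gt0 ?exprn_gt0//.
  rewrite -[4]/(2 * 2)%:R natrM -expr2 -exprMn lerXn2r ?nnegrE ?mulr_ge0//.
  by rewrite -natrM ler_nat; lia.
by apply: orbit_weight_le => //; rewrite C20 lerDr.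
Qed.

End log_cocycle.

(** * Bounded functions and duality on the space of the operator *)

Section lebesgue01_norms.
Variables (R : realType) (p : \bar R).
Hypothesis p1 : (1 <= p)%E.
Local Notation mu := (lebesgue01 R).
Implicit Types f : measurableTypeR R -> R.

Lemma lebesgue01_setT : mu setT = 1%E.
Proof.
rewrite /= /lebesgue01/= /mrestr setTI lebesgue_measure_itv/= lte_fin ltr01.
by rewrite -EFinD subr0.
Qed.

Lemma Lnorm_le_cst f (C : R) : measurable_fun setT f ->
  (forall t, `|f t| <= C) -> ('N[mu]_p[EFin \o f] <= C%:E)%E.
Proof.
move=> mf fC; have C0 : 0 <= C := le_trans (normr_ge0 _) (fC 0).
apply: (@le_trans _ _ ('N[mu]_p[EFin \o cst C])%E).
  apply: le_Lnorm => //; apply: aeW => t.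
  by rewrite [leRHS]ger0_norm.
rewrite unlock; case: p p1 => [r r1|_|//].
- have r0 : 0 < r by rewrite lee_fin in r1; exact: lt_le_trans r1.
  have -> : (fun x : measurableTypeR R => `|(EFin \o cst C) x| `^ r)%E =
      cst ((C `^ r)%:E).
    by apply/funext => t /=; rewrite ger0_norm.
  rewrite integral_cst//= lebesgue01_setT mule1 /= -powRrM mulfV ?gt_eqF//.
  by rewrite powRr1.
- rewrite ifT; last by rewrite lebesgue01_setT lte01.
  rewrite (_ : abse \o _ = cst C%:E); last first.
    by apply/funext => t /=; rewrite ger0_norm.
  by rewrite ess_sup_cst ?lebesgue01_setT ?lte01.
Qed.

(** The measure has mass one: for finite p > 1 this is Hoelder's inequality against the constant
    1. *)
Lemma Lnorm1_le f : measurable_fun setT f ->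
  ('N[mu]_1[EFin \o f] <= 'N[mu]_p[EFin \o f])%E.
Proof.
move=> mf; case: p p1 => [r|_|//].
- rewrite lee_fin le_eqVlt => /predU1P[<-//|r1].
  have r0 : 0 < r by lra.
  pose q := r / (r - 1).
  have q0 : 0 < q by rewrite divr_gt0//; lra.
  have E : r^-1 + q^-1 = 1 by rewrite /q; field; apply/andP; split; lra.
  have m1 : measurable_fun setT (cst 1 : measurableTypeR R -> R) by [].
  have := hoelder mu mf m1 r0 q0 E.
  have -> : EFin \o (f \* cst 1)%R = EFin \o f.
    by apply/funext => t /=; rewrite mulr1.
  have -> : EFin \o (cst 1 : measurableTypeR R -> R) = cst 1%E by [].
  by rewrite Lnorm_cst1 lebesgue01_setT poweR1r mule1.
- rewrite Lnorm1 unlock ifT; last by rewrite lebesgue01_setT lte01.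
  have S0 : (0 <= ess_sup mu (abse \o (EFin \o f)))%E.
    apply: ess_sup_gee; first by rewrite lebesgue01_setT lte01.
    by apply: aeW => t /=.
  apply: (@le_trans _ _ (\int[mu]_x (cst (ess_sup mu (abse \o (EFin \o f)))) x)%E).
    apply: ae_ge0_le_integral => //.
    - by apply: measurableT_comp => //; exact/measurable_EFinP.
    - by have := ess_sup_ge mu (abse \o (EFin \o f)); apply: filterS => t h _.
  by rewrite integral_cst//= lebesgue01_setT mule1.
Qed.

End lebesgue01_norms.

Section complex_facts.
Variable R : realType.
Implicit Types z : R[i].

Lemma normc_Re z : `|complex.Re z| <= normc z.
Proof.
case: z => a b /=; rewrite -sqrtr_sqr ler_sqrt ?lerDl ?sqr_ge0//.
by rewrite addr_ge0 ?sqr_ge0.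
Qed.

Lemma normc_real (r : R) : normc r%:C = `|r|.
Proof. by rewrite /= expr0n addr0 sqrtr_sqr. Qed.

Definition cis (x : R) : R[i] := cos x +i* sin x.

Lemma normc_cis x : normc (cis x) = 1.
Proof. by rewrite /= cos2Dsin2 sqrtr1. Qed.

Lemma cisD x y : cis (x + y) = cis x * cis y.
Proof. by rewrite /cis cosD sinD; congr (_ +i* _); ring. Qed.

Lemma cis_period x (k : int) : cis (x + pi *+ 2 * k%:~R) = cis x.
Proof.
have H (n : nat) y : cis (y + pi *+ 2 * n%:R) = cis y.
  by rewrite mulr_natr /cis (periodicn (@cosD2pi R)) (periodicn (@sinD2pi R)).
case: k => n; first by rewrite -pmulrn H.
by rewrite NegzE intrN -pmulrn -(H n.+1) mulrN subrK.
Qed.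

End complex_facts.

Section bounded_functions.
Variable R : realType.
Local Notation mu := (lebesgue01 R).
Local Notation T := (measurableTypeR R).
Implicit Types f g : T -> R[i].

(** Such functions belong to every L^p and also act on it by integration, so one class provides
    vectors and functionals for all p. *)
Definition bounded_measurable f :=
  cmeasurable f /\ exists C : R, forall t, normc (f t) <= C.

Lemma bounded_measurableD f g :
  bounded_measurable f -> bounded_measurable g -> bounded_measurable (f \+ g).
Proof.
move=> [mf [C fC]] [mg [D gD]]; split; first exact: cmeasurableD.
by exists (C + D) => t; rewrite (le_trans (le_normcD _ _))// lerD.
Qed.

Lemma bounded_measurableM f g :
  bounded_measurable f -> bounded_measurable g ->
  bounded_measurable (fun t => f t * g t).
Proof.
move=> [mf [C fC]] [mg [D gD]]; split; first exact: cmeasurableM.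
exists (C * D) => t; rewrite normcM ler_pM ?normc_ge0//.
Qed.

Lemma bounded_measurable_cst (c : R[i]) : bounded_measurable (cst c).
Proof. by split; [exact: cmeasurable_cst|exists (normc c)]. Qed.

Lemma bounded_measurable_real (f : T -> R) (C : R) : measurable_fun setT f ->
  (forall t, `|f t| <= C) -> bounded_measurable (fun t => (f t)%:C).
Proof.
move=> mf fC; split; first by split => //=; exact: measurable_cst.
by exists C => t; rewrite normc_real.
Qed.

Lemma bounded_measurable_cis (a b : R) :
  bounded_measurable (fun t : T => cis (a * t + b)).
Proof.
have m : measurable_fun setT (fun t : T => a * t + b).
  by apply: measurable_funD => //; exact: measurable_funM.
split; last by exists 1 => t; rewrite normc_cis.
split => /=.
  by apply: measurableT_comp m; apply: continuous_measurable_fun; exact: continuous_cos.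
by apply: measurableT_comp m; apply: continuous_measurable_fun; exact: continuous_sin.
Qed.

Variables (p : \bar R) (p1 : (1 <= p)%E).
Local Notation V := (cLspace mu p1).

(** A total map: a function outside L^p is sent to the default 0, which spares carrying membership
    proofs. *)
Definition class_of f : V := toL (insubd (0 : cLfunType mu p1) f).

Lemma bounded_measurable_cLfun f : bounded_measurable f -> f \in cLfun mu p.
Proof.
move=> [mf [C fC]]; apply/cLfunP; split => //.
apply: (@le_lt_trans _ _ C%:E); last exact: ltry.
apply: Lnorm_le_cst => //; first exact: measurable_normc.
by move=> t; rewrite ger0_norm ?normc_ge0.
Qed.

Lemma class_ofE f (fp : f \in cLfun mu p) : class_of f = toL (CLfun p1 fp).
Proof. by congr toL; apply: val_inj; rewrite insubdK. Qed.

Lemma class_ofD f g : bounded_measurable f -> bounded_measurable g ->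
  class_of f + class_of g = class_of (f \+ g).
Proof.
move=> bf bg; rewrite (class_ofE (bounded_measurable_cLfun bf)).
rewrite (class_ofE (bounded_measurable_cLfun bg)).
rewrite (class_ofE (bounded_measurable_cLfun (bounded_measurableD bf bg))) toLD.
by congr toL; apply: val_inj.
Qed.

Lemma class_ofZ (c : R[i]) f : bounded_measurable f ->
  c *: class_of f = class_of (fun t => c * f t).
Proof.
move=> bf; rewrite (class_ofE (bounded_measurable_cLfun bf)).
have bcf := bounded_measurableM (bounded_measurable_cst c) bf.
rewrite (class_ofE (bounded_measurable_cLfun bcf)) toLZ.
by congr toL; apply: val_inj.
Qed.

Lemma class_of_symsum (f : int -> T -> R[i]) N :
  (forall n, bounded_measurable (f n)) ->
  bounded_measurable (fun t => symsum (f ^~ t) N) /\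
  symsum (fun n => class_of (f n)) N = class_of (fun t => symsum (f ^~ t) N).
Proof.
move=> bf; elim: N => [|N [IH1 IH2]].
  rewrite symsum0 (_ : (fun t => _) = f 0)//.
  by apply/funext => t; rewrite symsum0.
rewrite symsumS IH2 class_ofD// class_ofD//; last exact: bounded_measurableD.
have -> : (fun t => symsum (f ^~ t) N.+1) =
    (fun t => symsum (f ^~ t) N) \+ (f N.+1%:Z \+ f (- N.+1%:Z)).
  by apply/funext => t; rewrite symsumS.
split => //; apply: bounded_measurableD => //; exact: bounded_measurableD.
Qed.

(** The norm of [V] takes values in [R[i]]; this is the same norm as a real number. *)
Definition rnorm (u : V) : R := cLfun_norm (repr u).

Lemma rnormE (u : V) : `|u| = (rnorm u)%:C.
Proof. by []. Qed.

Lemma rnorm_toL (f : cLfunType mu p1) : rnorm (toL f) = cLfun_norm f.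
Proof. by have := norm_toL f; rewrite rnormE => -[]. Qed.

Lemma rnorm_ge0 (u : V) : 0 <= rnorm u.
Proof. by have := normr_ge0 u; rewrite rnormE lecR. Qed.

Lemma rnorm_class_of_le f (C : R) : bounded_measurable f ->
  (forall t, normc (f t) <= C) -> rnorm (class_of f) <= C.
Proof.
move=> bf fC; rewrite (class_ofE (bounded_measurable_cLfun bf)) rnorm_toL.
rewrite -lee_fin cLfun_normE; apply: Lnorm_le_cst => //.
  by apply: measurable_normc; case: bf.
by move=> t; rewrite ger0_norm ?normc_ge0.
Qed.

End bounded_functions.

(** * The pairing of L^p with bounded functions *)

Section pairing.
Variables (R : realType) (p : \bar R) (p1 : (1 <= p)%E).
Local Notation mu := (lebesgue01 R).
Local Notation T := (measurableTypeR R).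
Local Notation V := (cLspace mu p1).
Implicit Types (f g : T -> R[i]) (u v : V) (y : T -> R[i]).

(** There is no conjugation, as transposes rather than adjoints are used. The real part suffices
    because a condition imposed for all commuting operators S is also imposed for their complex
    multiples. *)
Definition pairing y u : R := Rintegral mu setT (fun t => complex.Re (repr u t * y t)).

Lemma cLfun_measurable (h : cLfunType mu p1) : cmeasurable h.
Proof. by have /cLfunP[] := cLfun_funP h. Qed.

Lemma measurable_ReM f g : cmeasurable f -> cmeasurable g ->
  measurable_fun setT (fun t => complex.Re (f t * g t)).
Proof. by move=> mf mg; case: (cmeasurableM mf mg). Qed.

Lemma integral_pairing_le (h : cLfunType mu p1) y (C : R) : cmeasurable y ->
  (forall t, normc (y t) <= C) ->
  (\int[mu]_t `|(complex.Re (h t * y t))%:E| <=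
   C%:E * 'N[mu]_p[EFin \o (fun t => normc (h t))])%E.
Proof.
move=> my yC; have mh := cLfun_measurable h.
have mn := measurable_normc mh.
have C0 : 0 <= C := le_trans (normc_ge0 _) (yC 0).
apply: (@le_trans _ _ (\int[mu]_x (C%:E * (normc (h x))%:E))%E).
  apply: ge0_le_integral => //.
  - by apply: measurableT_comp => //; apply/measurable_EFinP; exact: measurable_ReM.
  - by apply: measurable_funeM; exact/measurable_EFinP.
  - move=> t _ /=; rewrite lee_fin (le_trans (normc_Re _))// normcM mulrC.
    by rewrite ler_pM ?normc_ge0.
rewrite ge0_integralZl//; [|exact/measurable_EFinP|]; last first.
  by move=> t _; rewrite lee_fin normc_ge0.
rewrite lee_wpmul2l ?lee_fin//.
apply: le_trans (Lnorm1_le p1 mn); rewrite Lnorm1.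
apply: ge0_le_integral => //.
- by move=> t _; rewrite lee_fin normc_ge0.
- exact/measurable_EFinP.
- by apply: measurableT_comp => //; exact/measurable_EFinP.
- by move=> t _ /=; rewrite lee_fin ler_norm.
Qed.

Lemma integrable_pairing (h : cLfunType mu p1) y : bounded_measurable y ->
  mu.-integrable setT (EFin \o (fun t => complex.Re (h t * y t))).
Proof.
move=> [my [C yC]]; have mh := cLfun_measurable h.
apply/integrableP; split.
  by apply/measurable_EFinP; exact: measurable_ReM.
apply: le_lt_trans (integral_pairing_le h my yC) _.
have /cLfunP[_ nh] := cLfun_funP h.
by rewrite lte_mul_pinfty ?lee_fin// (le_trans (normc_ge0 _) (yC 0)).
Qed.

Lemma pairing_toL y (h : cLfunType mu p1) : bounded_measurable y ->
  pairing y (toL h) = Rintegral mu setT (fun t => complex.Re (h t * y t)).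
Proof.
move=> [my _]; rewrite /pairing /Rintegral; congr fine.
apply: ae_eq_integral => //.
- by apply/measurable_EFinP; apply: measurable_ReM => //; exact: cLfun_measurable.
- by apply/measurable_EFinP; apply: measurable_ReM => //; exact: cLfun_measurable.
- by apply: filterS (repr_toL h) => t H tT; rewrite H.
Qed.

Lemma pairing_class_of y f : bounded_measurable y -> bounded_measurable f ->
  pairing y (class_of p1 f) = Rintegral mu setT (fun t => complex.Re (f t * y t)).
Proof.
move=> by_ bf; rewrite (class_ofE _ (bounded_measurable_cLfun p1 bf)).
by rewrite pairing_toL.
Qed.

Lemma pairingD y u v : bounded_measurable y ->
  pairing y (u + v) = pairing y u + pairing y v.
Proof.
move=> by_; rewrite -(reprLK u) -(reprLK v) toLD !pairing_toL//.
rewrite -RintegralD//; try exact: integrable_pairing.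
by apply: eq_Rintegral => t _ /=; rewrite mulrDl raddfD.
Qed.

Lemma pairingZ y (a : R) u : bounded_measurable y ->
  pairing y (a%:C *: u) = a * pairing y u.
Proof.
move=> by_; rewrite -(reprLK u) toLZ !pairing_toL//.
rewrite -RintegralZl//; last exact: integrable_pairing.
apply: eq_Rintegral => t _ /=.
rewrite -[X in complex.Re (X * _)]/(a%:C * repr u t) -mulrA.
by case: (_ * y t) => ? ? /=; rewrite mul0r subr0.
Qed.

Lemma pairing0 y : bounded_measurable y -> pairing y 0 = 0.
Proof. by move=> by_; have := pairingZ 0 0 by_; rewrite scaler0 mul0r. Qed.

Lemma pairingB y u v : bounded_measurable y ->
  pairing y (u - v) = pairing y u - pairing y v.
Proof.
move=> by_; rewrite pairingD// -scaleN1r.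
have -> : (-1 : R[i]) = (-1)%:C by rewrite rmorphN.
by rewrite pairingZ// mulN1r.
Qed.

Lemma pairing_symsum y (f : int -> V) N : bounded_measurable y ->
  pairing y (symsum f N) = symsum (fun n => pairing y (f n)) N.
Proof.
move=> by_; elim: N => [|N IH]; first by rewrite !symsum0.
by rewrite symsumS [RHS]symsumS -IH pairingD//; congr (_ + _); exact: pairingD.
Qed.

Lemma pairing_le y u (C : R) : bounded_measurable y ->
  (forall t, normc (y t) <= C) -> `|pairing y u| <= C * rnorm u.
Proof.
move=> by_ yC; have my := by_.1.
have I := integrable_pairing (repr u) by_.
rewrite -lee_fin /pairing EFin_normr_Rintegral// EFinM cLfun_normE.
apply: (le_trans (le_abse_integral mu measurableT (measurable_int _ I))).
exact: integral_pairing_le.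
Qed.

Lemma pairing_combination y y1 y2 (a b : R) u : bounded_measurable y1 ->
  bounded_measurable y2 -> y = (fun t => a%:C * y1 t + b%:C * y2 t) ->
  pairing y u = a * pairing y1 u + b * pairing y2 u.
Proof.
move=> b1 b2 ->; rewrite /pairing.
have I1 := integrable_pairing (repr u) b1; have I2 := integrable_pairing (repr u) b2.
rewrite -!RintegralZl// -RintegralD//; last 2 first.
- by have := integrableZl measurableT a I1; apply: eq_integrable.
- by have := integrableZl measurableT b I2; apply: eq_integrable.
apply: eq_Rintegral => t _; case: (repr u t) (y1 t) (y2 t) => [? ?] [? ?] [? ?] /=.
ring.
Qed.

Lemma pairing_symsumr (c : int -> R) (y : int -> T -> R[i]) u N :
  (forall n, bounded_measurable (y n)) ->
  bounded_measurable (fun t => symsum (fun n => (c n)%:C * y n t) N) /\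
  pairing (fun t => symsum (fun n => (c n)%:C * y n t) N) u =
  symsum (fun n => c n * pairing (y n) u) N.
Proof.
move=> by_.
have bcy n : bounded_measurable (fun t => (c n)%:C * y n t).
  exact: bounded_measurableM (bounded_measurable_cst _) (by_ n).
have P n : pairing (fun t => (c n)%:C * y n t) u = c n * pairing (y n) u.
  rewrite (pairing_combination (y1 := y n) (y2 := y n) (a := c n) (b := 0))//.
    by rewrite mul0r addr0.
  by apply/funext => t; rewrite mul0r addr0.
elim: N => [|N [IH1 IH2]].
  rewrite symsum0 -P.
  have -> : (fun t => symsum (fun n => (c n)%:C * y n t) 0) = fun t => (c 0)%:C * y 0 t.
    by apply/funext => t; rewrite symsum0.
  by split.
have E : (fun t => symsum (fun n => (c n)%:C * y n t) N.+1) =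
   (fun t => 1%:C * symsum (fun n => (c n)%:C * y n t) N +
      1%:C * ((fun t => (c N.+1%:Z)%:C * y N.+1%:Z t) \+
              (fun t => (c (- N.+1%:Z))%:C * y (- N.+1%:Z) t)) t).
  by apply/funext => t; rewrite symsumS !mul1r.
have b2 := bounded_measurableD (bcy N.+1%:Z) (bcy (- N.+1%:Z)).
split.
  rewrite E; apply: bounded_measurableD.
    exact: bounded_measurableM (bounded_measurable_cst _) IH1.
  exact: bounded_measurableM (bounded_measurable_cst _) b2.
rewrite (pairing_combination _ IH1 b2 E) IH2 symsumS !mul1r; congr (_ + _).
rewrite (@pairing_combination _ _ _ 1 1 u (bcy N.+1%:Z) (bcy (- N.+1%:Z))).
  by rewrite !mul1r !P.
by apply/funext => t; rewrite !mul1r.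
Qed.

(** The change of variables by the measure-preserving rotation; the last hypothesis says that y' is
    the transpose of e T applied to y. *)
Lemma pairing_bishop alpha (y y' : T -> R[i]) u : bounded_measurable y ->
  bounded_measurable y' ->
  (forall t, 0 <= t < 1 -> y' (rotation alpha t) = (expR 1 * t)%:C * y t) ->
  pairing y' u = expR 1 * pairing y (bishop p1 alpha u).
Proof.
move=> b b' yy'; rewrite -[u in RHS]reprLK bishopE pairing_toL//.
rewrite -RintegralZl//; last exact: integrable_pairing.
have I := integrable_pairing (repr u) b'.
rewrite /pairing /Rintegral; congr fine.
have mr : measurable_fun [set: T] (rotation alpha : T -> T).
  exact: measurable_rotation.
pose mrot : {mfun T >-> T} :=
  HB.pack (rotation alpha : T -> T) (isMeasurableFun.Build _ _ _ _ _ mr).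
set G := fun t : T => (complex.Re (repr u t * y' t))%:E.
have mG : measurable_fun setT G := measurable_int _ I.
transitivity (\int[pushforward mu mrot]_x G x)%E.
  by apply: eq_measure_integral => A mA _; apply/esym; exact: lebesgue01_rotation.
have E t : 0 <= t < 1 -> G (rotation alpha t) =
    (expR 1 * complex.Re (bishop_fun alpha (repr u) t * y t))%:E.
  move=> t01; rewrite /G yy'//= /bishop_map /rotation; congr (_%:E).
  by case: (repr u _) (y t) => [? ?] [? ?] /=; ring.
rewrite integral_pushforward//; last first.
  rewrite preimage_setT; apply/integrableP; split; first exact: measurableT_comp.
  have /integrableP[_] := I; apply: le_lt_trans.
  rewrite [leRHS](_ : _ = \int[pushforward mu mrot]_x `|G x|)%E; last first.
    by apply: eq_measure_integral => A mA _; apply/esym; exact: lebesgue01_rotation.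
  rewrite ge0_integral_pushforward//; last by apply: measurableT_comp.
rewrite preimage_setT.
apply: ae_eq_integral => //.
- exact: measurableT_comp.
- apply/measurable_EFinP; apply: measurable_funM => //.
  by apply: measurable_ReM; [exact: cLfun_measurable|case: b].
- by apply: ae_lebesgue01 => t t01 _; exact: E.
Qed.

End pairing.

Section nonnegative_symmetric_series.
Variable R : realType.
Implicit Types f : int -> R.

Lemma symsum_nd f : (forall n, 0 <= f n) ->
  {homo symsum f : M N / (M <= N)%N >-> M <= N}.
Proof.
move=> f0 M N MN; rewrite -(subnKC MN); elim: (N - M)%N => [|k IH].
  by rewrite addn0.
by rewrite addnS symsumS (le_trans IH)// lerDl addr_ge0.
Qed.

Lemma symsum_shift1_le f N : (forall n, 0 <= f n) ->
  symsum (fun n => f (n + 1)) N <= symsum f N.+1.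
Proof.
move=> f0; rewrite symsum_shift1 symsumS -addrA lerD2l.
by rewrite lerD// (@le_trans _ _ 0) ?oppr_le0.
Qed.

Lemma symsum_shift1_ge f N : (forall n, 0 <= f n) ->
  symsum f N <= symsum (fun n => f (n + 1)) N.+1.
Proof.
move=> f0; rewrite symsum_shift1 symsumS.
by have := f0 N.+1%:Z; have := f0 N.+2%:Z; lra.
Qed.

(** A window translated by m lies in the centred window enlarged by |m|, and conversely. Nonnegative
    shifts go by induction; a negative one is undone by applying that case to the translated
    sequence. *)
Lemma symsum_shift_le f (m : int) N : (forall n, 0 <= f n) ->
  symsum f N <= symsum (fun n => f (n + m)) (N + `|m|) /\
  symsum (fun n => f (n + m)) N <= symsum f (N + `|m|).
Proof.
move=> f0.
have pos (g : int -> R) (k : nat) L : (forall n, 0 <= g n) ->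
    symsum g L <= symsum (fun n => g (n + k%:Z)) (L + k) /\
    symsum (fun n => g (n + k%:Z)) L <= symsum g (L + k).
  move=> g0; elim: k L => [|k IH] L.
    rewrite addn0; have E : (fun n => g (n + 0%:Z)) = g.
      by apply/funext => n; rewrite addr0.
    by rewrite E.
  have E : (fun n => g (n + k.+1%:Z)) = (fun n => g (n + 1 + k%:Z)).
    by apply/funext => n; congr g; lia.
  have [IH1 _] := IH L; have [_ IH2] := IH L.+1.
  rewrite E; split.
    apply: (le_trans IH1); rewrite addnS.
    by apply: (@symsum_shift1_ge (fun n => g (n + k%:Z))) => n.
  rewrite addnS -addSn; apply: le_trans IH2.
  by apply: (@symsum_shift1_le (fun n => g (n + k%:Z))) => n.
case: m => k; first exact: pos.
have := pos (fun n => f (n + Negz k)) k.+1 N (fun n => f0 _).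
have E : (fun n => f (n + k.+1%:Z + Negz k)) = f.
  by apply/funext => n; congr f; rewrite NegzE; lia.
by rewrite /= E => -[h1 h2]; split.
Qed.

(** The remainder depends only on the majorant. Applied at every point t, it is uniform in t and
    hence a norm estimate in each L^p. *)
Lemma nonneg_symsum_lim f (K : R) :
  (forall n : int, 0 <= f n <= K / (`|n|.+1)%:R ^+ 4) ->
  (fun N => symsum f N) @ \oo --> limn (symsum f) /\
  forall N, symsum f N <= limn (symsum f) <= symsum f N + 2 * K / N.+1%:R.
Proof.
move=> fK; have f0 n : 0 <= f n by case/andP: (fK n).
have K0 : 0 <= K by have /andP[h1 h2] := fK 0; rewrite expr1n divr1 in h2; lra.
have tail N M : (N <= M)%N -> symsum f M <= symsum f N + 2 * K / N.+1%:R.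
  move=> NM; rewrite -lerBlDl; apply: le_trans (ler_norm _) _.
  apply: symsum_tail NM => n nN; rewrite ger0_norm//.
  have /andP[_ h] := fK n; apply: (le_trans h).
  have n0 : 0 < (`|n|%N)%:R :> R by rewrite ltr0n (leq_ltn_trans _ nN).
  rewrite ler_wpM2l// lef_pV2 ?posrE ?exprn_gt0// ?mulr_gt0//.
  by rewrite -natrX -natrM ler_nat; nia.
have cv : cvgn (symsum f).
  apply: nondecreasing_is_cvgn; first exact: symsum_nd.
  exists (symsum f 0 + 2 * K / 1%:R) => _ [M _ <-].
  exact: tail.
split=> // N; rewrite (nondecreasing_cvgn_le (symsum_nd f0) cv)/=.
by apply: limr_le => //; exists N => // M /= NM; exact: tail.
Qed.

End nonnegative_symmetric_series.

(** For a step of at most 1/2, the first multiple to reach 1/4 overshoots it by less than 1/2. If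
    alpha > 1/2, the step 1 - alpha is used, through negative multiples of alpha. *)
Lemma rotation_multiple_middle (R : realType) (alpha : R) : 0 < alpha < 1 ->
  exists k l : int, 4^-1 <= k%:~R * alpha - l%:~R <= 3 / 4.
Proof.
have H (b : R) : 0 < b -> b <= 1 / 2 -> exists n : nat, 4^-1 <= n%:R * b <= 3 / 4.
  move=> b0 b1.
  have ex : exists n : nat, 4^-1 <= n%:R * b.
    exists (Num.bound (4^-1 / b)); rewrite -ler_pdivrMr//.
    by rewrite ltW// archi_boundP// divr_ge0// ltW.
  case: (ex_minnP ex) => n h hn; exists n; rewrite h/=.
  case: n h hn => [|n] h hn; first by rewrite mul0r; lra.
  have : ~~ (4^-1 <= n%:R * b) by apply/negP => /hn; rewrite ltnn.
  by rewrite -ltNge -[n.+1%:R]natr1 mulrDl mul1r; lra.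
move=> /andP[a0 a1]; have [a2|a2] := leP alpha (1 / 2).
  have [n hn] := H alpha a0 a2; exists n%:Z, 0; rewrite subr0 -pmulrn; exact: hn.
have [n hn] := H (1 - alpha) ltac:(lra) ltac:(lra); exists (- n%:Z), (- n%:Z).
by rewrite intrN -pmulrn opprK; lra.
Qed.

Section bounded_operators.
Variables (R : realType) (p : \bar R) (p1 : (1 <= p)%E).
Local Notation mu := (lebesgue01 R).
Local Notation V := (cLspace mu p1).

Lemma bounded_operator_rnorm (S : V -> V) : bounded_operator S ->
  exists2 D : R, 0 <= D & forall u, rnorm (S u) <= D * rnorm u.
Proof.
move=> [C HC]; exists `|complex.Re C| => // u.
have := HC u; rewrite !rnormE; case: C {HC} => a b /=.
rewrite lecE/= => /andP[_]; rewrite mulr0 subr0 => /le_trans; apply.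
by rewrite ler_wpM2r ?rnorm_ge0// ler_norm.
Qed.

Lemma bounded_operator_comp (S1 S2 : V -> V) :
  bounded_operator S1 -> bounded_operator S2 -> bounded_operator (S1 \o S2).
Proof.
move=> /bounded_operator_rnorm[D1 D10 H1] /bounded_operator_rnorm[D2 D20 H2].
exists (D1 * D2)%:C => u; rewrite !rnormE -rmorphM/= lecR.
by rewrite (le_trans (H1 _))// -mulrA ler_wpM2l.
Qed.

Lemma bounded_operator_scale (a : R[i]) : bounded_operator ( *:%R a : V -> V).
Proof. by exists `|a| => u; rewrite normrZ. Qed.

End bounded_operators.

(** * The annihilated vector *)

Section orbits.
Variables (R : realType) (alpha : R).
Local Notation T := (measurableTypeR R).
Local Notation good := (good_set alpha).

(* The bilateral orbit under [e T_alpha] of the indicator function of the good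
   set, and the corresponding orbit under the transpose of [e T_alpha]. *)
Definition bishop_orbit (n : int) (t : T) : R := \1_good (t + n%:~R * alpha) *
  expR (- log_cocycle alpha (- n) (t + n%:~R * alpha)).

Definition dual_orbit (m : int) (t : T) : R := \1_good (t - m%:~R * alpha) *
  expR (log_cocycle alpha m (t - m%:~R * alpha)).

Lemma indic_ge0 (A : set R) t : 0 <= \1_A t :> R.
Proof. by rewrite indicE. Qed.

Lemma indic_le1 (A : set R) t : \1_A t <= 1 :> R.
Proof. by rewrite indicE; case: (_ \in _). Qed.

Lemma orbit_ge0 n t : 0 <= bishop_orbit n t.
Proof. by rewrite mulr_ge0 ?indic_ge0 ?expR_ge0. Qed.

Lemma dual_orbit_ge0 n t : 0 <= dual_orbit n t.
Proof. by rewrite mulr_ge0 ?indic_ge0 ?expR_ge0. Qed.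

Lemma orbit0 t : bishop_orbit 0 t = \1_good t.
Proof. by rewrite /bishop_orbit oppr0 log_cocycle0 oppr0 expR0 mulr1 mul0r addr0. Qed.

Lemma dual_orbit0 t : dual_orbit 0 t = \1_good t.
Proof. by rewrite /dual_orbit log_cocycle0 expR0 mulr1 mul0r subr0. Qed.

Let measurable_shift (a : R) : measurable_fun [set: T] (fun t : T => t + a : T).
Proof. exact: measurable_funD. Qed.

Lemma measurable_orbit n : measurable_fun [set: T] (bishop_orbit n).
Proof.
apply: measurable_funM.
  apply: (@measurableT_comp _ _ _ _ _ _ (\1_good : T -> R)); last exact: measurable_shift.
  exact: measurable_indic (measurable_good_set alpha).
apply: (measurableT_comp (@measurable_expR R)); apply: measurable_funN.
by apply: (measurableT_comp (measurable_log_cocycle alpha _)); exact: measurable_shift.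
Qed.

Lemma measurable_dual_orbit n : measurable_fun [set: T] (dual_orbit n).
Proof.
apply: measurable_funM.
  apply: (@measurableT_comp _ _ _ _ _ _ (\1_good : T -> R)); last exact: measurable_shift.
  exact: measurable_indic (measurable_good_set alpha).
apply: (measurableT_comp (@measurable_expR R)).
by apply: (measurableT_comp (measurable_log_cocycle alpha _)); exact: measurable_shift.
Qed.

Lemma indic_goodDz s (z : int) : \1_good (s + z%:~R) = \1_good s :> R.
Proof.
rewrite !indicE; congr ((nat_of_bool _)%:R).
by apply/idP/idP; rewrite !inE => /good_setDz.
Qed.

Lemma rotation_eq t : rotation alpha t = t + alpha + (- Num.floor (t + alpha))%:~R.
Proof. by rewrite /rotation /fracpart intrN. Qed.

Lemma good_fracpart_gt0 s (j : int) : good s -> 0 < fracpart (s + j%:~R * alpha).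
Proof.
move=> gs; apply: lt_le_trans (dist_int_le_fracpart _).
case: j => j.
  by apply: lt_le_trans (gs j).1; rewrite divr_gt0 ?exprn_gt0.
rewrite NegzE intrN mulNr -pmulrn.
by apply: lt_le_trans (gs j.+1).2; rewrite divr_gt0 ?exprn_gt0.
Qed.

Let fracpart_id (t : R) : 0 <= t < 1 -> fracpart t = t.
Proof. by move=> t01; apply: (@fracpart_unique R 0); rewrite ?add0r. Qed.

(** On a good orbit no point is 0, so exp(1 + ln t) = e t, unaffected by the default value of ln at
    0, and the recurrence of the cocycle applies; off the good orbits both sides vanish. *)
Lemma orbit_step n t : 0 <= t < 1 ->
  expR 1 * t * bishop_orbit n (rotation alpha t) = bishop_orbit (n + 1) t.
Proof.
move=> t01; rewrite rotation_eq /bishop_orbit.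
set z := (- Num.floor _)%:~R; set s := t + (n + 1)%:~R * alpha.
have -> : t + alpha + z + n%:~R * alpha = s + z by rewrite /s intrD; ring.
rewrite indic_goodDz log_cocycleDz indicE.
have [gs|] := boolP (s \in good); last by rewrite !mul0r mulr0.
rewrite !mul1r; rewrite inE in gs.
have sE : s + (- (n + 1))%:~R * alpha = t by rewrite /s intrN; ring.
have t0 : 0 < t.
  by have := @good_fracpart_gt0 s (- (n + 1)) gs; rewrite sE fracpart_id.
have -> : - n = - (n + 1) + 1 by rewrite opprD addrNK.
rewrite log_cocycleS sE fracpart_id// !opprD !expRD !expRN lnK ?posrE//.
by field; rewrite !gt_eqF ?expR_gt0.
Qed.

Lemma dual_orbit_step m t : 0 <= t < 1 ->
  dual_orbit (m + 1) (rotation alpha t) = expR 1 * t * dual_orbit m t.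
Proof.
move=> t01; rewrite rotation_eq /dual_orbit.
set z := (- Num.floor _)%:~R; set s := t - m%:~R * alpha.
have -> : t + alpha + z - (m + 1)%:~R * alpha = s + z by rewrite /s intrD; ring.
rewrite indic_goodDz log_cocycleDz indicE.
have [gs|] := boolP (s \in good); last by rewrite !mul0r mulr0.
rewrite !mul1r; rewrite inE in gs.
have sE : s + m%:~R * alpha = t by rewrite /s subrK.
have t0 : 0 < t.
  by have := @good_fracpart_gt0 s m gs; rewrite sE fracpart_id.
by rewrite log_cocycleS sE fracpart_id// !expRD lnK ?posrE//; ring.
Qed.

Variable w : nat -> R.
Hypothesis growth : forall s, good s -> forall j : int,
  `|log_cocycle alpha j s| <= w `|j|%N.

Lemma orbit_le n t : bishop_orbit n t <= expR (w `|n|%N).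
Proof.
rewrite /bishop_orbit indicE; have [gs|_] := boolP (_ \in _); last first.
  by rewrite mul0r expR_ge0.
rewrite mul1r ler_expR; rewrite inE in gs.
apply: (le_trans (ler_norm _)); rewrite normrN.
by have := growth gs (- n); rewrite abszN.
Qed.

Lemma dual_orbit_le n t : dual_orbit n t <= expR (w `|n|%N).
Proof.
rewrite /dual_orbit indicE; have [gs|_] := boolP (_ \in _); last first.
  by rewrite mul0r expR_ge0.
rewrite mul1r ler_expR; rewrite inE in gs.
exact: (le_trans (ler_norm _) (growth gs _)).
Qed.

End orbits.

(** Iterates the step in both directions of Z; applied to Q m n phi, the pairing of S x_n with the
    m-th dual vector of phase phi. *)
Lemma shift_relation (R : pzRingType) (Q : int -> int -> R -> R) (theta : R) :
  (forall m n phi, Q (m + 1) n phi = Q m (n + 1) (phi + theta)) ->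
  forall m n phi, Q m n phi = Q 0 (n + m) (phi + m%:~R * theta).
Proof.
move=> step; case=> m.
  elim: m => [|m IH] n phi; first by rewrite mul0r !addr0.
  rewrite -addn1 PoszD step IH intrD mulrDl mul1r -!addrA.
  by rewrite [1 + m%:Z]addrC [theta + _]addrC.
rewrite NegzE; elim: m => [|m IH] n phi.
  have := step (-1) (n - 1) (phi - theta); rewrite addNr !subrK => <-.
  by rewrite mulN1r.
have := step (- m.+2%:Z) (n - 1) (phi - theta); rewrite !subrK => <-.
have E : - m.+2%:Z = - m.+1%:Z - 1 by rewrite -[m.+2]addn1 PoszD opprD.
rewrite E subrK IH intrB mulrBl mul1r -!addrA.
by rewrite [-1 + _]addrC [- theta + _]addrC.
Qed.

Lemma quadruple_le N : (N.*2.*2.+1 <= 4 * N.+1 ^ 2)%N.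
Proof. by rewrite expnS expn1; nia. Qed.

(** * Orthogonality of Y to S X for every commuting S *)

Section annihilation.
Variables (R : realType) (alpha : R) (p : \bar R) (p1 : (1 <= p)%E).
Local Notation mu := (lebesgue01 R).
Local Notation T := (measurableTypeR R).
Local Notation V := (cLspace mu p1).
Local Notation good := (good_set alpha).
Variables (w : nat -> R) (c : int -> R) (K : R) (k l : int).
Hypothesis w_nd : forall m n, (m <= n)%N -> w m <= w n.
Hypothesis growth : forall s, good s -> forall j : int,
  `|log_cocycle alpha j s| <= w `|j|%N.
Hypothesis c0 : c 0 = 1.
Hypothesis c01 : forall n, 0 <= c n <= 1.
Hypothesis cK : forall n : int,
  c n * expR (w (`|n|.*2)%N) <= K / (`|n|.+1)%:R ^+ 4.
Hypothesis c_band : forall m : int, band_limited (pi / 4) (fun n => c n * c (m - n)).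
Hypothesis kl : 4^-1 <= k%:~R * alpha - l%:~R <= 3 / 4.

Let theta : R := pi *+ 2 * (k%:~R * alpha - l%:~R).

(** The free phase phi turns multiplication by e^(i theta) into a shift of phi, so a real-valued
    pairing suffices. *)
Let wave (phi : R) (t : T) : R[i] := cis (pi *+ 2 * k%:~R * t + phi).

Let dual (phi : R) (m : int) (t : T) : R[i] := wave phi t * (dual_orbit alpha m t)%:C.

Let x (n : int) : V := class_of p1 (fun t => (bishop_orbit alpha n t)%:C).

Let bm_orbit n : bounded_measurable (fun t => (bishop_orbit alpha n t)%:C).
Proof.
apply: (@bounded_measurable_real R _ (expR (w `|n|%N))).
  exact: measurable_orbit.
by move=> t; rewrite ger0_norm ?orbit_ge0// orbit_le.
Qed.

Let bm_dual phi m : bounded_measurable (dual phi m).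
Proof.
apply: bounded_measurableM; first exact: bounded_measurable_cis.
apply: (@bounded_measurable_real R _ (expR (w `|m|%N))).
  exact: measurable_dual_orbit.
by move=> t; rewrite ger0_norm ?dual_orbit_ge0// dual_orbit_le.
Qed.

Let dual_le phi m t : normc (dual phi m t) <= expR (w `|m|%N).
Proof.
rewrite normcM normc_cis mul1r normc_real ger0_norm ?dual_orbit_ge0//.
exact: dual_orbit_le.
Qed.

Let bishop_x n : bishop p1 alpha (x n) = (expR 1)^-1%:C *: x (n + 1).
Proof.
rewrite /x class_ofZ// (class_ofE _ (bounded_measurable_cLfun p1 (bm_orbit n))).
have b := bounded_measurableM (bounded_measurable_cst ((expR 1)^-1%:C))
  (bm_orbit (n + 1)).
rewrite bishopE (class_ofE _ (bounded_measurable_cLfun p1 b)).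
apply/toL_eqP; apply: ae_lebesgue01 => t t01 _ /=.
rewrite /bishop_map -/(rotation alpha t) -(orbit_step _ _ t01) -!rmorphM/=.
by congr (_%:C); rewrite !mulrA mulVf ?mul1r// gt_eqF ?expR_gt0.
Qed.

Let dual_step phi m t : 0 <= t < 1 ->
  dual phi (m + 1) (rotation alpha t) = (expR 1 * t)%:C * dual (phi + theta) m t.
Proof.
move=> t01; rewrite /dual dual_orbit_step// rmorphM/= mulrCA; congr (_ * (_ * _)).
rewrite /wave rotation_eq.
set z := - Num.floor _.
rewrite -(cis_period (_ + (phi + theta)) (k * z + l)); congr cis.
by rewrite /theta intrD intrM; ring.
Qed.

Let K_ge0 : 0 <= K.
Proof.
have := cK 0; rewrite c0 mul1r expr1n divr1; apply: le_trans.
exact: expR_ge0.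
Qed.

Let c_ge0 n : 0 <= c n. Proof. by case/andP: (c01 n). Qed.
Let c_le1 n : c n <= 1. Proof. by case/andP: (c01 n). Qed.

Let c_growth n : c n * expR (w `|n|%N) <= K / (`|n|.+1)%:R ^+ 4.
Proof.
apply: le_trans (cK n); rewrite ler_wpM2l// ler_expR w_nd//.
by rewrite -addnn leq_addr.
Qed.

Let orbit_series t n : 0 <= c n * bishop_orbit alpha n t <= K / (`|n|.+1)%:R ^+ 4.
Proof.
rewrite mulr_ge0 ?orbit_ge0//= (le_trans _ (c_growth n))//.
by rewrite ler_wpM2l// orbit_le.
Qed.

Let dual_series t n : 0 <= c n * dual_orbit alpha n t <= K / (`|n|.+1)%:R ^+ 4.
Proof.
rewrite mulr_ge0 ?dual_orbit_ge0//= (le_trans _ (c_growth n))//.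
by rewrite ler_wpM2l// dual_orbit_le.
Qed.

Definition orbit_sum (t : T) : R := limn (symsum (fun n => c n * bishop_orbit alpha n t)).

Definition dual_orbit_sum (t : T) : R :=
  limn (symsum (fun n => c n * dual_orbit alpha n t)).

Let series_bound N : symsum (fun n : int => K / (`|n|.+1)%:R ^+ 4) N <= 3 * K.
Proof.
have f0 n : 0 <= K / (`|n|%N.+1)%:R ^+ 4 <= K / (`|n|%N.+1)%:R ^+ 4.
  by rewrite lexx divr_ge0// exprn_ge0.
have [_ H] := nonneg_symsum_lim f0.
have /andP[h1 _] := H N; have /andP[_ h2] := H 0%N.
apply: (le_trans h1); apply: (le_trans h2).
by rewrite symsum0 expr1n !divr1; lra.
Qed.

Let limn_le3 (f : int -> R) :
  (forall n : int, 0 <= f n <= K / (`|n|.+1)%:R ^+ 4) ->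
  0 <= limn (symsum f) <= 3 * K.
Proof.
move=> fK; have [_ H] := nonneg_symsum_lim fK; have /andP[h1 h2] := H 0%N.
rewrite symsum0 divr1 in h1 h2.
by have := fK 0; rewrite expr1n divr1; lra.
Qed.

Let measurable_limn (f : int -> T -> R) : (forall n, measurable_fun setT (f n)) ->
  (forall t (n : int), 0 <= f n t <= K / (`|n|.+1)%:R ^+ 4) ->
  measurable_fun setT (fun t => limn (symsum (f ^~ t))).
Proof.
move=> mf fK; apply: (@measurable_fun_cvg _ _ _ _ (fun N t => symsum (f ^~ t) N)).
  elim=> [|N IH].
    by rewrite (_ : (fun t => _) = f 0)//; apply/funext => t; rewrite symsum0.
  rewrite (_ : (fun t => _) = (fun t => symsum (f ^~ t) N) \+
     (f N.+1%:Z \+ f (- N.+1%:Z))); last by apply/funext => t; rewrite symsumS.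
  by apply: measurable_funD => //; exact: measurable_funD.
by move=> t _; have [+ _] := nonneg_symsum_lim (fK t).
Qed.

Let bm_orbit_sum : bounded_measurable (fun t => (orbit_sum t)%:C).
Proof.
apply: (@bounded_measurable_real R _ (3 * K)).
  apply: measurable_limn => [n|t n]; last exact: orbit_series.
  by apply: measurable_funM => //; exact: measurable_orbit.
move=> t; have /andP[h1 h2] := limn_le3 (orbit_series t).
by rewrite ger0_norm.
Qed.

Definition dual_vector (t : T) : R[i] := wave 0 t * (dual_orbit_sum t)%:C.

Let bm_dual_vector : bounded_measurable dual_vector.
Proof.
apply: bounded_measurableM; first exact: bounded_measurable_cis.
apply: (@bounded_measurable_real R _ (3 * K)).
  apply: measurable_limn => [n|t n]; last exact: dual_series.
  by apply: measurable_funM => //; exact: measurable_dual_orbit.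
move=> t; have /andP[h1 h2] := limn_le3 (dual_series t).
by rewrite ger0_norm.
Qed.

Definition spectral_vector : V := class_of p1 (fun t => (orbit_sum t)%:C).

Let real_symsum (f : int -> R) N :
  symsum (fun n => (f n)%:C : R[i]) N = (symsum f N)%:C.
Proof. by rewrite -(symsum_morph (real_complex R)). Qed.

(** The window is recentred at m so that n can stand for the total index n + m of the pairing. For
    |m| <= N the doubled window still covers [-N, N] in the original index, and positivity bounds
    the remainder by the tail beyond N. *)
Let spectral_vector_approx (m : int) N : (`|m| <= N)%N ->
  rnorm (spectral_vector - symsum (fun n => (c (n - m))%:C *: x (n - m)) N.*2)
  <= 2 * K / N.+1%:R.
Proof.
move=> mN; pose f t n := c n * bishop_orbit alpha n t.
have b n : bounded_measurable (fun t => (f t (n - m))%:C).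
  rewrite (_ : (fun t => _) = fun t => (c (n - m))%:C * (bishop_orbit alpha (n - m) t)%:C).
    exact: bounded_measurableM (bounded_measurable_cst _) (bm_orbit _).
  by apply/funext => t; rewrite -rmorphM.
have -> : (fun n => (c (n - m))%:C *: x (n - m)) =
    (fun n => class_of p1 (fun t => (f t (n - m))%:C)).
  apply/funext => n; rewrite /x class_ofZ//; congr class_of.
  by apply/funext => t; rewrite -rmorphM.
have [bs ->] := class_of_symsum p1 N.*2 b.
rewrite /spectral_vector -scaleN1r class_ofZ// class_ofD//; last first.
  exact: bounded_measurableM (bounded_measurable_cst _) bs.
apply: rnorm_class_of_le => [|t].
  apply: bounded_measurableD => //.
  exact: bounded_measurableM (bounded_measurable_cst _) bs.
rewrite /= (real_symsum (fun n => f t (n - m))) mulN1r -rmorphB normc_real.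
have f0 n : 0 <= f t n by case/andP: (orbit_series t n).
have [_ H] := nonneg_symsum_lim (orbit_series t).
have [h1 _] := symsum_shift_le (- m) N f0.
have [_ h2] := symsum_shift_le (- m) N.*2 f0.
have /andP[_ h3] := H N; have /andP[h4 _] := H (N.*2 + `|- m|)%N.
have h5 : symsum (fun n => f t (n - m)) (N + `|- m|) <=
    symsum (fun n => f t (n - m)) N.*2.
  by apply: symsum_nd => //; rewrite abszN -addnn leq_add2l.
have h6 := le_trans h2 h4; have h7 := le_trans h1 h5.
rewrite ger0_norm ?subr_ge0// lerBlDl; apply: (le_trans h3).
by rewrite lerD2r.
Qed.

Let dual_vector_approx (u : V) N :
  `|pairing dual_vector u - symsum (fun m => c m * pairing (dual 0 m) u) N| <=
  2 * K / N.+1%:R * rnorm u.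
Proof.
have [bs <-] := pairing_symsumr c u N (bm_dual 0).
set YN := (fun t => symsum _ N) in bs *.
pose Z t := 1%:C * dual_vector t + (-1)%:C * YN t.
have ZE : pairing Z u = pairing dual_vector u - pairing YN u.
  by rewrite (pairing_combination _ bm_dual_vector bs erefl) mul1r mulN1r.
rewrite -ZE; apply: pairing_le => [|t].
  apply: bounded_measurableD.
    exact: bounded_measurableM (bounded_measurable_cst _) bm_dual_vector.
  exact: bounded_measurableM (bounded_measurable_cst _) bs.
rewrite /Z; have -> : YN t =
    wave 0 t * (symsum (fun n => c n * dual_orbit alpha n t) N)%:C.
  rewrite -real_symsum -symsumM; apply: eq_symsum => n.
  by rewrite /dual mulrCA -rmorphM.
rewrite /dual_vector mul1r rmorphN mulN1r -mulrBr -rmorphB normcM normc_cis mul1r.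
rewrite normc_real; have [_ H] := nonneg_symsum_lim (dual_series t).
by have /andP[h1 h2] := H N; rewrite ger0_norm ?subr_ge0// lerBlDl.
Qed.

(** The middle half of the circle is exactly what the bandwidth pi / 4 and the margin pi / 4
    leave. *)
Let theta_itv : pi / 4 + pi / 4 <= theta <= pi *+ 2 - pi / 4 - pi / 4.
Proof.
have p0 := pi_gt0 R; have /andP[h1 h2] := kl.
rewrite /theta; set y := _ - _ in h1 h2 *; rewrite mulr2n.
have h3 := ler_wpM2l (ltW p0) h1; have h4 := ler_wpM2l (ltW p0) h2.
by apply/andP; split; lra.
Qed.

(** The full convolution vanishes at theta, leaving a tail. From the decay of c, half of the fourth
    power sums the tail; exp(-w(2N)) and the other half are pulled out. *)
Let convolution_small (n : int) (tau : R) N :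
  `|symsum (fun m => c m * c (n - m) * cos (m%:~R * theta + tau)) N| <=
  2 * (K * expR (- w N.*2) / N.+1%:R ^+ 2) / N.+1%:R.
Proof.
apply: (@band_limited_sum0 R (pi / 4) (fun m => c m * c (n - m))) => //.
move=> m Nm; rewrite ger0_norm ?mulr_ge0//.
apply: (@le_trans _ _ (c m)); first by rewrite ler_piMr.
have h := cK m; rewrite -ler_pdivlMr ?expR_gt0// -expRN in h.
apply: (le_trans h).
have hw : expR (- w (`|m|.*2)%N) <= expR (- w N.*2).
  by rewrite ler_expR lerN2 w_nd// leq_double ltnW.
have m0 : (0 < `|m|)%N := leq_ltn_trans (leq0n _) Nm.
have mR : 0 < (`|m|%N)%:R :> R by rewrite ltr0n.
have mR1 : 0 < (`|m|%N.+1)%:R :> R by [].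
rewrite mulrAC -[leRHS]mulrA -invfM; apply: ler_pM.
- by rewrite mulr_ge0// expR_ge0.
- by rewrite invr_ge0 exprn_ge0.
- by rewrite ler_wpM2l.
rewrite lef_pV2 ?posrE ?mulr_gt0 ?exprn_gt0//.
rewrite -!natrX -!natrM ler_nat -[4%N]/(2 + 2)%N expnD leq_mul//.
  by rewrite leq_exp2r// ltnS ltnW.
by rewrite expnS expn1 leq_mul2r leqnSn orbT.
Qed.

Section operator.
Variable S : {linear V -> V}.
Hypothesis S_bounded : bounded_operator S.
Hypothesis S_comm : forall u, S (bishop p1 alpha u) = bishop p1 alpha (S u).

Let Q (m n : int) (phi : R) : R := pairing (dual phi m) (S (x n)).

Let Q_step m n phi : Q (m + 1) n phi = Q m (n + 1) (phi + theta).
Proof.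
have b1 := bm_dual (phi + theta) m; have b2 := bm_dual phi (m + 1).
rewrite /Q (pairing_bishop _ b1 b2 (dual_step phi m)).
by rewrite -S_comm bishop_x linearZ/= pairingZ// mulrA mulfV ?mul1r// gt_eqF ?expR_gt0.
Qed.

Let Q_shift m n phi : Q m n phi = Q 0 (n + m) (phi + m%:~R * theta).
Proof. exact: (shift_relation Q_step). Qed.

(** Splits off real and imaginary parts, phases 0 and pi / 2, so that cos(m theta) and sin(m theta)
    leave the pairing. *)
Let Q_phase n phi : Q 0 n phi =
  cos phi * Q 0 n 0 + sin phi * Q 0 n (pi / 2).
Proof.
apply: pairing_combination => //; apply/funext => t.
rewrite /dual /wave addr0 !cisD !mulrA -!mulrDl; congr (_ * _).
rewrite [cis phi](_ : _ = (cos phi)%:C + (sin phi)%:C * cis (pi / 2)); first by ring.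
by rewrite /cis cos_pihalf sin_pihalf /=; congr (_ +i* _); ring.
Qed.

(** A bound O(1/(N+1)) is proved for every N. Truncating Y and X leaves a finite double sum; at
    fixed total index n, the pairings reduce to Q 0 n with phase m theta, and the sum over m is a
    truncated convolution. *)
Lemma pairing_spectral_vector : pairing dual_vector (S spectral_vector) = 0.
Proof.
have [D D0 HD] := bounded_operator_rnorm S_bounded.
pose E0 := expR (w 0%N).
have E00 : 0 <= E0 by exact: expR_ge0.
pose rX := rnorm (S spectral_vector).
have rX0 : 0 <= rX by exact: rnorm_ge0.
have QE n phi : `|Q 0 n phi| <= E0 * (D * expR (w `|n|%N)).
  apply: le_trans (pairing_le _ (bm_dual phi 0) (dual_le phi 0)) _.
  rewrite ler_wpM2l ?expR_ge0//; apply: (le_trans (HD _)); rewrite ler_wpM2l//.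
  apply: rnorm_class_of_le => // t.
  by rewrite normc_real ger0_norm ?orbit_ge0// orbit_le.
(* The three terms come from truncating Y, from truncating X, and from the convolutions. *)
pose Ctot := 2 * K * rX + 6 * K * (K * D) + 16 * (E0 * D * K).
suff bound N : `|pairing dual_vector (S spectral_vector)| <= Ctot / N.+1%:R.
  apply/eqP; rewrite -normr_le0 leNgt; apply/negP => P0.
  have C0 : 0 <= Ctot.
    have := bound 0%N; rewrite divr1; exact: le_trans (normr_ge0 _).
  have := archi_boundP (divr_ge0 C0 (ltW P0)).
  set N := Num.bound _ => HN.
  have := bound N; rewrite ler_pdivlMr// => h.
  have : Ctot < `|pairing dual_vector (S spectral_vector)| * N.+1%:R.
    rewrite mulrC -ltr_pdivrMr//; apply: (lt_le_trans HN).
    by rewrite ler_nat.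
  by move=> /(le_lt_trans h); rewrite ltxx.
have N0 : 0 < N.+1%:R :> R by [].
pose P m := pairing (dual 0 m) (S spectral_vector).
pose P' m := symsum (fun n => c (n - m) * Q m (n - m) 0) N.*2.
have PP' m : (`|m| <= N)%N ->
    `|c m * P m - c m * P' m| <= K / (`|m|%N.+1)%:R ^+ 4 * (D * (2 * K / N.+1%:R)).
  move=> mN; rewrite -mulrBr normrM ger0_norm//.
  have -> : P m - P' m = pairing (dual 0 m) (S (spectral_vector -
      symsum (fun n => (c (n - m))%:C *: x (n - m)) N.*2)).
    rewrite linearB/= pairingB// (symsum_morph S) pairing_symsum//; congr (_ - _).
    by apply: eq_symsum => n; rewrite /= linearZ /= pairingZ.
  apply: (@le_trans _ _ (c m * (expR (w `|m|%N) * (D * (2 * K / N.+1%:R))))).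
    rewrite ler_wpM2l//; apply: (le_trans (pairing_le _ (bm_dual 0 m) (dual_le 0 m))).
    rewrite ler_wpM2l ?expR_ge0//; apply: (le_trans (HD _)); rewrite ler_wpM2l//.
    exact: spectral_vector_approx.
  by rewrite mulrA ler_wpM2r ?c_growth// mulr_ge0// divr_ge0// mulr_ge0.
have sumPP' : `|symsum (fun m => c m * P m) N - symsum (fun m => c m * P' m) N| <=
    6 * K * (K * D) / N.+1%:R.
  rewrite -[X in _ - X]mul1r -mulNr -symsumM -symsumD.
  apply: (le_trans (ler_norm_symsum _ _)).
  apply: (@le_trans _ _ (symsum (fun m => D * (2 * K / N.+1%:R) *
      (K / (`|m|%N.+1)%:R ^+ 4)) N)).
    apply: ler_symsum_bound => m mN; rewrite mulN1r [leRHS]mulrC; exact: PP'.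
  rewrite symsumM.
  apply: (@le_trans _ _ (D * (2 * K / N.+1%:R) * (3 * K))).
    by rewrite ler_wpM2l// mulr_ge0// divr_ge0// mulr_ge0.
  by rewrite le_eqVlt; apply/orP; left; apply/eqP; field; lra.
(* Over 4N+1 values of n, |Q 0 n| is at most E0 D exp(w(2N)). The convolutions carry
   exp(-w(2N))/(N+1)^3, which cancels the exponential and outweighs the count. *)
have sumP' : `|symsum (fun m => c m * P' m) N| <= 16 * (E0 * D * K) / N.+1%:R.
  pose G tau n := symsum (fun m => c m * c (n - m) * cos (m%:~R * theta + tau)) N.
  have -> : symsum (fun m => c m * P' m) N =
      symsum (fun n => Q 0 n 0 * G 0 n + Q 0 n (pi / 2) * G (- (pi / 2)) n) N.*2.
    transitivity (symsum (fun m => symsum (fun n =>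
        c m * (c (n - m) * Q m (n - m) 0)) N.*2) N).
      by apply: eq_symsum => m; rewrite symsumM.
    rewrite exchange_symsum; apply: eq_symsum => n.
    rewrite -!symsumM -symsumD; apply: eq_symsum => m.
    rewrite Q_shift subrK add0r Q_phase addr0 cosBpihalf.
    move: (Q 0 n 0) (Q 0 n (pi / 2)) (c m) (c (n - m)) => q1 q2 c1 c2; ring.
  apply: (le_trans (ler_norm_symsum _ _)).
  pose g := 2 * (K * expR (- w N.*2) / N.+1%:R ^+ 2) / N.+1%:R.
  have g0 : 0 <= g.
    by rewrite divr_ge0// mulr_ge0// divr_ge0 ?exprn_ge0// mulr_ge0// expR_ge0.
  apply: (@le_trans _ _ (symsum (fun=> 2 * (E0 * (D * expR (w N.*2)) * g)) N.*2)).
    apply: ler_symsum_bound => n nN.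
    have hQ phi : `|Q 0 n phi| <= E0 * (D * expR (w N.*2)).
      apply: (le_trans (QE n phi)); rewrite ler_wpM2l// ler_wpM2l// ler_expR.
      exact: w_nd.
    apply: (le_trans (ler_normD _ _)); rewrite !normrM [leRHS]mulr_natl mulr2n.
    by apply: lerD; apply: ler_pM => //; exact: convolution_small.
  rewrite symsum_cst /g expRN.
  set e := expR _; have e0 : 0 < e by exact: expR_gt0.
  have -> : 2 * (E0 * (D * e) * (2 * (K * e^-1 / N.+1%:R ^+ 2) / N.+1%:R)) *
      (N.*2.*2.+1)%:R = 4 * (E0 * D * K) * ((N.*2.*2.+1)%:R / N.+1%:R ^+ 3).
    by field; lra.
  have -> : 16 * (E0 * D * K) / N.+1%:R = 4 * (E0 * D * K) * (4 / N.+1%:R).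
    by field; lra.
  rewrite ler_wpM2l ?mulr_ge0// ler_pdivrMr ?exprn_gt0//.
  have -> : 4 / N.+1%:R * N.+1%:R ^+ 3 = 4 * N.+1%:R ^+ 2 :> R by field; lra.
  by rewrite -natrX -natrM ler_nat quadruple_le.
have := dual_vector_approx (S spectral_vector) N; rewrite -/rX.
move: sumPP' sumP'; rewrite -/(P _); set A := symsum _ N; set B := symsum _ N.
rewrite /Ctot; set z := pairing dual_vector _ => h1 h2 h3.
have -> : z = (z - A) + (A - B) + B by ring.
apply: (le_trans (ler_normD _ _)); rewrite [leRHS]mulrDl lerD//.
apply: (le_trans (ler_normD _ _)); rewrite [leRHS]mulrDl lerD//.
by rewrite mulrAC.
Qed.

End operator.

Lemma bounded_measurable_dual_vector : bounded_measurable dual_vector.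
Proof. exact: bm_dual_vector. Qed.

Lemma indic_le_orbit_sum t : \1_good t <= orbit_sum t.
Proof.
have [_ H] := nonneg_symsum_lim (orbit_series t).
by have /andP[+ _] := H 0%N; rewrite symsum0 c0 mul1r orbit0.
Qed.

Lemma indic_le_dual_orbit_sum t : \1_good t <= dual_orbit_sum t.
Proof.
have [_ H] := nonneg_symsum_lim (dual_series t).
by have /andP[+ _] := H 0%N; rewrite symsum0 c0 mul1r dual_orbit0.
Qed.

Lemma spectral_vector_neq0 : spectral_vector <> 0.
Proof.
rewrite /spectral_vector (class_ofE _ (bounded_measurable_cLfun p1 bm_orbit_sum)).
move=> /toL_eqP[N [mN N0 sub]].
have gN : good `<=` N.
  move=> t gt; apply: sub => /= h.
  have {}h := h I; move: (indic_le_orbit_sum t).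
  have -> : orbit_sum t = 0 by move: h => [].
  by rewrite indicE mem_set//= ler10.
have : (mu good <= mu N)%E.
  by apply: le_measure; rewrite ?inE//; exact: measurable_good_set.
by rewrite N0 leNgt (good_set_measure alpha).
Qed.

(** Testing against the conjugate wave restricted to the good set undoes the twist and leaves a
    nonnegative integrand, at least 1 on a set of positive measure. *)
Lemma dual_vector_neq0 : exists u : V, pairing dual_vector u <> 0.
Proof.
pose g t : R[i] := cis (- (pi *+ 2 * k%:~R) * t + 0) * (\1_good t)%:C.
have mind : measurable_fun setT (\1_good : T -> R).
  exact: measurable_indic (measurable_good_set alpha).
have bind : bounded_measurable (fun t : T => (\1_good t : R)%:C).
  apply: (@bounded_measurable_real R _ 1) => // t.
  by rewrite ger0_norm ?indic_ge0 ?indic_le1.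
have bg : bounded_measurable g.
  by apply: bounded_measurableM bind; exact: bounded_measurable_cis.
exists (class_of p1 g); rewrite pairing_class_of//.
have I1 := integrable_pairing (CLfun p1 (bounded_measurable_cLfun p1 bg)) bm_dual_vector.
have I2 := integrable_pairing (CLfun p1 (bounded_measurable_cLfun p1 bind))
  (bounded_measurable_cst 1).
have gE t : complex.Re (g t * dual_vector t) = \1_good t * dual_orbit_sum t.
  have -> : g t * dual_vector t = (\1_good t * dual_orbit_sum t)%:C.
    rewrite /g /dual_vector /wave mulrACA -cisD -rmorphM addr0 addr0 mulNr addNr.
    by rewrite /cis cos0 sin0 mul1r.
  by [].
have iE t : complex.Re ((\1_good t : R)%:C * 1) = \1_good t by rewrite mulr1.
have := le_Rintegral measurableT I2 I1.
have -> : Rintegral mu setT (fun t => complex.Re ((\1_good t : R)%:C * cst 1 t)) =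
    fine (mu good).
  transitivity (Rintegral mu setT (\1_good : T -> R)).
    by apply: eq_Rintegral => t _; exact: iE.
  rewrite /Rintegral (integral_indic mu measurableT (measurable_good_set alpha)).
  by rewrite setIT.
move=> h e; have {}h : fine (mu good) <= 0.
  rewrite -e; apply: h => t _.
  rewrite -[leLHS]/(complex.Re ((\1_good t : R)%:C * 1)) iE.
  rewrite -[leRHS]/(complex.Re (g t * dual_vector t)) gE.
  have := indic_le_dual_orbit_sum t; rewrite indicE.
  by case: (t \in good) => /= h1; rewrite ?mul1r// mul0r.
have : 0 < fine (mu good); last by rewrite ltNge h.
rewrite fine_gt0// (good_set_measure alpha)/=.
apply: (@le_lt_trans _ _ (mu setT)); last by rewrite lebesgue01_setT ltry.
by apply: le_measure; rewrite ?inE//; exact: measurable_good_set.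
Qed.

End annihilation.

(** Applied to the weight w(2n) + 4 ln(n+1): the doubled argument matches the doubled windows, the
    logarithm yields the fourth power, and ln(2^j + 1) <= j + 1 keeps the dyadic sum finite. *)
Lemma spectral_coefficients (R : realType) (w : nat -> R) (B : R) :
  (forall n, 0 <= w n) -> (forall m n, (m <= n)%N -> w m <= w n) ->
  (forall J, \sum_(j < J) w (2 ^ j)%N / 2 ^+ j <= B) ->
  exists (c : int -> R) (K : R), [/\ c 0 = 1, forall n, 0 <= c n <= 1,
    forall n : int, c n * expR (w (`|n|.*2)%N) <= K / (`|n|.+1)%:R ^+ 4 &
    forall k : int, band_limited (pi / 4) (fun n => c n * c (k - n))].
Proof.
move=> w0 wnd wB; pose v n : R := w n.*2 + 4 * ln n.+1%:R.
have v0 n : 0 <= v n by rewrite addr_ge0// mulr_ge0// ln_ge0// ler1n.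
have vnd m n : (m <= n)%N -> v m <= v n.
  move=> mn; rewrite lerD ?wnd ?leq_double// ler_wpM2l// ler_ln ?posrE//.
  by rewrite ler_nat ltnS.
have p2 j : 0 < 2 ^+ j :> R by rewrite exprn_gt0.
have vB J : \sum_(j < J) v (2 ^ j)%N / 2 ^+ j <= 2 * B + 4 * 4.
  apply: (@le_trans _ _ (\sum_(j < J) (2 * (w (2 ^ j.+1)%N / 2 ^+ j.+1) +
      4 * (j.+1%:R / 2 ^+ j)))).
    apply: ler_sum => j _; rewrite mulrDl -mul2n -expnS; apply: lerD.
      by rewrite exprS [leRHS](_ : _ = w (2 ^ j.+1)%N / 2 ^+ j)//; field; rewrite gt_eqF.
    rewrite -mulrA ler_wpM2l// ler_wpM2r ?invr_ge0 ?(ltW (p2 _))//.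
    apply: (@le_trans _ _ (ln (2 ^+ j.+1))).
      rewrite ler_ln ?posrE// -natrX ler_nat expnS mul2n -addnn -addn1 leq_add2l.
      by rewrite expn_gt0.
    rewrite lnXn// -[leLHS]mulr_natl -[leRHS]mulr1 ler_wpM2l//; exact: ln2_le1.
  rewrite big_split/= -!mulr_sumr; apply: lerD.
    rewrite ler_pM2l//; apply: le_trans (wB J.+1).
    by rewrite big_ord_recl lerDr divr_ge0// ltW.
  rewrite ler_pM2l//.
  suff -> : \sum_(j < J) j.+1%:R / 2 ^+ j = 4 - (2 * J%:R + 4) / 2 ^+ J :> R.
    by rewrite gerBl divr_ge0 ?(ltW (p2 _))// addr_ge0// mulr_ge0.
  elim: J => [|J IH]; first by rewrite big_ord0 expr0 divr1 mulr0 add0r subrr.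
  by rewrite big_ord_recr/= IH exprS -[J.+1%:R]natr1; field; rewrite gt_eqF.
have [c [K [c0 c01 cK cb]]] := decaying_coefficients v0 vnd vB.
exists c, K; split => // n; have := cK n.
have -> : expR (- v `|n|%N) = (expR (w `|n|.*2))^-1 * (`|n|.+1%:R ^+ 4)^-1.
  by rewrite /v expRN expRD expRM_natl lnK ?posrE// invfM.
by rewrite mulrCA mulrC ler_pdivlMr ?expR_gt0.
Qed.

(** * The hyperinvariant subspace *)

Theorem theorem3p7 (R : realType) (alpha : R)
    (alpha01 : 0 < alpha < 1) (alpha_irr : irrational alpha)
    (den_growth : exists C : R, \forall j \near \oo,
      ln (convergent_den alpha j.+1) <=
      C * (convergent_den alpha j / ln (convergent_den alpha j) ^+ 3))
    (p : \bar R) (p1 : (1 <= p)%E) :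
  exists M : set (cLspace (lebesgue01 R) p1),
    [/\ closed_subspace M, hyperinvariant (bishop p1 alpha) M
      & nontrivial_subspace M].
Proof.
have [w [B [w0 wnd wB growth]]] := log_cocycle_growth alpha01 alpha_irr den_growth.
have [c [K [c0 c01 cK cb]]] := spectral_coefficients w0 wnd wB.
have [k [l kl]] := rotation_multiple_middle alpha01.
set V := cLspace (lebesgue01 R) p1; set T := bishop p1 alpha.
pose Y := dual_vector alpha c k.
have bY : bounded_measurable Y.
  exact: bounded_measurable_dual_vector wnd growth c01 cK.
pose X : V := spectral_vector alpha p1 c.
have XY (S : {linear V -> V}) : bounded_operator S ->
    (forall u, S (T u) = T (S u)) -> pairing Y (S X) = 0.
  by move=> bS cS; exact: (pairing_spectral_vector wnd growth c0 c01 cK cb kl bS cS).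
pose M : set V := [set u | forall S : {linear V -> V}, bounded_operator S ->
  (forall v, S (T v) = T (S v)) -> pairing Y (S u) = 0].
(* The pairing is only real-linear in u; complex scalars are absorbed by passing from S to a S,
   which also commutes. *)
have MZ (a : R[i]) u : M u -> M (a *: u).
  move=> Mu S bS cS; rewrite linearZ.
  pose S' : {linear V -> V} := ( *:%R a : V -> V) \o S.
  apply: (Mu S'); first exact: bounded_operator_comp (bounded_operator_scale _ _) bS.
  by move=> v /=; rewrite cS /T linearZ.
exists M; split.
- split.
    split; first by rewrite inE => S bS cS; rewrite linear0 pairing0.
    move=> a u v; rewrite !inE => Mu Mv S bS cS.
    by rewrite linearD pairingD// (MZ a u Mu S)// Mv// addr0.
  move=> u cu S bS cS.
  have [D D0 HD] := bounded_operator_rnorm bS.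
  have [C YC] := bY.2.
  have C0 : 0 <= C := le_trans (normc_ge0 _) (YC 0).
  (* The functional sending u to the pairing with S u is Lipschitz with constant C D; the 1 keeps
     the radius e / (C D + 1) meaningful when C D = 0. *)
  have CD1 : 0 < C * D + 1 by rewrite ltr_wpDl// mulr_ge0.
  apply/eqP; rewrite -normr_le0; apply/ler_addgt0Pr => e e0; rewrite add0r.
  have d0 : 0 < (e / (C * D + 1))%:C by rewrite ltcR divr_gt0.
  have [v [Mv]] := cu _ (nbhsx_ballx u _ d0).
  rewrite -ball_normE/= => uv.
  have {}uv : rnorm (u - v) < e / (C * D + 1) by move: uv; rewrite rnormE ltcR.
  have -> : pairing Y (S u) = pairing Y (S (u - v)).
    by rewrite linearB pairingB// Mv// subr0.
  apply: (le_trans (pairing_le _ bY YC)).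
  apply: (@le_trans _ _ (C * (D * (e / (C * D + 1))))).
    rewrite ler_wpM2l//; apply: (le_trans (HD _)); rewrite ler_wpM2l//.
    exact: ltW.
  rewrite mulrA mulrCA ger_pMr// ler_pdivrMr// mul1r; lra.
- move=> S bS cS u Mu S' bS' cS'.
  pose S'' : {linear V -> V} := S' \o S.
  apply: (Mu S''); first exact: bounded_operator_comp.
  by move=> v /=; rewrite cS cS'.
- split.
    move=> M0; apply: (@spectral_vector_neq0 _ _ _ p1 _ _ _ wnd growth c0 c01 cK).
    have : M X by move=> S bS cS; exact: XY.
    by rewrite M0.
  move=> MT; have [u] := dual_vector_neq0 p1 k wnd growth c0 c01 cK; apply.
  have : M u by rewrite MT.
  pose S : {linear V -> V} := idfun.
  move=> /(_ S); apply => //.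
  by exists 1 => v; rewrite mul1r.
Qed.
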